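(* For any $0<p_0,q_0,r_0\le\infty$ we have the following (strong) factorizations: $F_1)$ $T^{p_0,r_0}_{q_0}\rightarrow T^{p_0,\infty}_{q_0}\cdot T^{\infty,r_0}_\infty$; $F_2)$ $T^{p_0,r_0}_{q_0}\rightarrow T^{p_0,\infty}_{\infty}\cdot T^{\infty,r_0}_{q_0}$; $F_3)$ $T^{p_0,r_0}_{q_0}\rightarrow T^{p_0,\infty}_{\infty}\cdot T^{\infty,\infty}_{q_0}\cdot T^{\infty,r_0}_{\infty}$.
   Context: Let $\mathbb{R}^{n+1}_+=\mathbb{R}^n\times(0,\infty)$ with Lebesgue measure; functions are complex-valued measurable, identified a.e. For $(y,t)\in\mathbb{R}^{n+1}_+$, $B(y,t)=\{z\in\mathbb{R}^n:|z-y|<t\}$, $\Gamma(x)=\{(y,t):|y-x|<t\}$, and $\widehat{B}=\{(y,t):B(y,t)\subset B\}$ for an open ball $B$. Fix Whitney parameters $0<\alpha_1<\alpha_2^{-1}<1$ and $W(y,t)=\{(z,s):|z-y|<\alpha_1t,\ \alpha_2^{-1}t<s<\alpha_2t\}$; $\mathcal{W}_r(f)(y,t)=|W(y,t)|^{-1/r}\|f\|_{L^r(W(y,t))}$ ($0<r<\infty$), $\mathcal{W}_\infty(f)(y,t)=\operatorname{ess\,sup}_{W(y,t)}|f|$. Tent spaces $T^p_q$: (A) $p,q<\infty$: $\|g\|=\|(\iint_{\Gamma(x)}|g|^q\,dy\,dt/t^{n+1})^{1/q}\|_{L^p(dx)}$; (B) $q<p=\infty$: $\|g\|=\sup_x\sup_{B\ni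 x}|B|^{-1/q}(\iint_{\widehat B}|g|^q\,dy\,dt/t)^{1/q}$; (C) $p<q=\infty$: $\|g\|=\|\sup_{(y,t)\in\Gamma(x)}|g(y,t)|\|_{L^p(dx)}$; (D) $T^\infty_\infty=L^\infty$. $T^{p,r}_q$ is the space of $f$ with $\|f\|_{T^{p,r}_q}=\|\mathcal{W}_r(f)\|_{T^p_q}<\infty$. Factorization: $X_0\rightarrow X_1\cdots X_m$ means that for every $f_0\in X_0$ there exist $f_i\in X_i$ ($1\le i\le m$) with $|f_0|=|f_1|\cdots|f_m|$ a.e. and $\|f_1\|_{X_1}\cdots\|f_m\|_{X_m}\le C\|f_0\|_{X_0}$ with $C$ independent of the functions. *)

(* Defs.v *)
From HB Require Import structures.
From mathcomp Require Import all_boot all_order all_algebra.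
From mathcomp Require Import all_classical all_reals all_analysis.
From mathcomp Require Import complex.

Set Implicit Arguments.
Unset Strict Implicit.
Unset Printing Implicit Defensive.

Import Order.TTheory GRing.Theory Num.Theory.
Local Open Scope classical_set_scope.
Local Open Scope ring_scope.

Section TentSpaces.
Variable R : realType.

(* Points of R^n are n-tuples of reals (product Borel sigma-algebra);
   points of R^{n+1}_+ are pairs (y,t) : n.-tuple R * R with 0 < t. *)
Definition pt (n : nat) := (n.-tuple R * R)%type.

Definition cabs (z : R[i]) : R := ComplexField.Normc.normc z.

(* Lebesgue integral on R^n of a nonnegative extended-real function,
   computed as an iterated one-dimensional Lebesgue integral (Tonelli). *)
Fixpoint intRn (n : nat) : (n.-tuple R -> \bar R) -> \bar R :=
  match n return (n.-tuple R -> \bar R) -> \bar R with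
  | 0 => fun f => f [tuple]
  | m.+1 => fun f =>
      (\int[@lebesgue_measure R]_x intRn (fun y : m.-tuple R => f (cons_tuple x y)))%E
  end.

Definition intH (n : nat) (F : pt n -> \bar R) : \bar R :=
  intRn (fun y : n.-tuple R =>
    (\int[@lebesgue_measure R]_(t in [set t : R | (0 < t)%R]) F (y, t))%E).

Definition volRn (n : nat) (A : set (n.-tuple R)) : \bar R :=
  intRn (fun y => (\1_A y)%:E).
Definition volH (n : nat) (A : set (pt n)) : \bar R :=
  intH (fun z => (\1_A z)%:E).

Definition nullH (n : nat) (N : set (pt n)) : Prop :=
  exists M : set (pt n), measurable M /\ N `<=` M /\ volH M = 0%E.

Definition Hp (n : nat) : set (pt n) := [set z | 0 < z.2].

Definition edist (n : nat) (z y : n.-tuple R) : R :=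
  Num.sqrt (\sum_(i < n) (tnth z i - tnth y i) ^+ 2).
Definition ballRn (n : nat) (y : n.-tuple R) (t : R) : set (n.-tuple R) :=
  [set z | edist z y < t].

Definition cone (n : nat) (x : n.-tuple R) : set (pt n) :=
  [set z | 0 < z.2 /\ edist z.1 x < z.2].
Definition tent (n : nat) (c : n.-tuple R) (rho : R) : set (pt n) :=
  [set z | 0 < z.2 /\ ballRn z.1 z.2 `<=` ballRn c rho].
Definition whitney (a1 a2 : R) (n : nat) (y : n.-tuple R) (t : R) : set (pt n) :=
  [set z | edist z.1 y < a1 * t /\ a2^-1 * t < z.2 /\ z.2 < a2 * t].

Definition esssupH (n : nat) (A : set (pt n)) (g : pt n -> \bar R) : \bar R :=
  ereal_inf [set M : \bar R | nullH [set z | A z /\ (M < g z)%E]].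

Definition Wavg (a1 a2 : R) (n : nat) (r : \bar R) (f : pt n -> R[i])
  (z : pt n) : \bar R :=
  let W := whitney a1 a2 z.1 z.2 in
  match r with
  | r'%:E =>
      poweR ((fine (volH W))^-1%:E *
             intH (fun w => ((\1_W w) * powR (cabs (f w)) r')%:E))%E r'^-1
  | +oo%E => esssupH W (fun w => (cabs (f w))%:E)
  | -oo%E => 0%E
  end.

Definition tentN (n : nat) (p q : \bar R) (g : pt n -> \bar R) : \bar R :=
  match p, q with
  | p'%:E, q'%:E =>
      poweR (intRn (fun x =>
        poweR (intH (fun z =>
          ((\1_(cone x) z)%:E * poweR (g z) q' * (z.2 ^- n.+1)%:E)%E))
          (p' / q'))) p'^-1
  | +oo%E, q'%:E =>
      ereal_sup [set v : \bar R | exists (x c : n.-tuple R) (rho : R),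
        [/\ 0 < rho, ballRn c rho x &
        v = (((fine (volRn (ballRn c rho))) `^ (- q'^-1))%:E *
            poweR (intH (fun z =>
              ((\1_(tent c rho) z)%:E * poweR (g z) q' * (z.2^-1)%:E)%E)) q'^-1)%E]]
  | p'%:E, +oo%E =>
      poweR (intRn (fun x => poweR (ereal_sup (g @` cone x)) p')) p'^-1
  | +oo%E, +oo%E => esssupH (@Hp n) g
  | _, _ => 0%E
  end.

Definition cmeasurable (n : nat) (f : pt n -> R[i]) : Prop :=
  measurable_fun (@Hp n) (fun z => complex.Re (f z)) /\
  measurable_fun (@Hp n) (fun z => complex.Im (f z)).

Definition tnorm (a1 a2 : R) (n : nat) (p r q : \bar R) (f : pt n -> R[i]) : \bar R :=
  tentN p q (Wavg a1 a2 r f).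
Definition inT (a1 a2 : R) (n : nat) (p r q : \bar R) (f : pt n -> R[i]) : Prop :=
  cmeasurable f /\ (tnorm a1 a2 p r q f < +oo)%E.

Definition ae_absH (n : nat) (g h : pt n -> R) : Prop :=
  nullH [set z | 0 < z.2 /\ g z <> h z].

(* A space T^{p,r}_q is described by its exponent triple (p, r, q). *)
Definition tsp := (\bar R * \bar R * \bar R)%type.
Definition tN (a1 a2 : R) (n : nat) (X : tsp) := @tnorm a1 a2 n X.1.1 X.1.2 X.2.
Definition tin (a1 a2 : R) (n : nat) (X : tsp) := @inT a1 a2 n X.1.1 X.1.2 X.2.

Definition factor2 (a1 a2 : R) (n : nat) (X0 X1 X2 : tsp) : Prop :=
  exists C : R, forall f0 : pt n -> R[i], tin a1 a2 X0 f0 ->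
    exists f1 f2 : pt n -> R[i],
      [/\ tin a1 a2 X1 f1, tin a1 a2 X2 f2,
          ae_absH (fun z => cabs (f0 z)) (fun z => cabs (f1 z) * cabs (f2 z)) &
          (tN a1 a2 X1 f1 * tN a1 a2 X2 f2 <= C%:E * tN a1 a2 X0 f0)%E].

Definition factor3 (a1 a2 : R) (n : nat) (X0 X1 X2 X3 : tsp) : Prop :=
  exists C : R, forall f0 : pt n -> R[i], tin a1 a2 X0 f0 ->
    exists f1 f2 f3 : pt n -> R[i],
      [/\ tin a1 a2 X1 f1, tin a1 a2 X2 f2, tin a1 a2 X3 f3,
          ae_absH (fun z => cabs (f0 z))
                  (fun z => cabs (f1 z) * cabs (f2 z) * cabs (f3 z)) &
          (tN a1 a2 X1 f1 * tN a1 a2 X2 f2 * tN a1 a2 X3 f3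
             <= C%:E * tN a1 a2 X0 f0)%E].

End TentSpaces.

(* Main.v *)
(* Let g be the Whitney average of f0.  It satisfies a sub-mean value inequality
   g(z)^q <= C t^(-n-1) int_V g^q over an enlarged Whitney region V, for every q
   and whatever r is, because a Whitney box is covered by boundedly many cells and
   one of them carries a fixed part of the average.

   F1 (q finite): f1 is the q-mean of g over enlarged Whitney regions, so that
   f2 = f0 / f1 has bounded averages.  The norm of f1 is bounded by a change of
   aperture when p is finite, and by Fubini on tents otherwise.

   F2 (p, q finite): let A be the area functional of g and f1(y,t) the (p/2)-mean of
   A over a ball of radius comparable to t.  The norm of f1 is bounded by the maximal
   theorem in L^2.  By Chebyshev A <= C f1(y,t) on half of B(y,t), so the averages of
   f2 = f0 / f1 satisfy (W f2)^q <= C g^q |B|^-1 int_B A^-q, and Fubini bounds the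
   tent integrals of the right-hand side by the volume of the ball.  When q is
   infinite, the supremum of g over cones replaces A, which proves F1 as well.

   F3 is F1 followed by F2 with r infinite. *)

Require Import Defs.
From HB Require Import structures.
From mathcomp Require Import all_boot all_order all_algebra.
From mathcomp Require Import all_classical all_reals all_analysis.
From mathcomp Require Import complex measurable_realfun ring lra.
Import Order.TTheory GRing.Theory Num.Theory.
Import numFieldNormedType.Exports.
Local Open Scope ring_scope.

(** This explains three choices: means of order [p / 2], whose maximal function is used in L^2
    however small [p] is; a separate argument for [s <= 1] in the change of aperture; and
    Chebyshev's inequality on half a ball, which bounds a negative power of a mean by the mean of a
    negative power.

    Apart from the constant factor used when [p] is infinite, [f1] is a mean built from [g] and [f2]
    is the quotient. Two degenerate values of [f1] then need care: infinity, excluded by the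
    finiteness of the norm of [f0], and zero, which has to force [f0] to vanish almost everywhere
    nearby.

    The norms are iterated integrals. They are rewritten with measures [mu] on R^n and [nu] on its
    product with R, so that Tonelli's theorem can exchange points and cones; integrands on the
    half-space are extended by zero. Cubes replace Euclidean balls wherever possible, their measure
    being explicit. *)

Section TentSpaceFactorization.
Set Implicit Arguments.
Unset Strict Implicit.
Unset Printing Implicit Defensive.
Local Open Scope classical_set_scope.
Local Open Scope ereal_scope.

(** * Lebesgue measure on R^n *)

Section ProductSigmaFinite.

(** Tonelli's theorem asks for sigma-finiteness, and the measures below are iterated products.
    Nondecreasing exhausting sequences let a single index serve both coordinates. *)
Lemma product_sigma_finite d1 d2 (T1 : measurableType d1) (T2 : measurableType d2)
    (R : realType) (m1 : {sigma_finite_measure set T1 -> \bar R})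
    (m2 : {sigma_finite_measure set T2 -> \bar R}) :
  sigma_finite setT (m1 \x m2).
Proof.
have /sigma_finiteP[F [TF ndF Ffin]] := @sigma_finiteT _ _ _ m1.
have /sigma_finiteP[G [TG ndG Gfin]] := @sigma_finiteT _ _ _ m2.
exists (fun k => F k `*` G k).
  apply/seteqP; split=> [[x y] _|//].
  have [i _ Fx] : (\bigcup_k F k) x by rewrite -TF.
  have [j _ Gy] : (\bigcup_k G k) y by rewrite -TG.
  exists (maxn i j) => //; split => /=.
  - by move/subsetPset: (ndF _ _ (leq_maxl i j)); apply.
  - by move/subsetPset: (ndG _ _ (leq_maxr i j)); apply.
move=> k; have [mF Fk] := Ffin k; have [mG Gk] := Gfin k; split.
  exact: measurableX.
by rewrite product_measure1E// lte_mul_pinfty// ge0_fin_numE.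
Qed.

End ProductSigmaFinite.

Section EuclideanMeasure.
Variable R : realType.

(* [lebesgue_measure] lives on [measurableTypeR R], whose display is not the one
   of the measurable structure that [R] carries inside tuples and products. *)
Section leb.
Let idR : measurableTypeR R -> R := idfun.

Let measurable_idR : measurable_fun setT idR.
Proof. by move=> _ Y mY; rewrite setTI preimage_id. Qed.

Definition leb : set R -> \bar R := pushforward (@lebesgue_measure R) idR.

Let pf := measure_function_pushforward__canonical__measure_function_Measure
  (@lebesgue_measure R) measurable_idR.

HB.instance Definition _ := isMeasure.Build _ _ _ leb
  (measure0 pf) (measure_ge0 pf) (@measure_semi_sigma_additive _ _ _ pf).

Let leb_sigma_finite : sigma_finite setT leb.
Proof.
have [F TF Ffin] := @sigma_finiteT _ _ _ (@lebesgue_measure R).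
by exists F.
Qed.

HB.instance Definition _ := Measure_isSigmaFinite.Build _ _ _ leb leb_sigma_finite.

Lemma integral_leb (f : R -> \bar R) : measurable_fun [set: R] f ->
  (forall x, 0 <= f x) ->
  \int[@lebesgue_measure R]_x f x = \int[leb]_x f x.
Proof.
move=> mf f0; rewrite (_ : \int[leb]_x f x = \int[pushforward (@lebesgue_measure R) idR]_x f x)//.
have := @ge0_integral_pushforward _ _ _ _ _ _ measurable_idR (@lebesgue_measure R) setT f measurableT mf.
by rewrite preimage_setT => ->.
Qed.

End leb.

Section succ.
Variables (n : nat) (m : {sigma_finite_measure set (n.-tuple R) -> \bar R}).

Definition consT (p : R * n.-tuple R) : n.+1.-tuple R := cons_tuple p.1 p.2.

Lemma measurable_consT : measurable_fun setT consT.
Proof. exact: (measurable_cons measurable_fst measurable_snd). Qed.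

Definition uncons (x : n.+1.-tuple R) : R * n.-tuple R := (thead x, [tuple of behead x]).

Lemma consTK : cancel consT uncons.
Proof. by move=> [a b]; congr pair; apply: val_inj. Qed.

Lemma measurable_uncons : measurable_fun setT uncons.
Proof.
apply/measurable_fun_pairP; split; first exact: measurable_tnth.
exact: measurable_behead.
Qed.

Definition muS : set (n.+1.-tuple R) -> \bar R := pushforward (leb \x m) consT.

Let pf := measure_function_pushforward__canonical__measure_function_Measure
  (leb \x m) measurable_consT.

HB.instance Definition _ := isMeasure.Build _ _ _ muS
  (measure0 pf) (measure_ge0 pf) (@measure_semi_sigma_additive _ _ _ pf).

Let muS_sigma_finite : sigma_finite setT muS.
Proof.
have [F TF Ffin] : sigma_finite setT (leb \x m) by exact: product_sigma_finite.
(* By [consTK], the preimage of this set under [consT] is [F k] again, so its measure is the product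
   measure of [F k]. *)
exists (fun k => uncons @^-1` F k).
  by rewrite -preimage_bigcup -TF.
move=> k; have [mF Fk] := Ffin k; split.
  by rewrite -[X in measurable X]setTI; exact: measurable_uncons.
rewrite /muS /pushforward -comp_preimage.
by rewrite (_ : uncons \o consT = id)// funeqE => p /=; rewrite consTK.
Qed.

HB.instance Definition _ := Measure_isSigmaFinite.Build _ _ _ muS muS_sigma_finite.

Lemma integral_muS (f : n.+1.-tuple R -> \bar R) : measurable_fun setT f ->
  (forall x, 0 <= f x) ->
  \int[muS]_x f x = \int[leb]_a \int[m]_y f (cons_tuple a y).
Proof.
move=> mf f0.
rewrite (_ : \int[muS]_x f x = \int[pushforward (leb \x m) consT]_x f x)//.
have := @ge0_integral_pushforward _ _ _ _ _ _ measurable_consT (leb \x m) setT f measurableT mf.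
rewrite preimage_setT => -> //.
rewrite fubini_tonelli1//=.
exact: (measurableT_comp mf measurable_consT).
Qed.

End succ.

(** The Dirac mass on the one-point space R^0 matches the base case of [intRn], so dimension zero is
    covered by the same arguments. *)
Fixpoint mu (n : nat) : {sigma_finite_measure set (n.-tuple R) -> \bar R} :=
  match n with
  | 0 => @dirac _ (0.-tuple R) [tuple] R
  | m.+1 => muS (mu m)
  end.

(** This is the passage from the iterated integral of the definitions to a sigma-finite measure, to
    which Tonelli's theorem and monotone convergence apply. Each induction step peels off the first
    coordinate. *)
Lemma intRnE n (f : n.-tuple R -> \bar R) : measurable_fun setT f ->
  (forall x, 0 <= f x) -> intRn f = \int[mu n]_x f x.
Proof.
elim: n f => [|n IH] f mf f0 /=.
  by rewrite integral_dirac// diracT mul1e.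
have mf' : measurable_fun setT (fun p : R * n.-tuple R => f (cons_tuple p.1 p.2)).
  exact: (measurableT_comp mf (@measurable_consT n)).
have E a : intRn (fun y : n.-tuple R => f (cons_tuple a y)) =
    \int[mu n]_y f (cons_tuple a y).
  apply: IH => //.
  exact: (measurableT_comp mf' (pair1_measurable a)).
under eq_fun do rewrite E.
rewrite integral_leb.
- by rewrite integral_muS.
- exact: (measurable_fun_fubini_tonelli_F _ mf').
- by move=> a; exact: integral_ge0.
Qed.

Definition nu (n : nat) : set (n.-tuple R * R) -> \bar R := mu n \x leb.

Arguments nu n : clear implicits.

HB.instance Definition _ n := Measure.on (nu n).

HB.instance Definition _ n := Measure_isSigmaFinite.Build _ _ _ (nu n)
  (@product_sigma_finite _ _ _ _ _ (mu n) leb).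

(** [nu] also charges the points with t <= 0, whence the vanishing condition on [F]. *)
Lemma intHE n (F : pt R n -> \bar R) : measurable_fun setT F ->
  (forall z, 0 <= F z) -> (forall z, z.2 <= 0 -> F z = 0)%R ->
  intH F = \int[nu n]_z F z.
Proof.
move=> mF F0 Fneg; rewrite /intH.
have E y : \int[@lebesgue_measure R]_(t in [set t : R | (0 < t)%R]) F (y, t) = \int[leb]_t F (y, t).
  rewrite integral_mkcond -integral_leb//; last first.
    exact: (measurableT_comp mF (pair1_measurable y)).
  apply: eq_integral => t _.
  rewrite /patch; case: ifPn => //; rewrite notin_setE/= => /negP.
  by rewrite -leNgt => t0; rewrite Fneg.
under eq_fun do rewrite E.
rewrite intRnE.
- by rewrite /nu fubini_tonelli1//.
- exact: (measurable_fun_fubini_tonelli_F F mF).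
- by move=> x; exact: integral_ge0.
Qed.

(** Balls of the sup norm. Their measure follows exactly from the product structure, while that of a
    Euclidean ball is only bounded from both sides by comparison. *)
Definition cube n (y : n.-tuple R) (r : R) : set (n.-tuple R) :=
  [set x | forall i, `|tnth x i - tnth y i| < r]%R.

Lemma measurable_cube n (y : n.-tuple R) r : measurable (cube y r).
Proof.
rewrite (_ : cube y r = \bigcap_(i in [set: 'I_n]) ((fun x => tnth x i) @^-1` (ball (tnth y i) r))).
  apply: fin_bigcap_measurable => // i _.
  rewrite -[X in measurable X]setTI; apply: measurable_tnth => //.
  exact: measurable_ball.
apply/seteqP; split=> x /= h i; first by move=> _; rewrite /ball/= distrC.
by have := h i Logic.I; rewrite /ball/= distrC.
Qed.
Hint Resolve measurable_cube : core.

Lemma mu_cube n (y : n.-tuple R) (r : R) : (0 < r)%R ->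
  mu n (cube y r) = ((2 * r) ^+ n)%:E.
Proof.
move=> r0; elim: n y => [|n IH] y /=.
  by rewrite diracE mem_set// => -[].
rewrite /muS /pushforward.
rewrite (_ : @consT n @^-1` _ = ball (thead y) r `*` cube [tuple of behead y] r).
  rewrite product_measure1E; [| exact: measurable_ball | exact: measurable_cube].
  rewrite IH exprS EFinM; congr (_ * _).
  by rewrite /= /leb /pushforward preimage_id lebesgue_measure_ball ?ltW// mulr_natl.
have tl i : tnth y (lift ord0 i) = tnth [tuple of behead y] i.
  by rewrite {1}(tuple_eta y) tnthS.
have tc a (x : n.-tuple R) i : tnth (consT (a, x)) (lift ord0 i) = tnth x i.
  by rewrite /consT (_ : cons_tuple _ _ = [tuple of a :: x]) ?tnthS//; exact: val_inj.
apply/seteqP; split=> -[a x] /= h.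
- split => [|i]; first by have := h ord0; rewrite /ball/= distrC.
  by have := h (lift ord0 i); rewrite tl tc.
- case: h => h1 h2 i; case: (unliftP ord0 i) => [j ->|->].
    by rewrite tl tc; exact: h2.
  by move: h1; rewrite /ball/= distrC.
Qed.

End EuclideanMeasure.

(** * Calculus of nonnegative measurable functions *)

Section NonnegMeasurable.
Variable R : realType.

(** All integrands below take values in [0, +oo]. This class is stable under products, powers and
    integrals depending on a parameter, and Tonelli's theorem holds in it without integrability. *)
Definition mnn d (T : measurableType d) (f : T -> \bar R) :=
  measurable_fun setT f /\ forall x, 0 <= f x.

Definition ind T (A : set T) (x : T) : \bar R := (\1_A x)%:E.

Lemma ind_in T (A : set T) x : A x -> ind A x = 1.
Proof. by move=> Ax; rewrite /ind indicE mem_set. Qed.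

Lemma ind_out T (A : set T) x : ~ A x -> ind A x = 0.
Proof. by move=> Ax; rewrite /ind indicE memNset. Qed.

Lemma ind_ge0 T (A : set T) x : 0 <= ind A x.
Proof. by rewrite lee_fin. Qed.

Lemma ind_sub T U (A : set T) (B : set U) x y : (A x -> B y) -> ind A x <= ind B y.
Proof.
have [Ax AB|Ax _] := pselect (A x); last by rewrite (ind_out Ax) ind_ge0.
by rewrite !ind_in//; exact: AB.
Qed.

Section one.
Context d (T : measurableType d).
Implicit Types (f g : T -> \bar R) (A B : set T).

Lemma mnn_cst (c : \bar R) : 0 <= c -> mnn (fun _ : T => c).
Proof. by split. Qed.

Lemma mnn_mul f g : mnn f -> mnn g -> mnn (fun x => f x * g x).
Proof.
move=> [mf f0] [mg g0]; split; first exact: emeasurable_funM.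
by move=> x; exact: mule_ge0.
Qed.

Lemma mnn_add f g : mnn f -> mnn g -> mnn (fun x => f x + g x).
Proof.
move=> [mf f0] [mg g0]; split; first exact: emeasurable_funD.
by move=> x; exact: adde_ge0.
Qed.

Lemma mnn_ind A : measurable A -> mnn (ind A).
Proof. by move=> mA; split=> [|x]; [exact/measurable_EFinP/measurable_indic|rewrite lee_fin]. Qed.

Lemma mnn_poweR f p : mnn f -> mnn (fun x => f x `^ p).
Proof.
move=> [mf f0]; split=> [|x]; last exact: poweR_ge0.
exact: (measurableT_comp (@measurable_poweR R p) mf).
Qed.

Lemma mfun_EFin (h : T -> R) : measurable_fun setT h ->
  measurable_fun setT (fun x => (h x)%:E : \bar R).
Proof. by move=> mh; exact/measurable_EFinP. Qed.

Lemma mnn_EFin (h : T -> R) : measurable_fun setT h -> (forall x, 0 <= h x)%R ->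
  mnn (fun x => (h x)%:E : \bar R).
Proof. by move=> mh h0; split=> [|x]; [exact/measurable_EFinP|rewrite lee_fin]. Qed.

Lemma mnn_comp d' (T' : measurableType d') (f : T -> \bar R) (h : T' -> T) :
  mnn f -> measurable_fun setT h -> mnn (fun x => f (h x)).
Proof. by move=> [mf f0] mh; split=> [|x]//; exact: (measurableT_comp mf mh). Qed.

Lemma mnn_mine f g : mnn f -> mnn g -> mnn (fun x => mine (f x) (g x)).
Proof.
move=> [mf f0] [mg g0]; split; first exact: measurable_mine.
by move=> x; rewrite le_min f0 g0.
Qed.

Variable m : {measure set T -> \bar R}.

Lemma int_ge0 f : mnn f -> 0 <= \int[m]_x f x.
Proof. by move=> [_ f0]; exact: integral_ge0. Qed.

Lemma int_le f g : mnn f -> mnn g -> (forall x, f x <= g x) ->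
  \int[m]_x f x <= \int[m]_x g x.
Proof. by move=> [mf f0] [mg g0] fg; apply: ge0_le_integral. Qed.

Lemma int_Zl f c : mnn f -> 0 <= c -> \int[m]_x (c * f x) = c * \int[m]_x f x.
Proof. by move=> [mf f0] c0; rewrite ge0_integralZl. Qed.

Lemma int_Zr f c : mnn f -> 0 <= c -> \int[m]_x (f x * c) = \int[m]_x f x * c.
Proof. by move=> [mf f0] c0; rewrite ge0_integralZr. Qed.

Lemma int_D f g : mnn f -> mnn g ->
  \int[m]_x (f x + g x) = \int[m]_x f x + \int[m]_x g x.
Proof. by move=> [mf f0] [mg g0]; rewrite ge0_integralD. Qed.

Lemma int_indic A : measurable A -> \int[m]_x ind A x = m A.
Proof. by move=> mA; rewrite /ind integral_indic// setIT. Qed.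

Lemma int_restrict f A : measurable A ->
  \int[m]_(x in A) f x = \int[m]_x (ind A x * f x).
Proof.
move=> mA; rewrite integral_mkcond; apply: eq_integral => x _.
by rewrite patchE /ind indicE; case: ifPn => _; rewrite ?mul1e ?mul0e.
Qed.

Lemma int_eq0 f : mnn f -> \int[m]_x f x = 0 -> m [set x | f x != 0] = 0.
Proof.
move=> [mf f0] I0.
have /(ae_eq_integral_abs m measurableT mf) [N [mN N0 sub]] :
    \int[m]_x `|f x| = 0.
  by rewrite -[RHS]I0; apply: eq_integral => x _; rewrite gee0_abs.
apply: (subset_measure0 _ mN _ N0).
  by have := emeasurable_neq measurableT mf 0; rewrite setTI.
by move=> x /= fx; apply: sub => /= /(_ Logic.I) /eqP; exact/negP.
Qed.

Lemma int_null0 f : mnn f -> m [set x | f x != 0] = 0 -> \int[m]_x f x = 0.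
Proof.
move=> [mf f0] I0.
have /(ae_eq_integral_abs m measurableT mf) <- :
    ae_eq m setT f (cst 0).
  exists [set x | f x != 0]; split => //.
    by have := emeasurable_neq measurableT mf 0; rewrite setTI.
  by move=> x /= h; apply/eqP => fx; apply: h.
by apply: eq_integral => x _; rewrite gee0_abs.
Qed.

End one.

Section two.
Context d1 d2 (T1 : measurableType d1) (T2 : measurableType d2).
Variable m1 : {sigma_finite_measure set T1 -> \bar R}.
Variable m2 : {sigma_finite_measure set T2 -> \bar R}.
Variable F : T1 -> T2 -> \bar R.
Hypothesis mF : mnn (fun p : T1 * T2 => F p.1 p.2).

Lemma mnn_int1 : mnn (fun x => \int[m2]_y F x y).
Proof.
case: mF => m F0; split; first exact: (measurable_fun_fubini_tonelli_F _ m).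
by move=> x; apply: integral_ge0 => y _; exact: (F0 (x, y)).
Qed.

Lemma mnn_int2 : mnn (fun y => \int[m1]_x F x y).
Proof.
case: mF => m F0; split; first exact: (measurable_fun_fubini_tonelli_G _ m).
by move=> y; apply: integral_ge0 => x _; exact: (F0 (x, y)).
Qed.

Lemma tonelli : \int[m1]_x \int[m2]_y F x y = \int[m2]_y \int[m1]_x F x y.
Proof. by case: mF => m F0; exact: (fubini_tonelli _ m). Qed.

End two.

Lemma measurable_ltr_set d (T : measurableType d) (f g : T -> R) :
  measurable_fun setT f -> measurable_fun setT g ->
  measurable [set x | (f x < g x)%R].
Proof.
move=> mf mg; rewrite -[X in measurable X]setTI.
by have := measurable_fun_ltr mf mg; apply; [exact: measurableT|exact: (Logic.I : @measurable _ bool [set true])].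
Qed.

Lemma measurable_lte_set d (T : measurableType d) (f g : T -> \bar R) :
  measurable_fun setT f -> measurable_fun setT g ->
  measurable [set x | f x < g x].
Proof.
move=> mf mg; rewrite -[X in measurable X]setTI.
by have := measurable_fun_lte mf mg; apply; [exact: measurableT|exact: (Logic.I : @measurable _ bool [set true])].
Qed.

Lemma measurable_lee_set d (T : measurableType d) (f g : T -> \bar R) :
  measurable_fun setT f -> measurable_fun setT g ->
  measurable [set x | f x <= g x].
Proof.
move=> mf mg; rewrite -[X in measurable X]setTI.
by have := measurable_fun_lee mf mg; apply; [exact: measurableT|exact: (Logic.I : @measurable _ bool [set true])].
Qed.

Lemma measurable_setAnd d (T : measurableType d) (P Q : T -> Prop) :
  measurable [set x | P x] -> measurable [set x | Q x] ->
  measurable [set x | P x /\ Q x].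
Proof. exact: measurableI. Qed.

Lemma measurable_setAll d (T : measurableType d) n (P : 'I_n -> T -> Prop) :
  (forall i, measurable [set x | P i x]) ->
  measurable [set x | forall i, P i x].
Proof.
move=> mP; rewrite (_ : [set x | _] = \bigcap_(i in [set: 'I_n]) [set x | P i x]).
  by apply: fin_bigcap_measurable => // i _; exact: mP.
by apply/seteqP; split=> x h i; [move=> _; exact: h|exact: h i Logic.I].
Qed.

End NonnegMeasurable.

(** * The maximal function *)

Section Maximal.
Variables (R : realType) (n : nat).
Local Notation E := (n.-tuple R).
Local Notation mu := (@mu R n).
Implicit Types (h : E -> \bar R) (x y : E).

Definition cavg h y (r : R) : \bar R :=
  (((2 * r) ^+ n)^-1)%:E * \int[mu]_(x in cube y r) h x.

(** A countable family of cubes with rational centre and radius. Codes that decode to nothing, or to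
    a nonpositive radius, get radius 1, so that every member is a genuine cube. *)
Definition ratcube (k : nat) : E * R :=
  if unpickle k is Some q then
    let: (c, r) := (q : n.-tuple rat * rat) in
    ([tuple of map ratr c], if (0 < r)%R then ratr r else 1%R)
  else ([tuple of nseq n 0%R], 1%R).

Lemma ratcube_gt0 k : (0 < (ratcube k).2)%R.
Proof.
rewrite /ratcube; case: unpickle => [[c r]|]/=; last exact: ltr01.
by case: ifPn => // r0; rewrite ltr0q.
Qed.

Lemma ratcube_surj (c : n.-tuple rat) (r : rat) : (0 < r)%R ->
  exists k, ratcube k = ([tuple of map ratr c], ratr r).
Proof. by move=> r0; exists (pickle (c, r)); rewrite /ratcube pickleK r0. Qed.

(** The uncentred Hardy-Littlewood maximal function over rational cubes only: as a countable
    supremum it is measurable for free, and [cavg_le_maxf] shows that arbitrary cubes cost just a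
    factor [2 ^+ n]. *)
Definition maxf h x : \bar R :=
  esups (fun k => ind R (cube (ratcube k).1 (ratcube k).2) x *
                  cavg h (ratcube k).1 (ratcube k).2) 0%N.

Lemma maxfE h x : maxf h x = ereal_sup (range (fun k =>
   ind R (cube (ratcube k).1 (ratcube k).2) x *
                  cavg h (ratcube k).1 (ratcube k).2)).
Proof. by rewrite /maxf /esups/= /sdrop; congr ereal_sup; apply/seteqP; split => u [k]/=; [exists k|exists k]. Qed.

Lemma cavg_ge0 h y r : (forall x, 0 <= h x) -> (0 < r)%R -> 0 <= cavg h y r.
Proof.
move=> h0 r0; apply: mule_ge0; last exact: integral_ge0.
by rewrite lee_fin invr_ge0 exprn_ge0// mulr_ge0// ltW.
Qed.

Lemma maxf_mnn h : mnn h -> mnn (maxf h).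
Proof.
move=> [mh h0]; split.
  apply: measurable_fun_esups => k.
  apply: emeasurable_funM => //.
  exact: (mnn_ind _ (measurable_cube _ _)).1.
move=> x; rewrite maxfE; apply: le_trans (ereal_sup_ubound _); last by exists 0%N.
by apply: mule_ge0; [exact: ind_ge0|apply/cavg_ge0/ratcube_gt0].
Qed.

Lemma maxf_gtP h x (a : \bar R) : 0 <= a -> a < maxf h x <->
  exists2 k, cube (ratcube k).1 (ratcube k).2 x &
             a < cavg h (ratcube k).1 (ratcube k).2.
Proof.
move=> a0; rewrite maxfE; split.
  move=> /ereal_sup_gt[_ [k _ <-]].
  have [xk|xk] := pselect (cube (ratcube k).1 (ratcube k).2 x).
    by rewrite ind_in// mul1e; exists k.
  by rewrite ind_out// mul0e ltNge a0.
move=> [k xk ak]; apply: (lt_le_trans ak); apply: ereal_sup_ubound.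
by exists k => //; rewrite ind_in// mul1e.
Qed.

Lemma cube_sub x y (r s : R) :
  (forall i, `|tnth x i - tnth y i| + r <= s)%R -> cube x r `<=` cube y s.
Proof.
move=> H z hz i; have := H i; have := hz i.
have := ler_distD (tnth x i) (tnth z i) (tnth y i); lra.
Qed.

(** A rational centre within [r / 4] of [y] and a rational radius between [3 / 2 * r] and [2 * r]
    give a cube that contains [cube y r] and is at most [2 ^+ n] times larger. *)
Lemma cavg_le_maxf h y (r : R) x : mnn h -> (0 < r)%R -> cube y r x ->
  cavg h y r <= (2 ^+ n)%:E * maxf h x.
Proof.
move=> [mh h0] r0 xy.
have e0 : (0 < r / 4)%R by lra.
have ex i : {q : rat | `|ratr q - tnth y i| < r / 4}%R.
  apply: cid.
  have [q] := @rat_in_itvoo R (tnth y i - r / 4) (tnth y i + r / 4) ltac:(lra).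
  by rewrite in_itv/= => /andP[a b]; exists q; rewrite ltr_distl; lra.
pose c := [tuple sval (ex i) | i < n].
have [q] := @rat_in_itvoo R (3 / 2 * r) (2 * r) ltac:(lra).
rewrite in_itv/= => /andP[q1 q2].
have q0 : (0 < q)%R by rewrite -(ltr0q R); lra.
have [k Ek] := ratcube_surj c q0.
have sub : cube y r `<=` cube (ratcube k).1 (ratcube k).2.
  rewrite Ek; apply: cube_sub => i /=.
  rewrite tnth_map tnth_mktuple distrC.
  by have := svalP (ex i); lra.
have kx : cube (ratcube k).1 (ratcube k).2 x by exact: sub.
have le1 : cavg h (ratcube k).1 (ratcube k).2 <= maxf h x.
  rewrite maxfE; apply: ereal_sup_ubound; exists k => //.
  by rewrite ind_in// mul1e.
apply: le_trans (lee_wpmul2l _ le1); last by rewrite lee_fin exprn_ge0.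
rewrite /cavg muleA -EFinM; apply: lee_pmul.
- by rewrite lee_fin invr_ge0 exprn_ge0//; lra.
- exact: integral_ge0.
- rewrite lee_fin Ek/= -exprVn -exprVn -exprMn lerXn2r// ?nnegrE ?mulr_ge0 ?invr_ge0; try lra.
  rewrite ler_pdivlMr; last by lra.
  rewrite mulrC ler_pdivrMr; lra.
- apply: ge0_subset_integral => //; [exact: measurable_cube|exact: measurable_cube|].
  exact: measurable_funTS.
Qed.

Definition cubes (s : seq (E * R)) : set E :=
  [set x | exists2 p, p \in s & cube p.1 p.2 x].

Lemma cubes_cons p s : cubes (p :: s) = cube p.1 p.2 `|` cubes s.
Proof.
apply/seteqP; split=> x.
  by move=> [q]; rewrite inE => /orP[/eqP-> xp|qs xq]; [left|right; exists q].
by move=> [xp|[q qs xq]]; [exists p; rewrite ?mem_head|exists q; rewrite ?inE ?qs ?orbT].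
Qed.

Lemma measurable_cubes s : measurable (cubes s).
Proof.
elim: s => [|p s IH].
  by rewrite (_ : cubes [::] = set0)//; apply/seteqP; split => x // [].
by rewrite cubes_cons; apply: measurableU => //; exact: measurable_cube.
Qed.

Lemma seq_max_radius (p : E * R) s :
  exists2 q, q \in p :: s & forall p', p' \in p :: s -> (p'.2 <= q.2)%R.
Proof.
elim: s p => [|p2 s IH] p; first by exists p; rewrite ?mem_head// => p'; rewrite inE => /eqP->.
have [q qs qmax] := IH p2.
have [pq|qp] := leP p.2 q.2.
  by exists q; [rewrite inE qs orbT|move=> p'; rewrite inE => /orP[/eqP->//|/qmax]].
exists p; first exact: mem_head.
by move=> p'; rewrite inE => /orP[/eqP->//|/qmax p'q]; exact: le_trans p'q (ltW qp).
Qed.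

(* Vitali covering: a largest cube [q], tripled, covers all the cubes that meet
   it; induct on those that do not. *)
Lemma cubes_vitali h (k : R) s : mnn h -> (0 <= k)%R ->
  (forall p, p \in s -> (0 < p.2)%R /\
     mu (cube p.1 p.2) <= k%:E * \int[mu]_(x in cube p.1 p.2) h x) ->
  mu (cubes s) <= (3 ^+ n * k)%:E * \int[mu]_(x in cubes s) h x.
Proof.
move=> [mh h0] k0.
have [m] := ubnP (size s); elim: m s => // m IH [|p s] ss Hs.
  rewrite (_ : cubes [::] = set0); last by apply/seteqP; split => x // [].
  by rewrite measure0 integral_set0 mule0.
have [q qs qmax] := seq_max_radius p s.
have [q0 qk] := Hs q qs.
pose s' := [seq p' <- p :: s | `[< cube p'.1 p'.2 `&` cube q.1 q.2 = set0 >]].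
have s's p' : p' \in s' -> p' \in p :: s by rewrite mem_filter => /andP[].
have cq : cube q.1 q.2 q.1 by move=> i; rewrite subrr normr0.
have qs' : q \notin s'.
  rewrite mem_filter qs andbT; apply/asboolPn => e0.
  by have : (set0 : set E) q.1 by rewrite -e0; split.
have sz : (size s' < m)%N.
  rewrite -ltnS (leq_trans _ ss)// ltnS.
  rewrite size_filter -(count_predT (p :: s)) ltn_neqAle sub_count ?andbT//.
  apply/eqP => cc.
  have : all [pred p' | `[< cube p'.1 p'.2 `&` cube q.1 q.2 = set0 >]] (p :: s).
    by rewrite all_count cc count_predT.
  move=> /allP /(_ q qs) qq; move: qs'; rewrite mem_filter qs andbT.
  by move/negP; apply.
have IHs := IH s' sz (fun p' ps' => Hs p' (s's p' ps')).
have m3 : measurable (cube q.1 (3 * q.2)) by exact: measurable_cube.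
have sub : cubes (p :: s) `<=` cube q.1 (3 * q.2) `|` cubes s'.
  move=> x [p' p's xp'].
  have [dis|/set0P[y [yp' yq]]] := eqVneq (cube p'.1 p'.2 `&` cube q.1 q.2) set0.
    by right; exists p' => //; rewrite mem_filter p's andbT; exact/asboolP.
  left => i; have := xp' i; have := yp' i; have := yq i; have := qmax p' p's.
  have := ler_distD (tnth p'.1 i) (tnth x i) (tnth q.1 i).
  have := ler_distD (tnth y i) (tnth p'.1 i) (tnth q.1 i).
  rewrite (distrC (tnth p'.1 i) (tnth y i)); lra.
apply: (@le_trans _ _ (mu (cube q.1 (3 * q.2)) + mu (cubes s'))).
  apply: le_trans (measureU2 _ _ _) => //; last exact: measurable_cubes.
  apply: le_measure => //; rewrite inE; first exact: measurable_cubes.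
  by apply: measurableU => //; exact: measurable_cubes.
have disj : [disjoint cube q.1 q.2 & cubes s'].
  rewrite disj_set2E; apply/eqP/seteqP; split => // x [xq [p' + xp']].
  rewrite mem_filter => /andP[/asboolP e0 _].
  by rewrite /= -[False]/((set0 : set E) x) -e0; split.
apply: (@le_trans _ _ ((3 ^+ n * k)%:E *
    \int[mu]_(x in cube q.1 q.2 `|` cubes s') h x)); last first.
  apply: lee_wpmul2l; first by rewrite lee_fin mulr_ge0// exprn_ge0.
  apply: ge0_subset_integral => //.
  - apply: measurableU; [exact: measurable_cube|exact: measurable_cubes].
  - exact: measurable_cubes.
  - exact: measurable_funTS.
  - move=> x [xq|[p' /s's p's xp']]; [by exists q|by exists p'].
rewrite ge0_integral_setU//; last 3 first.
- exact: measurable_cube.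
- exact: measurable_cubes.
- exact: measurable_funTS.
rewrite ge0_muleDr ?integral_ge0//; apply: leeD => //.
rewrite EFinM -muleA; apply: le_trans (lee_wpmul2l _ qk); last first.
  by rewrite lee_fin exprn_ge0.
by rewrite !mu_cube//; [rewrite -EFinM lee_fin -exprMn mulrCA|rewrite mulr_gt0].
Qed.

(** The superlevel set is the increasing union of finite unions of rational cubes whose average
    exceeds [a]. The covering lemma bounds each finite union uniformly, and continuity from below
    passes to the limit. *)
Lemma maxf_weak h (a : R) : mnn h -> (0 < a)%R ->
  mu [set x | a%:E < maxf h x] <= (3 ^+ n / a)%:E * \int[mu]_x h x.
Proof.
move=> mh a0.
pose s N := [seq ratcube k | k <- iota 0 N &
  `[< a%:E < cavg h (ratcube k).1 (ratcube k).2 >]].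
have -> : [set x | a%:E < maxf h x] = \bigcup_N cubes (s N).
  apply/seteqP; split=> x /=.
    move=> /maxf_gtP; rewrite lee_fin (ltW a0) => /(_ isT)[k xk ak].
    exists k.+1 => //; exists (ratcube k) => //.
    apply/mapP; exists k => //; rewrite mem_filter mem_iota /= add0n ltnS leqnn andbT.
    exact/asboolP.
  move=> [N _ [p /mapP[k]]]; rewrite mem_filter => /andP[/asboolP ak _] -> xk.
  by apply/maxf_gtP; rewrite ?lee_fin ?ltW//; exists k.
have bnd N : mu (cubes (s N)) <= (3 ^+ n / a)%:E * \int[mu]_x h x.
  apply: (@le_trans _ _ ((3 ^+ n / a)%:E * \int[mu]_(x in cubes (s N)) h x)).
    apply: cubes_vitali => //; first by rewrite invr_ge0 ltW.
    move=> p /mapP[k]; rewrite mem_filter => /andP[/asboolP ak _] ->.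
    split; first exact: ratcube_gt0.
    have r0 := ratcube_gt0 k; move: ak; rewrite /cavg mu_cube//.
    set I := \int[mu]_(x in _) _ => /ltW.
    have c0 : (0 < (2 * (ratcube k).2) ^+ n)%R by rewrite exprn_gt0// mulr_gt0.
    by rewrite lee_pdivlMl// => H; rewrite lee_pdivlMl// muleC.
  apply: lee_wpmul2l; first by rewrite lee_fin divr_ge0// ?exprn_ge0// ltW.
  case: mh => mh h0.
  by apply: ge0_subset_integral => //; exact: measurable_cubes.
have nd : nondecreasing_seq (fun N => cubes (s N)).
  move=> N M NM; apply/subsetPset => x [p ps xp]; exists p => //.
  move: ps => /mapP[k]; rewrite mem_filter => /andP[ak kN] ->.
  apply/mapP; exists k => //; rewrite mem_filter ak/=.
  by move: kN; rewrite !mem_iota /= !add0n => /leq_trans; apply.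
have cv := @nondecreasing_cvg_mu _ _ _ mu _ (fun N => measurable_cubes (s N))
  (bigcupT_measurable _ (fun N => measurable_cubes (s N))) nd.
rewrite -(cvg_lim _ cv)//.
by apply: lime_le; [apply/cvg_ex; eexists; exact: cv|exact: nearW].
Qed.

End Maximal.

(** * Integrals of powers over level sets *)

Section PowerIntegrals.
Variable R : realType.
Local Notation leb := (@leb R).

Let powR_is_derive (c x : R) : (0 < c -> 0 < x ->
  is_derive x 1 (fun a => c^-1 * a `^ c) (x `^ (c - 1)))%R.
Proof.
move=> c0 x0.
have H := is_derive1_powR c x0.
have -> : (x `^ (c - 1) = c^-1 *: (c * x `^ (c - 1)))%R.
  by rewrite /GRing.scale/= mulrA mulVf ?mul1r ?gt_eqF.
exact: is_deriveZ.
Qed.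

Let integral_powR_itv (a b c : R) : (0 < c -> 0 < a -> a < b ->
  (\int[leb]_(x in `[a, b]) (x `^ (c - 1))%:E <= (b `^ c / c)%:E)%E)%R.
Proof.
move=> c0 a0 ab.
rewrite integral_mkcond -integral_leb; last 2 first.
- apply/(measurable_restrictT _ _).1 => //; apply: measurable_funTS.
  by apply/measurable_EFinP; exact: measurable_powR.
- by move=> x; apply: erestrict_ge0 => y _; rewrite lee_fin powR_ge0.
rewrite -integral_mkcond.
have pos x : x \in `[a, b]%R -> (0 < x)%R.
  by rewrite in_itv/= => /andP[ax _]; exact: lt_le_trans ax.
have dF x : (0 < x)%R -> {for x, continuous (fun x : R => c^-1 * x `^ c)%R}.
  move=> x0; apply/differentiable_continuous/derivable1_diffP.
  by have := powR_is_derive c0 x0; case.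
rewrite (@continuous_FTC2 _ _ (fun x => c^-1 * x `^ c)%R)//.
- rewrite -EFinD lee_fin mulrC gerBl mulr_ge0 ?powR_ge0// invr_ge0 ltW//.
- apply: derivable_within_continuous => x xab.
  by apply: derivable_powR; rewrite in_itv/= andbT pos.
- split.
  + move=> x; rewrite in_itv/= => /andP[ax _].
    by have := powR_is_derive c0 (lt_trans a0 ax); case.
  + by apply: cvg_at_right_filter; apply: dF.
  + by apply: cvg_at_left_filter; apply: dF; exact: lt_trans ab.
- move=> x; rewrite in_itv/= => /andP[ax _].
  by rewrite derive1E; have := powR_is_derive c0 (lt_trans a0 ax); case.
Qed.

(** For [c < 1] the integrand is singular at 0, so the fundamental theorem of calculus is used on
    closed intervals away from 0, followed by monotone convergence. *)
Lemma integral_powR_le (b c : R) : (0 < c)%R -> (0 <= b)%R ->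
  \int[leb]_x (ind R [set a | (0 < a)%R /\ (a < b)%R] x * (x `^ (c - 1))%:E)
    <= (b `^ c / c)%:E.
Proof.
move=> c0; rewrite le_eqVlt => /orP[/eqP<-|b0].
  rewrite (_ : \int[leb]_x _ = 0) ?lee_fin ?divr_ge0 ?powR_ge0 ?ltW//.
  apply: integral0_eq => x _; rewrite ind_out ?mul0e//= => -[x0 /(lt_trans x0)].
  by rewrite ltxx.
have mp : measurable_fun setT (fun x : R => (x `^ (c - 1))%:E).
  by apply/measurable_EFinP; exact: measurable_powR.
have mS : measurable [set a : R | (0 < a)%R /\ (a < b)%R].
  by apply: measurable_setAnd; exact: measurable_ltr_set.
(* With [k.+2] the left end is strictly below [b] already for [k = 0], as [integral_powR_itv]
   requires. *)
pose F (k : nat) : set R := [set` `[b / k.+2%:R, b]%R].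
have nd : nondecreasing_seq F.
  move=> i j ij; apply/subsetPset => x; rewrite /F/= !in_itv/= => /andP[h ->].
  rewrite andbT (le_trans _ h)// ler_pM2l// lef_pV2 ?posrE// ler_nat.
  by rewrite !ltnS.
have mF k : measurable (F k) by exact: measurable_itv.
have := @ge0_nondecreasing_set_cvg_integral _ _ _ F (fun x => (x `^ (c - 1))%:E)
  (leb) nd mF.
move=> /(_ (fun k => measurable_funTS mp)) /(_ (fun _ x _ => powR_ge0 _ _)) cv.
have bF : \int[leb]_(x in \bigcup_k F k) (x `^ (c - 1))%:E <= (b `^ c / c)%:E.
  rewrite -(cvg_lim _ cv)//; apply: lime_le; first by apply/cvg_ex; eexists; exact: cv.
  apply: nearW => k; apply: integral_powR_itv => //; first by rewrite divr_gt0.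
  by rewrite ltr_pdivrMr// ltr_pMr// ltr1n.
apply: le_trans bF; rewrite [leRHS]integral_mkcond; apply: ge0_le_integral => //.
- by move=> x _; rewrite mule_ge0 ?ind_ge0// lee_fin powR_ge0.
- exact: emeasurable_funM (mnn_ind _ mS).1 mp.
- by apply/(measurable_restrictT _ _).1; [exact: bigcup_measurable|exact: measurable_funTS].
- move=> x _; rewrite patchE; have [[x0 xb]|nx] := pselect ((0 < x)%R /\ (x < b)%R); last first.
    by rewrite ind_out// mul0e; case: ifPn => // _; rewrite lee_fin powR_ge0.
  rewrite ind_in// mul1e ifT// inE; exists (Num.truncn (b / x)) => //.
  rewrite /F/= in_itv/= (ltW xb) andbT ler_pdivrMr// mulrC -ler_pdivrMr//.
  by rewrite ltW// (lt_trans (truncnS_gt _))// ltr_nat.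
Qed.

(** A value, finite or not, becomes the length of an interval. This is the layer cake formula
    pointwise; integrating it in [x] and exchanging the integrals gives the distribution
    function. *)
Lemma leb_lt (w : \bar R) : 0 <= w ->
  leb [set a : R | (0 < a)%R /\ a%:E < w] = w.
Proof.
case: w => [w| |] w0; last by [].
  rewrite (_ : [set a | _] = [set` `]0%R, w[%R]).
    rewrite /leb /pushforward preimage_id lebesgue_measure_itv/= lte_fin.
    case: ifPn; first by rewrite sube0.
    by rewrite -leNgt => w0'; congr EFin; apply/eqP; rewrite eq_le w0' -lee_fin w0.
  apply/seteqP; split=> x /=; rewrite in_itv/= lte_fin; first by move=> [-> ->].
  by move/andP.
rewrite (_ : [set a | _] = [set` `]0%R, +oo[%R]).
  by rewrite /leb /pushforward preimage_id lebesgue_measure_itv/= ltry.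
by apply/seteqP; split=> x /=; rewrite in_itv/= andbT ?ltry; [case|].
Qed.

(** The inner integral of the interpolation argument in [maxf_Lp]. The level set is [0 < a < v ^ p],
    and [- p^-1] is an integrable exponent at 0 exactly because [1 < p]. *)
Lemma integral_level_le (p : R) (v : \bar R) : (1 < p)%R -> 0 <= v ->
  \int[leb]_a (ind R [set a : R | (0 < a)%R /\ (a `^ p^-1)%:E < v] a
     * (a `^ (- p^-1))%:E) <= (p / (p - 1))%:E * v `^ (p - 1).
Proof.
move=> p1; have p0 : (0 < p)%R by lra.
have c0 : (0 < 1 - p^-1)%R by rewrite subr_gt0 invf_lt1.
case: v => [v| |] v0; last by [].
  have -> : [set a : R | (0 < a)%R /\ (a `^ p^-1)%:E < v%:E] =
            [set a : R | (0 < a)%R /\ (a < v `^ p)%R].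
    apply/seteqP; split=> a /= [a0]; rewrite lte_fin => av; split => //.
    - have := @gt0_ltr_powR R p p0 (a `^ p^-1)%R v.
      rewrite -powRrM mulVf ?gt_eqF// powRr1 ?(ltW a0)//; apply => //.
      by rewrite nnegrE powR_ge0.
    - have := @gt0_ltr_powR R p^-1 _ a (v `^ p)%R.
      rewrite -powRrM mulfV ?gt_eqF// powRr1//; apply => //; rewrite ?invr_gt0// nnegrE ?powR_ge0 ?ltW//.
  have := integral_powR_le c0 (powR_ge0 v p).
  have -> : (1 - p^-1 - 1 = - p^-1)%R by ring.
  move=> /le_trans; apply; rewrite poweR_EFin -EFinM lee_fin -powRrM.
  have -> : (p * (1 - p^-1) = p - 1)%R by field; lra.
  have -> // : ((1 - p^-1)^-1 = p / (p - 1))%R by field; lra.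
  by rewrite mulrC.
by rewrite poweRyr ?subr_eq0 ?gt_eqF// mulry gtr0_sg ?divr_gt0 ?subr_gt0// mul1e leey.
Qed.

End PowerIntegrals.

Section MaximalStrong.
Variables (R : realType) (n : nat).
Local Notation E := (n.-tuple R).
Local Notation mu := (@mu R n).
Local Notation leb := (@leb R).

Lemma mule_poweRB1 (v : \bar R) (p : R) : 0 <= v -> (1 < p)%R ->
  v * v `^ (p - 1) = v `^ p.
Proof.
move=> v0 p1; case: v v0 => [v v0| _|//].
  by rewrite !poweR_EFin -EFinM mulr_powRB1//; lra.
by rewrite !poweRyr ?mulyy//; apply/eqP; lra.
Qed.

(** Marcinkiewicz truncation: the part of [h] that stays below [a / 2] contributes at most [a / 2]
    to any average, so the remaining part must account for the other half. *)
Lemma maxf_split (h : E -> \bar R) (a : R) x : mnn h -> (0 < a)%R -> a%:E < maxf h x ->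
  (a / 2)%:E < maxf (fun y => ind R [set y | (a / 2)%:E < h y] y * h y) x.
Proof.
move=> mh a0 /maxf_gtP; rewrite lee_fin (ltW a0) => /(_ isT)[k xk ak].
have ms : measurable [set y : E | (a / 2)%:E < h y].
  by apply: measurable_lte_set => //; case: mh.
apply/maxf_gtP; first by rewrite lee_fin divr_ge0// ltW.
exists k => //; rewrite ltNge; apply/negP => le.
move: ak; rewrite ltNge => /negP; apply.
have r0 := ratcube_gt0 R n k.
set y := (ratcube R n k).1 in le *; set r := (ratcube R n k).2 in le r0 *.
have c0 : (0 < (2 * r) ^+ n)%R by rewrite exprn_gt0// mulr_gt0.
have mh1 : mnn (fun y => ind R [set y | (a / 2)%:E < h y] y * h y).
  by apply: mnn_mul => //; exact: mnn_ind.
have -> : a%:E = (a / 2)%:E + (a / 2)%:E by rewrite -EFinD; congr EFin; field.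
apply: le_trans (leeD le (lexx _)).
rewrite /cavg lee_pdivrMl// muleDr//; last first.
  rewrite ge0_adde_def// inE ?lee_fin ?divr_ge0 ?(ltW a0)//.
  by apply: cavg_ge0 => //; case: mh1.
rewrite muleA -EFinM mulfV ?gt_eqF// mul1e.
rewrite (int_restrict mu h (measurable_cube y r)).
rewrite (int_restrict mu (fun y => ind R _ y * h y) (measurable_cube y r)).
have -> : ((2 * r) ^+ n)%:E * (a / 2)%:E = \int[mu]_z (ind R (cube y r) z * (a / 2)%:E).
  rewrite int_Zr//; last by rewrite lee_fin divr_ge0// ltW.
    by rewrite -(mu_cube y r0); congr (_ * _); exact: esym (int_indic _ (measurable_cube y r)).
  by apply: mnn_ind; exact: measurable_cube.
have mI := @mnn_ind R _ _ _ (measurable_cube y r).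
have mc : mnn (fun _ : E => (a / 2)%:E).
  by apply: mnn_cst; rewrite lee_fin divr_ge0// ltW.
rewrite -int_D; try by apply: mnn_mul.
apply: int_le => [| |z]; try by apply: mnn_mul.
  by apply: mnn_add; apply: mnn_mul.
rewrite -ge0_muleDr; [|exact: (mh1.2 z)|exact: (mc.2 z)].
apply: lee_wpmul2l; first exact: ind_ge0.
case: mh => _ h0.
have [zh|zh] := pselect ((a / 2)%:E < h z).
  by rewrite ind_in// mul1e leeDl// lee_fin divr_ge0// ltW.
by rewrite ind_out//= mul0e add0e leNgt; exact/negP.
Qed.

(** Interpolation between the weak type bound and the trivial bound in L^oo. At level
    [b = a ^ p^-1], the weak bound is applied to [h] cut off below [b / 2], and Tonelli's theorem
    leaves the integral of [a ^ (- p^-1)] over [a < (2 h) ^ p], which is computed by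
    [integral_level_le]. *)
Theorem maxf_Lp (p : R) : (1 < p)%R -> exists2 C : R, (0 <= C)%R &
  forall h : E -> \bar R, mnn h ->
  \int[mu]_x (maxf h x `^ p) <= C%:E * \int[mu]_x (h x `^ p).
Proof.
move=> p1; have p0 : (0 < p)%R by lra.
(* The weak type constant [3 ^+ n] at level [b / 2], with the factor [b^-1] taken out. *)
pose K := (2 * 3 ^+ n : R)%R.
have K0 : (0 <= K)%R by rewrite mulr_ge0// exprn_ge0.
exists (K * (p / (p - 1) * 2 `^ (p - 1)))%R.
  rewrite mulr_ge0//; rewrite mulr_ge0 ?powR_ge0// divr_ge0; lra.
move=> h mh; have mu_ := maxf_mnn mh; set u := maxf h in mu_ *.
have mup : mnn (fun x => u x `^ p) by exact: mnn_poweR.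
have mh' : measurable_fun setT (fun z : E * R => h z.1).
  by case: mh => mh _; exact: (measurableT_comp mh measurable_fst).
have ma (q : R) : measurable_fun setT (fun z : E * R => z.2 `^ q)%R.
  exact: (measurableT_comp (measurable_powR q) measurable_snd).
have mS : measurable [set z : E * R | (0 < z.2)%R /\ z.2%:E < u z.1 `^ p].
  apply: measurable_setAnd; first exact: measurable_ltr_set.
  apply: measurable_lte_set.
  - exact: (mfun_EFin measurable_snd).
  - by case: mup => m _; exact: (measurableT_comp m measurable_fst).
have mT : measurable [set z : E * R | (0 < z.2)%R /\ (z.2 `^ p^-1)%:E < 2%:E * h z.1].
  apply: measurable_setAnd; first exact: measurable_ltr_set.
  apply: measurable_lte_set; first exact: (mfun_EFin (ma _)).
  exact: emeasurable_funM.
pose S x a := ind R [set z : E * R | (0 < z.2)%R /\ z.2%:E < u z.1 `^ p] (x, a).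
pose T x a := ind R [set z : E * R | (0 < z.2)%R /\ (z.2 `^ p^-1)%:E < 2%:E * h z.1] (x, a).
have mSS : mnn (fun z : E * R => S z.1 z.2).
  apply: mnn_comp (mnn_ind R mS) _; exact: measurable_fun_pair.
have mTT : mnn (fun z : E * R => T z.1 z.2).
  apply: mnn_comp (mnn_ind R mT) _; exact: measurable_fun_pair.
have mpw : mnn (fun z : E * R => (z.2 `^ (- p^-1))%:E).
  by apply: mnn_EFin => [|z]; [exact: ma|exact: powR_ge0].
have mG : mnn (fun z : E * R => K%:E * (h z.1 * (T z.1 z.2 * (z.2 `^ (- p^-1))%:E))).
  apply: mnn_mul; first exact: mnn_cst.
  apply: mnn_mul; first by apply: mnn_comp mh _.
  exact: mnn_mul.
have -> : \int[mu]_x (u x `^ p) = \int[mu]_x \int[leb]_a S x a.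
  apply: eq_integral => x _; rewrite -[LHS]leb_lt ?poweR_ge0//.
  rewrite -int_indic//; apply: measurable_setAnd; first exact: measurable_ltr_set.
  by apply: measurable_lte_set => //; exact: mfun_EFin.
rewrite tonelli//.
apply: (@le_trans _ _ (\int[leb]_a \int[mu]_x (K%:E * (h x * (T x a * (a `^ (- p^-1))%:E))))).
  apply: int_le; [exact: mnn_int2|exact: mnn_int2|] => a.
  have [a0|a0] := ltP 0%R a; last first.
    rewrite [leLHS]integral0_eq; last first.
      by move=> x _; rewrite /S ind_out//= => -[]; rewrite ltNge a0.
    apply: integral_ge0 => x _; case: mG => _ /(_ (x, a)); exact.
  have b0 : (0 < a `^ p^-1)%R by rewrite powR_gt0.
  set b := (a `^ p^-1)%R in b0 *.
  have mh1 : mnn (fun y => ind R [set y | (b / 2)%:E < h y] y * h y).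
    apply: mnn_mul => //; apply: mnn_ind; apply: measurable_lte_set => //.
    by case: mh.
  have -> : \int[mu]_x S x a = mu [set x | b%:E < u x].
    rewrite -int_indic; last first.
      by apply: measurable_lte_set => //; case: mu_.
    apply: eq_integral => x _; apply/eqP; rewrite eq_le.
    have ux0 : 0 <= u x by case: mu_.
    have bp : (b `^ p)%:E = a%:E by rewrite -powRrM mulVf ?gt_eqF// powRr1// ltW.
    rewrite !ind_sub//=.
    + move=> bu; split => //; rewrite -bp.
      move: bu; case: (u x) ux0 => [v| |] // v0.
        rewrite lte_fin poweR_EFin lte_fin => bv.
        by rewrite gt0_ltr_powR// ?nnegrE// ltW.
      by rewrite poweRyr ?gt_eqF// => _; exact: ltry.
    + move=> [_]; rewrite -bp.
      move: ux0; case: (u x) => [v| |] // v0.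
        rewrite poweR_EFin !lte_fin => bv; rewrite ltNge; apply/negP => vb.
        have : (v `^ p <= b `^ p)%R by rewrite ge0_ler_powR ?nnegrE// ltW.
        by rewrite leNgt bv.
      by rewrite ltry.
  have le1 : mu [set x | b%:E < u x] <=
      mu [set x | (b / 2)%:E < maxf (fun y => ind R [set y | (b / 2)%:E < h y] y * h y) x].
    apply: le_measure; rewrite ?inE.
    - by apply: measurable_lte_set => //; case: mu_.
    - by apply: measurable_lte_set => //; case: (maxf_mnn mh1).
    - by move=> x; exact: maxf_split.
  apply: (le_trans le1); apply: le_trans (maxf_weak mh1 _) _; first by rewrite divr_gt0.
  rewrite -int_Zl//; last by rewrite lee_fin divr_ge0// ?exprn_ge0// divr_ge0// ltW.
  apply: int_le.
  - by apply: mnn_mul => //; apply: mnn_cst; rewrite lee_fin divr_ge0// ?exprn_ge0// divr_ge0// ltW.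
  - exact: (mnn_comp mG (pair2_measurable a)).
  - move=> x; have hx0 : 0 <= h x by case: mh.
    rewrite (muleCA (h x)) (muleCA K%:E) (muleC (h x)) (muleA K%:E) -EFinM.
    rewrite (muleCA _%:E (ind _ _ _)) powRN -/b.
    have -> : (3 ^+ n / (b / 2) = K * b^-1)%R by rewrite /K; field; rewrite gt_eqF.
    apply: lee_wpmul2r; first by rewrite mule_ge0// lee_fin mulr_ge0// invr_ge0 ltW.
    apply: ind_sub => /= H; split => //.
    rewrite -/b; move: H; case: (h x) hx0 => [v| |] // v0; last by move=> _; rewrite mulry gtr0_sg// mul1e ltry.
    by rewrite -EFinM !lte_fin => vb; lra.
rewrite -tonelli//.
have mh2 : mnn (fun x => h x `^ p) by exact: mnn_poweR.
rewrite -int_Zl//; last first.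
  by rewrite lee_fin mulr_ge0// mulr_ge0 ?powR_ge0// divr_ge0; lra.
apply: int_le.
- exact: mnn_int1.
- by apply: mnn_mul => //; apply: mnn_cst; rewrite lee_fin mulr_ge0// mulr_ge0 ?powR_ge0// divr_ge0; lra.
- move=> x; have hx0 : 0 <= h x by case: mh.
  have mTx : mnn (fun a : R => T x a * (a `^ (- p^-1))%:E).
    apply: mnn_mul; first exact: mnn_comp mTT (pair1_measurable x).
    exact: mnn_comp mpw (pair1_measurable x).
  rewrite int_Zl//; last by apply: mnn_mul => //; exact: mnn_cst.
  rewrite int_Zl//.
  have := @integral_level_le R p (2%:E * h x) p1 ltac:(by rewrite mule_ge0).
  move=> le.
  rewrite (EFinM K) -[leRHS]muleA.
  apply: lee_wpmul2l => //.
  apply: le_trans (lee_wpmul2l hx0 le) _.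
  rewrite poweRM// poweR_EFin (EFinM (p / (p - 1))) -[leRHS]muleA.
  by rewrite (muleCA (h x)) (muleCA (h x)) mule_poweRB1.
Qed.

End MaximalStrong.

(** * Cones and change of aperture *)

Section Geometry.
Variables (R : realType) (n : nat).
Local Notation E := (n.-tuple R).
Local Notation mu := (@mu R n).
Local Notation edist := (@Defs.edist R n).
Implicit Types (x y : E) (z : pt R n).

Lemma edistC x y : edist x y = edist y x.
Proof. by rewrite /edist; congr Num.sqrt; apply: eq_bigr => i _; rewrite -sqrrN opprB. Qed.

Lemma edist_coord x y i : (`|tnth x i - tnth y i| <= edist x y)%R.
Proof.
rewrite -sqrtr_sqr ler_sqrt; last by apply: sumr_ge0 => j _; exact: sqr_ge0.
rewrite (bigD1 i)//= lerDl; apply: sumr_ge0 => j _; exact: sqr_ge0.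
Qed.

Lemma edist_le x y (r : R) : (0 <= r)%R -> (forall i, `|tnth x i - tnth y i| <= r)%R ->
  (edist x y <= n%:R * r)%R.
Proof.
move=> r0 H; rewrite -[leRHS]ger0_norm ?mulr_ge0// -sqrtr_sqr ler_sqrt ?sqr_ge0//.
apply: (@le_trans _ _ (\sum_(i < n) r ^+ 2)%R).
  by apply: ler_sum => i _; rewrite -real_normK ?num_real// lerXn2r ?nnegrE.
rewrite sumr_const card_ord exprMn -[leLHS]mulr_natl ler_wpM2r ?sqr_ge0//.
by rewrite -natrX ler_nat; case: n => // m; rewrite leq_pmulr.
Qed.

Lemma ballRn_cube y (t : R) : ballRn y t `<=` cube y t.
Proof. by move=> x xy i; apply: le_lt_trans (edist_coord x y i) xy. Qed.

(** Dividing by [n.+1] makes the inequality strict and keeps the radius positive in dimension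
    zero. *)
Lemma cube_ballRn y (t : R) : (0 < t)%R -> cube y (t / n.+1%:R) `<=` ballRn y t.
Proof.
move=> t0 x xy; rewrite /ballRn/=.
apply: le_lt_trans (edist_le (divr_ge0 (ltW t0) (ler0n _ n.+1)) _) _.
  by move=> i; apply/ltW/xy.
by rewrite mulrCA gtr_pMr// ltr_pdivrMr// mul1r ltr_nat.
Qed.

Section measurability.
Context d (T : measurableType d).

Lemma measurable_edist (f g : T -> E) : measurable_fun setT f -> measurable_fun setT g ->
  measurable_fun setT (fun p => edist (f p) (g p)).
Proof.
move=> /measurable_fun_tnthP mf /measurable_fun_tnthP mg.
apply: (@measurableT_comp _ _ _ _ _ _ (@Num.sqrt R)).
  by apply: continuous_measurable_fun; exact: sqrt_continuous.
by apply: measurable_sum => i; apply: measurable_funX; apply: measurable_funB; [exact: mf|exact: mg].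
Qed.

Lemma measurable_in_cube (f g : T -> E) (r : T -> R) : measurable_fun setT f ->
  measurable_fun setT g -> measurable_fun setT r ->
  measurable [set p | cube (f p) (r p) (g p)].
Proof.
move=> /measurable_fun_tnthP mf /measurable_fun_tnthP mg mr.
apply: measurable_setAll => i; apply: measurable_ltr_set => //.
by apply: measurableT_comp => //; apply: measurable_funB; [exact: mg|exact: mf].
Qed.

End measurability.

Lemma measurable_ballRn y (t : R) : measurable (ballRn y t).
Proof. by apply: measurable_ltr_set => //; exact: measurable_edist. Qed.

(** The measure of the cube inscribed by [cube_ballRn] in the unit ball. It serves as lower density
    of all balls, by scaling. *)
Definition cB : R := (2 / n.+1%:R) ^+ n.

Lemma cB_gt0 : (0 < cB)%R.
Proof. by rewrite exprn_gt0// divr_gt0. Qed.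

Lemma mu_ballRn_ge y (t : R) : (0 < t)%R -> (cB * t ^+ n)%:E <= mu (ballRn y t).
Proof.
move=> t0; rewrite /cB -exprMn.
have -> : (2 / n.+1%:R * t = 2 * (t / n.+1%:R))%R by rewrite -mulrA (mulrC _ t).
rewrite -(mu_cube y); last by rewrite divr_gt0.
apply: le_measure; rewrite ?inE; [exact: measurable_cube|exact: measurable_ballRn|].
exact: cube_ballRn.
Qed.

Lemma mu_ballRn_le y (t : R) : (0 < t)%R -> mu (ballRn y t) <= ((2 * t) ^+ n)%:E.
Proof.
move=> t0; rewrite -(mu_cube y)//.
apply: le_measure; rewrite ?inE; [exact: measurable_ballRn|exact: measurable_cube|].
exact: ballRn_cube.
Qed.

Lemma coneE x z : cone x z <-> (0 < z.2)%R /\ ballRn z.1 z.2 x.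
Proof. by rewrite /cone/ballRn/= edistC. Qed.

Lemma int_mu (A : set E) : measurable A -> \int[mu]_x ind R A x = mu A.
Proof. exact: int_indic. Qed.

(* Chebyshev: at least half of [B] carries values of [a] below a multiple of its
   average. *)
Lemma quant (a phi : E -> \bar R) y (r k : R) (B : set E) (L : \bar R) :
  mnn a -> mnn phi -> (0 < r)%R -> (0 < k)%R -> measurable B -> B `<=` cube y r ->
  (2 * (2 * r) ^+ n)%:E <= k%:E * mu B -> 0 <= L ->
  (forall x, B x -> a x <= k%:E * cavg a y r -> L <= phi x) ->
  L * mu B <= 2%:E * \int[mu]_x (ind R B x * phi x).
Proof.
move=> ma mphi r0 k0 mB sub kB L0 H.
have mc := measurable_cube y r.
have c0 : (0 < (2 * r) ^+ n)%R by rewrite exprn_gt0// mulr_gt0.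
have cavg0 : 0 <= cavg a y r by apply: cavg_ge0 => //; exact: ma.2.
pose m := cavg a y r.
have Bfin : mu B < +oo.
  apply: (@le_lt_trans _ _ (mu (cube y r))); last by rewrite mu_cube// ltry.
  by apply: le_measure; rewrite ?inE.
have mD : measurable (B `&` [set x | k%:E * m < a x]).
  by apply: measurableI => //; apply: measurable_lte_set => //; exact: ma.1.
have mG : measurable (B `&` [set x | a x <= k%:E * m]).
  by apply: measurableI => //; apply: measurable_lee_set => //; exact: ma.1.
have BE : mu B = mu (B `&` [set x | k%:E * m < a x]) + mu (B `&` [set x | a x <= k%:E * m]).
  rewrite -measureU//.
    rewrite -setIUr (_ : _ `|` _ = setT) ?setIT//.
    by apply/seteqP; split => x // _; case: (leP (a x) (k%:E * m)) => h; [right|left].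
  apply/seteqP; split => // x [[_ /= h1] [_ /= h2]].
  by move: h1; rewrite ltNge h2.
have half : mu B <= 2%:E * mu (B `&` [set x | a x <= k%:E * m]).
  suff : 2%:E * mu (B `&` [set x | k%:E * m < a x]) <= mu B.
    have Gfin : mu (B `&` [set x | a x <= k%:E * m]) \is a fin_num.
      rewrite ge0_fin_numE//; apply: le_lt_trans Bfin; apply: le_measure; rewrite ?inE//.
    have Dfin : mu (B `&` [set x | k%:E * m < a x]) \is a fin_num.
      rewrite ge0_fin_numE//; apply: le_lt_trans Bfin; apply: le_measure; rewrite ?inE//.
    rewrite BE -(fineK Gfin) -(fineK Dfin) -!EFinM -!EFinD !lee_fin; lra.
  have [->|D0] := eqVneq (mu (B `&` [set x | k%:E * m < a x])) 0.
    by rewrite mule0.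
  (* Chebyshev's inequality has a factor [m] on both sides, to be cancelled. If [m] is infinite the
     bad set is empty, and if [m] is zero then [a] vanishes almost everywhere on the cube and the
     bad set is null. *)
  have mfin : m < +oo.
    rewrite ltNge leye_eq; apply/eqP => moo; move: D0; rewrite moo.
    rewrite mulry gtr0_sg// mul1e (_ : _ `&` _ = set0) ?measure0 ?eqxx//.
    by apply/seteqP; split => x // [_ /=]; rewrite ltNge leey.
  have mk : k%:E * m * mu (B `&` [set x | k%:E * m < a x]) <= ((2 * r) ^+ n)%:E * m.
    have -> : ((2 * r) ^+ n)%:E * m = \int[mu]_x (ind R (cube y r) x * a x).
      rewrite -int_restrict// /m /cavg muleA -EFinM mulfV ?gt_eqF//.
      by rewrite mul1e.
    rewrite -(int_mu mD) -int_Zl//; last 2 first.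
      exact: mnn_ind.
      by rewrite mule_ge0// lee_fin ltW.
    apply: int_le.
    - by apply: mnn_mul; [apply: mnn_cst; rewrite mule_ge0// lee_fin ltW|exact: mnn_ind].
    - by apply: mnn_mul => //; exact: mnn_ind.
    - move=> x; rewrite muleC.
      have [[Bx lt]|nx] := pselect ((B `&` [set x | k%:E * m < a x]) x); last first.
        by rewrite ind_out// mul0e mule_ge0 ?ind_ge0//; exact: ma.2.
      by rewrite !ind_in ?mul1e ?ltW//; exact: sub.
  have [m0|m0] := eqVneq m 0.
    exfalso; move/eqP: D0; apply.
    have I0 : \int[mu]_x (ind R (cube y r) x * a x) = 0.
      rewrite -int_restrict//; move: m0; rewrite /m /cavg => /eqP.
      rewrite mule_eq0 => /orP[|/eqP//]; rewrite eqe invr_eq0.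
      by rewrite gt_eqF.
    have ca : mnn (fun x => ind R (cube y r) x * a x).
      by apply: mnn_mul => //; exact: mnn_ind.
    have N0 := int_eq0 ca I0.
    apply: (subset_measure0 mD _ _ N0).
      by have := emeasurable_neq measurableT ca.1 0; rewrite setTI.
    move=> x [Bx /=]; rewrite m0 mule0 => ax; rewrite ind_in; last exact: sub.
    by rewrite mul1e gt_eqF.
  have mp : 0 < m by rewrite lt_def m0.
  have mfn : m \is a fin_num by rewrite ge0_fin_numE.
  have Dfin : mu (B `&` [set x | k%:E * m < a x]) \is a fin_num.
    rewrite ge0_fin_numE//; apply: le_lt_trans Bfin; apply: le_measure; rewrite ?inE//.
  have Bfn : mu B \is a fin_num by rewrite ge0_fin_numE.
  move: mk kB mp Dfin; set DD := mu (B `&` _) => + + + Dfin.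
  rewrite -(fineK mfn) -(fineK Dfin) -(fineK Bfn) -!EFinM !lee_fin lte_fin.
  set D := fine DD; set b := fine (mu B); set mm := fine m; set c := ((2 * r) ^+ n)%R => h1 h2 h3.
  have h4 : (k * D <= c)%R by rewrite -(ler_pM2r h3) mulrAC.
  by rewrite -(ler_pM2l k0); lra.
apply: (le_trans (lee_wpmul2l L0 half)).
rewrite muleCA; apply: lee_wpmul2l => //.
rewrite -(int_mu mG) -int_Zl//; last exact: mnn_ind.
apply: int_le.
- by apply: mnn_mul; [exact: mnn_cst|exact: mnn_ind].
- by apply: mnn_mul => //; exact: mnn_ind.
- move=> x; have [[Bx le]|nx] := pselect ((B `&` [set x | a x <= k%:E * m]) x).
    by rewrite !ind_in// mule1 mul1e; exact: H.
  by rewrite [X in _ * X]ind_out// mule0 mule_ge0 ?ind_ge0//; exact: mphi.2.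
Qed.

End Geometry.

Section Aperture.
Variables (R : realType) (n : nat).
Local Notation E := (n.-tuple R).
Local Notation mu := (@mu R n).
Local Notation nu := (@nu R n).
Local Notation cone := (@cone R n).
Local Notation ballRn := (@ballRn R n).
Implicit Types (x y : E) (z : pt R n).

Lemma ind_eq T U (A : set T) (B : set U) a b : (A a <-> B b) -> ind R A a = ind R B b.
Proof. by move=> AB; apply/eqP; rewrite eq_le !ind_sub//; apply AB. Qed.

Lemma mnn_ind2 d (T : measurableType d) U (S : T -> set U) (f : T -> U) :
  measurable [set p | S p (f p)] -> mnn (fun p => ind R (S p) (f p)).
Proof.
move=> mS; rewrite (_ : (fun p => _) = ind R [set p | S p (f p)]); first exact: mnn_ind.
by apply/funext => p; apply: ind_eq.
Qed.

Definition ccone (l : R) x : set (pt R n) := [set z | (0 < z.2)%R /\ cube z.1 (l * z.2) x].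

(** Power of the area functional, with both the density and the power of t absorbed into [w]. The
    tent space case is [w = wq q g]. *)
Definition Acone (w : pt R n -> \bar R) x := \int[nu]_z (ind R (cone x) z * w z).
Definition Acube (l : R) (w : pt R n -> \bar R) x := \int[nu]_z (ind R (ccone l x) z * w z).

Section measurability.
Context d (T : measurableType d).
Variables (f : T -> E) (g : T -> pt R n).
Hypotheses (mf : measurable_fun setT f) (mg : measurable_fun setT g).

Let mg1 : measurable_fun setT (fun p => (g p).1).
Proof. exact: (measurableT_comp measurable_fst mg). Qed.

Let mg2 : measurable_fun setT (fun p => (g p).2).
Proof. exact: (measurableT_comp measurable_snd mg). Qed.

Lemma measurable_in_cone : measurable [set p | cone (f p) (g p)].
Proof.
apply: measurable_setAnd; first exact: measurable_ltr_set.
by apply: measurable_ltr_set => //; exact: measurable_edist.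
Qed.

Lemma measurable_in_ball : measurable [set p | ballRn (g p).1 (g p).2 (f p)].
Proof. by apply: measurable_ltr_set => //; exact: measurable_edist. Qed.

Lemma measurable_in_ccone l : measurable [set p | ccone l (f p) (g p)].
Proof.
apply: measurable_setAnd; first exact: measurable_ltr_set.
by apply: measurable_in_cube => //; exact: measurable_funM.
Qed.

End measurability.

Lemma Acone_mnn2 w : mnn w -> mnn (fun p : E * pt R n => ind R (cone p.1) p.2 * w p.2).
Proof.
move=> mw; apply: mnn_mul; first exact/mnn_ind2/measurable_in_cone.
exact: mnn_comp mw _.
Qed.

Lemma Acube_mnn2 l w : mnn w -> mnn (fun p : E * pt R n => ind R (ccone l p.1) p.2 * w p.2).
Proof.
move=> mw; apply: mnn_mul; first exact/mnn_ind2/measurable_in_ccone.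
exact: mnn_comp mw _.
Qed.

Lemma Acone_mnn w : mnn w -> mnn (Acone w).
Proof. by move=> mw; exact: mnn_int1 (Acone_mnn2 mw). Qed.

Lemma Acube_mnn l w : mnn w -> mnn (Acube l w).
Proof. by move=> mw; exact: mnn_int1 (Acube_mnn2 l mw). Qed.

(** Tonelli's theorem together with the duality between cones and balls: [z] lies in the cone of [x]
    when [x] lies in the ball of [z]. *)
Lemma weight_Acone (psi : E -> \bar R) w : mnn psi -> mnn w ->
  \int[mu]_x (psi x * Acone w x) =
  \int[nu]_z (ind R (@Hp R n) z * w z * \int[mu]_x (ind R (ballRn z.1 z.2) x * psi x)).
Proof.
move=> mpsi mw.
have mF : mnn (fun p : E * pt R n => psi p.1 * (ind R (cone p.1) p.2 * w p.2)).
  by apply: mnn_mul; [exact: mnn_comp mpsi _|exact: Acone_mnn2].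
transitivity (\int[mu]_x \int[nu]_z (psi x * (ind R (cone x) z * w z))).
  apply: eq_integral => x _; rewrite int_Zl//; last exact: mpsi.2.
  exact: mnn_comp (Acone_mnn2 mw) (pair1_measurable x).
rewrite (tonelli mu nu mF); apply: eq_integral => z _.
rewrite -int_Zl//; last 2 first.
- apply: mnn_mul => //; apply: mnn_ind; exact: measurable_ballRn.
- by rewrite mule_ge0 ?ind_ge0//; exact: mw.2.
apply: eq_integral => x _; have [z0|z0] := pselect (Hp z).
  rewrite (ind_in R z0) mul1e [LHS]muleA [LHS]muleC; congr (_ * _); rewrite muleC; congr (_ * _).
  apply: ind_eq; rewrite coneE; split; [by case|by split].
by rewrite (ind_out _ z0) !mul0e ind_out ?mul0e ?mule0// => -[].
Qed.

Lemma weight_Acube l (phi : E -> \bar R) w : mnn phi -> mnn w ->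
  \int[mu]_x (phi x * Acube l w x) =
  \int[nu]_z (ind R (@Hp R n) z * w z * \int[mu]_x (ind R (cube z.1 (l * z.2)) x * phi x)).
Proof.
move=> mphi mw.
have mF : mnn (fun p : E * pt R n => phi p.1 * (ind R (ccone l p.1) p.2 * w p.2)).
  by apply: mnn_mul; [exact: mnn_comp mphi _|exact: Acube_mnn2].
transitivity (\int[mu]_x \int[nu]_z (phi x * (ind R (ccone l x) z * w z))).
  apply: eq_integral => x _; rewrite int_Zl//; last exact: mphi.2.
  exact: mnn_comp (Acube_mnn2 l mw) (pair1_measurable x).
rewrite (tonelli mu nu mF); apply: eq_integral => z _.
rewrite -int_Zl//; last 2 first.
- apply: mnn_mul => //; apply: mnn_ind; exact: measurable_cube.
- by rewrite mule_ge0 ?ind_ge0//; exact: mw.2.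
apply: eq_integral => x _; have [z0|z0] := pselect (Hp z).
  rewrite (ind_in R z0) mul1e [LHS]muleA [LHS]muleC; congr (_ * _); rewrite muleC; congr (_ * _).
  by apply: ind_eq; split; [case|split].
by rewrite (ind_out _ z0) !mul0e ind_out ?mul0e ?mule0// => -[].
Qed.

Lemma measurable_Hp : measurable (@Hp R n).
Proof. by apply: measurable_ltr_set => //; exact: measurable_snd. Qed.

(** After Tonelli's theorem, an area functional sees a weight on R^n only through its integrals over
    balls, or over cubes. A comparison of two weights at that level is therefore a change of
    aperture, uniform in [w]. *)
Lemma weight_transfer (l C : R) (phi psi : E -> \bar R) : (0 <= C)%R -> mnn phi -> mnn psi ->
  (forall y (t : R), (0 < t)%R ->
     \int[mu]_x (ind R (cube y (l * t)) x * phi x) <=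
     C%:E * \int[mu]_x (ind R (ballRn y t) x * psi x)) ->
  forall w, mnn w -> \int[mu]_x (phi x * Acube l w x) <= C%:E * \int[mu]_x (psi x * Acone w x).
Proof.
move=> C0 mphi mpsi H w mw; rewrite weight_Acone// weight_Acube//.
have mW : mnn (fun z => ind R (@Hp R n) z * w z).
  by apply: mnn_mul => //; apply: mnn_ind; exact: measurable_Hp.
have m1 : mnn (fun z : pt R n => \int[mu]_x (ind R (cube z.1 (l * z.2)) x * phi x)).
  apply: (@mnn_int2 _ _ _ _ _ mu (fun (x : E) (z : pt R n) => ind R (cube z.1 (l * z.2)) x * phi x)).
  apply: mnn_mul; last exact: mnn_comp mphi _.
  apply: mnn_ind2; apply: measurable_in_cube => //.
    exact: (measurableT_comp measurable_fst measurable_snd).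
  by apply: measurable_funM => //; exact: (measurableT_comp measurable_snd measurable_snd).
have m2 : mnn (fun z : pt R n => \int[mu]_x (ind R (ballRn z.1 z.2) x * psi x)).
  apply: (@mnn_int2 _ _ _ _ _ mu (fun (x : E) (z : pt R n) => ind R (ballRn z.1 z.2) x * psi x)).
  apply: mnn_mul; last exact: mnn_comp mpsi _.
  exact/mnn_ind2/measurable_in_ball.
have mm2 : mnn (fun z : pt R n => ind R (@Hp R n) z * w z *
   \int[mu]_x (ind R (ballRn z.1 z.2) x * psi x)) by exact: mnn_mul.
rewrite -int_Zl//; apply: int_le.
- exact: mnn_mul.
- by apply: mnn_mul => //; exact: mnn_cst.
- move=> z; have [z0|z0] := pselect (Hp z).
    rewrite muleCA; apply: lee_wpmul2l; [exact: mW.2|exact: H].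
  by rewrite (ind_out _ z0) !mul0e mule0.
Qed.

End Aperture.

(** * Powers and inverses of extended reals *)

Section Powers.
Variable R : realType.

Lemma mnn_inve d (T : measurableType d) (f : T -> \bar R) : mnn f -> mnn (fun x => (f x)^-1).
Proof.
move=> [mf f0]; split=> [|x]; last by rewrite inve_ge0.
move=> mT; apply: (measurability _ (ErealGenOInfty.measurableE R)) => //.
move=> _ [_ [c ->] <-]; rewrite setTI.
rewrite (_ : _ @^-1` _ = [set x | c%:E < (f x)^-1]); last first.
  by apply/seteqP; split=> x /=; rewrite in_itv/= andbT.
have [c0|c0] := ltP c 0%R.
  rewrite (_ : [set x | _] = setT)//; apply/seteqP; split=> x //= _.
  by apply: (@lt_le_trans _ _ 0); rewrite ?lte_fin// inve_ge0.
rewrite (_ : [set x | _] = [set x | f x < (c%:E)^-1]).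
  exact: measurable_lte_set.
apply/seteqP; split=> x /=; rewrite inve_pgt// inE ?lee_fin//.
Qed.

Lemma le_poweR (x y : \bar R) (r : R) : (0 <= r)%R -> 0 <= x -> x <= y -> x `^ r <= y `^ r.
Proof.
move=> r0 x0 xy; apply: gt0_ler_poweR => //.
- by rewrite in_itv/= x0 leey.
- by rewrite in_itv/= (le_trans x0 xy) leey.
Qed.

(** If [v <= M] the second term is enough. Otherwise [v ^ s] is [v] times [v ^ (s - 1)], and the
    latter only grows when [v] is lowered to [M]. For [M = 0] and [s < 1] the inverse is infinite
    and the bound is trivial. *)
Lemma poweR_split (v M : \bar R) (s : R) : (0 < s)%R -> (s <= 1)%R -> 0 <= v -> 0 <= M ->
  v `^ s <= (M `^ (1 - s))^-1 * v + M `^ s.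
Proof.
move=> s0 s1 v0 M0; have e0 : (0 <= 1 - s)%R by rewrite subr_ge0.
have Mv0 : 0 <= (M `^ (1 - s))^-1 by rewrite inve_ge0 poweR_ge0.
have [vM|Mv] := leP v M.
  apply: le_trans (le_poweR (ltW s0) v0 vM) _.
  by rewrite leeDr// mule_ge0.
apply: le_trans _ (leeDl _ (poweR_ge0 _ _)).
case: M M0 Mv Mv0 => [M| |]//; rewrite ?lee_fin => M0 Mv Mv0; last first.
  by move: Mv; rewrite ltNge leey.
have [M00|Mp] := eqVneq M 0%R.
  have [s10|s1'] := eqVneq s 1%R.
    by rewrite s10 subrr poweRe0 inve1 mul1e poweRe1.
  have e1 : (1 - s != 0)%R by rewrite subr_eq0 eq_sym.
  rewrite M00 poweR0r// inve0.
  move: Mv; rewrite M00; case: v v0 => [v| |]//= v0; rewrite ?lte_fin => vp.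
    by rewrite mulyr gtr0_sg// mul1e leey.
  by rewrite mulyy leey.
have Mp0 : (0 < M)%R by rewrite lt_neqAle eq_sym Mp.
rewrite poweR_EFin inver gt_eqF ?powR_gt0//.
case: v v0 Mv => [v| |]// v0; last first.
  by move=> _; rewrite gt0_muley ?leey// lte_fin invr_gt0 powR_gt0.
rewrite lte_fin => Mv; have vp : (0 < v)%R by exact: lt_trans Mv.
rewrite poweR_EFin -EFinM lee_fin mulrC ler_pdivlMr ?powR_gt0//.
rewrite [leRHS](_ : v = v `^ s * v `^ (1 - s))%R; last first.
  rewrite -powRD; last by rewrite (gt_eqF vp) implybT.
  by rewrite addrC subrK powRr1// ltW.
rewrite ler_wpM2l ?powR_ge0//; apply: ge0_ler_powR => //; rewrite ?nnegrE ltW//.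
Qed.

(** An equality for [0 < v < +oo]. At 0, an infinite inverse times 0 is 0; at infinity the
    right-hand side is infinite. *)
Lemma inve_poweR_mul (v : \bar R) (s : R) : (0 < s)%R -> (s <= 1)%R -> 0 <= v ->
  (v `^ (1 - s))^-1 * v <= v `^ s.
Proof.
move=> s0 s1; case: v => [v| |]// v0; last first.
  by rewrite [leRHS]poweRyr ?leey// gt_eqF.
have [->|vp] := eqVneq v 0%R; first by rewrite mule0 poweR_ge0.
have v1 : (0 < v)%R by rewrite lt_neqAle eq_sym vp.
rewrite poweR_EFin inver gt_eqF ?powR_gt0// poweR_EFin -EFinM lee_fin.
rewrite mulrC ler_pdivrMr ?powR_gt0// -powRD ?vp ?implybT//.
by rewrite addrC subrK powRr1// ltW.
Qed.

(** Young's inequality with a small parameter and without sharp constants: when [a] is at most [eta]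
    times [b ^ (s - 1)^-1], the first term dominates; otherwise solving for [b] makes the second one
    dominate. *)
Lemma young_eps (a b : \bar R) (s eta : R) : (1 < s)%R -> (0 < eta)%R -> 0 <= a -> 0 <= b ->
  a * b <= eta%:E * b `^ (s / (s - 1)) + (eta `^ (1 - s))%:E * a `^ s.
Proof.
move=> s1 eta0; have s0 : (0 < s)%R by lra.
have s10 : (0 < s - 1)%R by lra.
have q0 : (0 < s / (s - 1))%R by rewrite divr_gt0.
have e0 : (0 < eta `^ (1 - s))%R by rewrite powR_gt0.
case: a => [a| |]// a0; last first.
  move=> b0; rewrite [+oo `^ s]poweRyr ?gt_eqF// [(eta `^ _)%:E * _]gt0_muley ?lte_fin//.
  by rewrite addey ?leey// gt_eqF// (lt_le_trans ltNy0)// mule_ge0 ?poweR_ge0// lee_fin ltW.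
case: b => [b| |]// b0; last first.
  rewrite [+oo `^ _]poweRyr ?gt_eqF// [eta%:E * _]gt0_muley ?lte_fin// addye ?leey//.
rewrite !poweR_EFin -!EFinM -EFinD lee_fin; rewrite !lee_fin in a0 b0.
have h1 : (0 <= eta * b `^ (s / (s - 1)))%R by rewrite mulr_ge0 ?powR_ge0// ltW.
have h2 : (0 <= eta `^ (1 - s) * a `^ s)%R by rewrite mulr_ge0 ?powR_ge0// ltW.
have Eb : (b `^ (s / (s - 1)) = b * b `^ ((s - 1)^-1))%R.
  rewrite -[in RHS](powRr1 b0) -powRrM mul1r.
  have -> : (s / (s - 1) = 1 + (s - 1)^-1)%R by field; rewrite gt_eqF.
  by rewrite powRD// gt_eqF// addr_gt0// invr_gt0.
have [ab|ab] := leP a (eta * b `^ ((s - 1)^-1))%R.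
  apply: (@le_trans _ _ (eta * b `^ (s / (s - 1)))%R); last by rewrite lerDl.
  by rewrite Eb mulrCA mulrC ler_wpM2l.
have bb : (b <= (a / eta) `^ (s - 1))%R.
  have H : (b `^ ((s - 1)^-1) <= a / eta)%R by rewrite ler_pdivlMr// mulrC ltW.
  have := @ge0_ler_powR R (s - 1) (ltW s10) _ _ _ _ H.
  rewrite -powRrM mulVf ?gt_eqF// powRr1//; apply.
  - by rewrite nnegrE powR_ge0.
  - by rewrite nnegrE divr_ge0// ltW.
apply: (@le_trans _ _ (a * (a / eta) `^ (s - 1))%R); first by rewrite ler_wpM2l.
have -> : (a * (a / eta) `^ (s - 1) = eta `^ (1 - s) * a `^ s)%R.
  rewrite powRM// ?invr_ge0 ?ltW// mulrA mulr_powRB1// mulrC; congr (_ * _)%R.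
  by rewrite -powR_inv1 ?ltW// -powRrM mulN1r opprB.
by rewrite lerDr.
Qed.

End Powers.

Section ApertureChange.
Variables (R : realType) (n : nat).
Local Notation E := (n.-tuple R).
Local Notation mu := (@mu R n).
Local Notation ballRn := (@ballRn R n).
Local Notation cB := (cB R n).
Implicit Types (x y : E) (z : pt R n).

Lemma inve_le_scale (k : R) (u v : \bar R) : (0 < k)%R -> 0 <= u -> 0 <= v ->
  u <= k%:E * v -> v^-1 <= k%:E * u^-1.
Proof.
move=> k0 u0 v0 uv.
have [->|un] := eqVneq u 0; first by rewrite inve0 gt0_muley ?leey// lte_fin.
have [->|vn] := eqVneq v +oo.
  by rewrite invey mule_ge0// ?inve_ge0// lee_fin ltW.
case: v v0 vn uv => [v| |]// v0 _ uv.
case: u u0 un uv => [u| |]// u0 un.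
rewrite -EFinM lee_fin => uv.
have up : (0 < u)%R by rewrite lt_neqAle eq_sym -eqe un.
have vp : (0 < v)%R by rewrite -(pmulr_rgt0 _ k0); exact: lt_le_trans uv.
rewrite !inver !gt_eqF// -EFinM lee_fin ler_pdivlMr// mulrC ler_pdivrMr//.
Qed.

(** The smallest constant for which the size condition of [quant] follows from the lower density
    [cB], for a ball of radius t inside a cube of radius [Num.max 1 l * t]. The maximum makes that
    cube contain the ball as well as the cube of aperture [l]. *)
Definition kap (l : R) : R := (2 * (2 * Num.max 1 l) ^+ n / cB)%R.

Lemma kap_gt0 l : (0 < kap l)%R.
Proof.
rewrite /kap divr_gt0 ?cB_gt0// mulr_gt0// exprn_gt0// mulr_gt0//.
by rewrite lt_max ltr01.
Qed.

Lemma max1_gt0 (l : R) : (0 < Num.max 1 l)%R. Proof. by rewrite lt_max ltr01. Qed.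

Lemma kap_ball l y (t : R) : (0 < t)%R ->
  (2 * (2 * (Num.max 1 l * t)%R) ^+ n)%:E <= (kap l)%:E * mu (ballRn y t).
Proof.
move=> t0; apply: (@le_trans _ _ ((kap l)%:E * (cB * t ^+ n)%:E)); last first.
  by apply: lee_wpmul2l; [rewrite lee_fin ltW// kap_gt0|exact: mu_ballRn_ge].
rewrite -EFinM lee_fin /kap [leRHS]mulrA divfK ?gt_eqF ?cB_gt0//.
by rewrite -[leRHS]mulrA -exprMn mulrA.
Qed.

Lemma ball_sub_maxcube l y (t : R) : (0 < t)%R ->
  ballRn y t `<=` cube y (Num.max 1 l * t)%R.
Proof.
move=> t0; apply: subset_trans (@ballRn_cube _ _ y t) _.
apply: cube_sub => i; rewrite subrr normr0 add0r ler_peMl ?(ltW t0)//.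
by rewrite le_max lexx.
Qed.

Lemma cube_sub_maxcube l y (t : R) : (0 < t)%R ->
  cube y (l * t) `<=` cube y (Num.max 1 l * t)%R.
Proof.
move=> t0; apply: cube_sub => i; rewrite subrr normr0 add0r ler_wpM2r ?(ltW t0)//.
by rewrite le_max lexx orbT.
Qed.

(** [quant] with the average replaced by the maximal function at any point [x] of the wider cube.
    Its good half of the ball then does not depend on an average that varies with the cube, which is
    what allows [phi x] to be bounded for each [x] separately. *)
Lemma quant_maxf (a phi : E -> \bar R) (l t : R) x y (L : \bar R) :
  mnn a -> mnn phi -> (0 < t)%R -> cube y (l * t) x -> 0 <= L ->
  (forall x', ballRn y t x' -> a x' <= (kap l * 2 ^+ n)%:E * maxf a x -> L <= phi x') ->
  L <= (2 / (cB * t ^+ n))%:E * \int[mu]_x' (ind R (ballRn y t) x' * phi x').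
Proof.
move=> ma mphi t0 xy L0 H.
have ct : (0 < cB * t ^+ n)%R by rewrite mulr_gt0 ?cB_gt0// exprn_gt0.
have r0 : (0 < Num.max 1 l * t)%R by rewrite mulr_gt0// max1_gt0.
have := @quant R n a phi y (Num.max 1 l * t)%R (kap l) (ballRn y t) L ma mphi r0
  (kap_gt0 l) (measurable_ballRn y t) (ball_sub_maxcube l t0) (kap_ball l y t0) L0.
move=> Q0.
have Q : L * mu (ballRn y t) <= 2%:E * \int[mu]_x0 (ind R (ballRn y t) x0 * phi x0).
  apply: Q0 => x' Bx' le; apply: H => //; apply: (le_trans le).
  rewrite (EFinM (kap l)) -muleA; apply: lee_wpmul2l; first by rewrite lee_fin ltW// kap_gt0.
  by apply: cavg_le_maxf => //; exact: cube_sub_maxcube xy.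
rewrite mulrC EFinM -muleA lee_pdivlMl// muleC; apply: le_trans Q.
by apply: lee_wpmul2l => //; exact: mu_ballRn_ge.
Qed.

(* With [a = (Acone w) ^ (s/2)] and [M = (maxf a) ^ (2/s)], split
   [A ^ s <= M ^ (s-1) * A + M ^ s], A = Acube l w; the weight [M ^ (s-1)] on a cube is
   dominated by the mean of [(Acone w) ^ (s-1)] on the concentric ball ([quant_maxf]). *)
Lemma aperture_le1 (s l : R) : (0 < s)%R -> (s <= 1)%R -> (0 < l)%R ->
  exists2 C : R, (0 <= C)%R & forall w, mnn w ->
    \int[mu]_x (Acube l w x `^ s) <= C%:E * \int[mu]_x (Acone w x `^ s).
Proof.
move=> s0 s1 l0.
have [C2 C20 M2] := @maxf_Lp R n 2%R ltac:(lra).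
(* The exponent for which [a x ^ e] is [A x ^ (1 - s)], since [a] is the power [s / 2] of [A]; so
   [b ^ e] is the power [1 - s] of [b ^ (2 / s)]. *)
pose e := (2 / s * (1 - s))%R.
have e0 : (0 <= e)%R by rewrite mulr_ge0 ?subr_ge0// divr_ge0// ltW.
pose c := (kap l * 2 ^+ n)%R.
have c0 : (0 < c)%R by rewrite mulr_gt0 ?kap_gt0// exprn_gt0.
pose C1 := ((2 * l) ^+ n * (2 / cB * c `^ e))%R.
have C10 : (0 <= C1)%R.
  by rewrite mulr_ge0 ?exprn_ge0 ?mulr_ge0 ?powR_ge0 ?invr_ge0 ?ltW// ?mulr_gt0// cB_gt0.
exists (C1 + C2)%R; first by rewrite addr_ge0.
move=> w mw; have mA := Acone_mnn mw; have mAl := Acube_mnn l mw.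
set A := Acone w in mA *; set Al := Acube l w in mAl *.
pose a x := A x `^ (s / 2).
have ma : mnn a by exact: mnn_poweR.
have mb := maxf_mnn ma; set b := maxf a in mb *.
pose phi x := (b x `^ e)^-1; pose psi x := (A x `^ (1 - s))^-1.
have mphi : mnn phi by apply/mnn_inve/mnn_poweR.
have mpsi : mnn psi by apply/mnn_inve/mnn_poweR.
have claim y (t : R) : (0 < t)%R -> \int[mu]_x (ind R (cube y (l * t)) x * phi x) <=
     C1%:E * \int[mu]_x (ind R (ballRn y t) x * psi x).
  move=> t0; have ct : (0 < cB * t ^+ n)%R by rewrite mulr_gt0 ?cB_gt0// exprn_gt0.
  have lt0 : (0 < l * t)%R by rewrite mulr_gt0.
  have mball : mnn (fun x => ind R (ballRn y t) x * psi x).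
    by apply: mnn_mul => //; apply: mnn_ind; exact: measurable_ballRn.
  set J := \int[mu]_x (ind R (ballRn y t) x * psi x).
  have J0 : 0 <= J by exact: int_ge0.
  pose K := (2 / (cB * t ^+ n) * c `^ e)%R.
  have K0 : (0 <= K)%R by rewrite mulr_ge0 ?powR_ge0// divr_ge0// ltW.
  have pt_le x : cube y (l * t) x -> phi x <= K%:E * J.
    move=> xy.
    have := @quant_maxf a (fun x' => (c `^ e)%:E * psi x') l t x y (phi x) ma _ t0 xy (mphi.2 x).
    have mcpsi : mnn (fun x' => (c `^ e)%:E * psi x').
      by apply: mnn_mul => //; apply: mnn_cst; rewrite lee_fin powR_ge0.
    have E1 : \int[mu]_x' (ind R (ballRn y t) x' * ((c `^ e)%:E * psi x')) = (c `^ e)%:E * J.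
      under eq_integral do rewrite muleCA.
      by rewrite int_Zl// lee_fin powR_ge0.
    rewrite E1 muleA -EFinM; apply=> // x' Bx' le.
    apply: inve_le_scale; rewrite ?poweR_ge0 ?powR_gt0//.
    have -> : A x' `^ (1 - s) = a x' `^ e.
      rewrite /a -poweRrM; congr (_ `^ _); rewrite /e; field; rewrite gt_eqF//.
    rewrite -poweR_EFin -poweRM ?lee_fin ?(ltW c0)//; last exact: mb.2.
    by apply: le_poweR => //; exact: poweR_ge0.
  apply: (@le_trans _ _ (\int[mu]_x (ind R (cube y (l * t)) x * (K%:E * J)))).
    apply: int_le.
    - by apply: mnn_mul => //; apply: mnn_ind; exact: measurable_cube.
    - apply: mnn_mul; first by apply: mnn_ind; exact: measurable_cube.
      by apply: mnn_cst; rewrite mule_ge0.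
    - move=> x; have [xy|xy] := pselect (cube y (l * t) x).
        by rewrite ind_in// !mul1e; exact: pt_le.
      by rewrite ind_out// !mul0e.
  rewrite int_Zr; last 2 first.
  - by apply: mnn_ind; exact: measurable_cube.
  - by rewrite mule_ge0.
  rewrite (int_mu (measurable_cube y (l * t))) mu_cube// muleA -EFinM.
  apply: lee_wpmul2r => //; rewrite lee_fin /K /C1 le_eqVlt; apply/orP; left; apply/eqP.
  rewrite !exprMn; field; rewrite !gt_eqF ?cB_gt0 ?exprn_gt0//.
have W := weight_transfer C10 mphi mpsi claim mw; rewrite -/Al -/A in W.
have mAs : mnn (fun x => A x `^ s) by exact: mnn_poweR.
apply: (@le_trans _ _ (\int[mu]_x (phi x * Al x + b x `^ 2))).
  apply: int_le; [exact: mnn_poweR| |].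
    by apply: mnn_add; [exact: mnn_mul|exact: mnn_poweR].
  move=> x; have := @poweR_split R (Al x) (b x `^ (2 / s)) s s0 s1 (mAl.2 x) (poweR_ge0 _ _).
  by rewrite -!poweRrM divfK ?gt_eqF.
rewrite int_D; [|exact: mnn_mul|exact: mnn_poweR].
rewrite EFinD ge0_muleDl ?lee_fin//; apply: leeD.
- apply: (le_trans W); apply: lee_wpmul2l; first by rewrite lee_fin.
  apply: int_le => [| |x]; [exact: mnn_mul|by []|].
  by apply: inve_poweR_mul => //; exact: mA.2.
- apply: (le_trans (M2 a ma)); apply: lee_wpmul2l; first by rewrite lee_fin.
  rewrite le_eqVlt; apply/orP; left; apply/eqP; apply: eq_integral => x _.
  by rewrite /a -poweRrM divfK.
Qed.

Let cube0 (k : nat) : set E := cube [tuple of nseq n 0%R] k.+1%:R.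

(** Truncating in space and in height makes the integrals finite, which the absorption argument of
    [aperture_gt1] needs. Monotone convergence removes the truncation. *)
Lemma exhaust_le (s : R) (f : E -> \bar R) (D : \bar R) : (1 <= s)%R -> mnn f ->
  (forall k, \int[mu]_x (ind R (cube0 k) x * mine (f x) k.+1%:R%:E `^ s) <= D) ->
  \int[mu]_x (f x `^ s) <= D.
Proof.
move=> s1 mf H; have s0 : (0 <= s)%R by lra.
pose g k x := ind R (cube0 k) x * mine (f x) k.+1%:R%:E `^ s.
have mg k : mnn (g k).
  apply: mnn_mul; first by apply: mnn_ind; exact: measurable_cube.
  by apply: mnn_poweR; apply: mnn_mine => //; apply: mnn_cst; rewrite lee_fin.
have nd x : nondecreasing_seq (g ^~ x).
  move=> i j ij; apply: lee_pmul; rewrite ?ind_ge0 ?poweR_ge0//.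
  - apply: ind_sub; apply: cube_sub => m; rewrite subrr normr0 add0r ler_nat.
    by rewrite ltnS.
  - apply: le_poweR => //; first by rewrite le_min lee_fin ler0n (mf.2 x).
    by rewrite le_min !ge_min lexx/= lee_fin ler_nat ltnS ij orbT.
apply: (@le_trans _ _ (\int[mu]_x limn (g ^~ x))).
  apply: int_le => [| |x]; first exact: mnn_poweR.
    split; last by move=> x; apply: lime_ge; [exact: ereal_nondecreasing_is_cvgn|apply: nearW => k; exact: (mg k).2].
    apply: (emeasurable_fun_cvg (fun k x => g k x)) => [k|x _]; first exact: (mg k).1.
    exact: ereal_nondecreasing_is_cvgn.
  have le_lim k : g k x <= limn (g ^~ x).
    rewrite (cvg_lim _ (ereal_nondecreasing_cvgn (nd x)))//.
    by apply: ereal_sup_ubound; exists k.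
  have inc k : (Num.truncn (\sum_(i < n) `|tnth x i|) <= k)%N -> cube0 k x.
    move=> ck i; rewrite tnth_nseq subr0.
    apply: (@le_lt_trans _ _ (\sum_(i < n) `|tnth x i|)%R).
      by rewrite (bigD1 i)//= lerDl sumr_ge0.
    by apply: lt_le_trans (truncnS_gt _) _; rewrite ler_nat ltnS.
  move: (mf.2 x) le_lim; rewrite /g; case: (f x) => [v| |]// v0 le_lim; last first.
    have sp : (0 < s)%R by lra.
    rewrite [leLHS]poweRyr ?gt_eqF//.
    rewrite leye_eq; apply/eqP/eq_infty => r.
    set k := maxn (Num.truncn (\sum_(i < n) `|tnth x i|)) (Num.truncn r).
    apply: le_trans (le_lim k); rewrite ind_in; last by apply: inc; rewrite leq_maxl.
    rewrite mul1e min_r ?leey// poweR_EFin lee_fin.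
    apply: (@le_trans _ _ k.+1%:R); last by apply: le1r_powR => //; rewrite ler1n.
    apply/ltW/(lt_le_trans (truncnS_gt _)); rewrite ler_nat ltnS; exact: leq_maxr.
  set k := maxn (Num.truncn (\sum_(i < n) `|tnth x i|)) (Num.truncn v).
  apply: le_trans (le_lim k); rewrite ind_in; last by apply: inc; rewrite leq_maxl.
  rewrite mul1e min_l// lee_fin.
  apply/ltW/(lt_le_trans (truncnS_gt _)); rewrite ler_nat ltnS; exact: leq_maxr.
rewrite (monotone_convergence _ measurableT (fun k => (mg k).1)); last 2 first.
- by move=> k x _; exact: (mg k).2.
- by move=> x _; exact: nd.
apply: lime_le; last exact: nearW.
apply: ereal_nondecreasing_is_cvgn => i j ij; apply: int_le => // x; exact: nd.
Qed.

(* Duality: test [Acube l w] against a truncation [h] of its own power [s-1], move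
   the wider aperture onto [h] as [maxf h], and absorb by Young's inequality. *)
Lemma aperture_gt1 (s l : R) : (1 < s)%R -> (0 < l)%R ->
  exists2 C : R, (0 <= C)%R & forall w, mnn w ->
    \int[mu]_x (Acube l w x `^ s) <= C%:E * \int[mu]_x (Acone w x `^ s).
Proof.
move=> s1 l0; have s0 : (0 < s)%R by lra.
have s10 : (0 < s - 1)%R by lra.
pose s' := (s / (s - 1))%R.
have s'1 : (1 < s')%R by rewrite /s' ltr_pdivlMr//; lra.
have [C' C'0 M'] := @maxf_Lp R n s' s'1.
pose C1 := ((2 * Num.max 1 l) ^+ n * 2 ^+ n / cB)%R.
have C10 : (0 <= C1)%R.
  by rewrite !mulr_ge0 ?exprn_ge0 ?mulr_ge0 ?invr_ge0 ?ltW ?cB_gt0 ?max1_gt0.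
(* Small enough for the maximal function term to be at most half of the left-hand side; the added 1
   avoids a division by zero. *)
pose eta := (2 * (C1 * C' + 1))^-1%R.
have C1C' : (0 <= C1 * C')%R by rewrite mulr_ge0.
have eta0 : (0 < eta)%R by rewrite invr_gt0; lra.
have etaC : (C1 * (eta * C') <= 2^-1)%R.
  by rewrite /eta mulrCA mulrC ler_pdivrMr; lra.
pose D1 := (C1 * eta `^ (1 - s))%R.
have D10 : (0 <= D1)%R by rewrite mulr_ge0// powR_ge0.
exists (2 * D1)%R; first by rewrite mulr_ge0.
move=> w mw; have mA := Acone_mnn mw; have mAl := Acube_mnn l mw.
set A := Acone w in mA *; set Al := Acube l w in mAl *.
have mAs : mnn (fun x => A x `^ s) by exact: mnn_poweR.
apply: exhaust_le => // [|k]; first exact: ltW.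
pose m x := mine (Al x) k.+1%:R%:E.
have mm : mnn m by apply: mnn_mine => //; apply: mnn_cst; rewrite lee_fin.
have mi : mnn (ind R (cube0 k)) by apply: mnn_ind; exact: measurable_cube.
pose h x := ind R (cube0 k) x * m x `^ (s - 1).
have mh : mnn h by apply: mnn_mul => //; exact: mnn_poweR.
have mMh := maxf_mnn mh.
set X := (X in X <= _).
(* Since [(s - 1) * s' = s], the dual norm of the test function [h] reproduces the quantity [X] to
   be bounded. *)
have XE : X = \int[mu]_x (h x `^ s').
  apply: eq_integral => x _; rewrite /h poweRM ?ind_ge0 ?poweR_ge0//.
  rewrite -poweRrM (_ : (s - 1) * s' = s)%R; last by rewrite /s' mulrC divfK// gt_eqF.
  have [xk|xk] := pselect (cube0 k x); first by rewrite ind_in// poweR1r.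
  by rewrite ind_out// poweR0r ?mul0e// gt_eqF//; lra.
(* [X] is to be subtracted from both sides, hence the truncation to a bounded function with bounded
   support. *)
have Xfin : X < +oo.
  apply: (@le_lt_trans _ _ (\int[mu]_x (ind R (cube0 k) x * (k.+1%:R `^ s)%:E))).
    apply: int_le.
    - by apply: mnn_mul => //; exact: mnn_poweR.
    - by apply: mnn_mul => //; apply: mnn_cst; rewrite lee_fin powR_ge0.
    - move=> x; apply: lee_wpmul2l; first exact: ind_ge0.
      by rewrite -poweR_EFin; apply: le_poweR; [exact: ltW|exact: mm.2|rewrite ge_min lexx orbT].
  rewrite int_Zr ?lee_fin ?powR_ge0//.
  by rewrite (int_mu (measurable_cube _ _)) mu_cube// -EFinM ltry.
have claim y (t : R) : (0 < t)%R -> \int[mu]_x (ind R (cube y (l * t)) x * h x) <=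
     C1%:E * \int[mu]_x (ind R (ballRn y t) x * maxf h x).
  move=> t0; have ct : (0 < cB * t ^+ n)%R by rewrite mulr_gt0 ?cB_gt0// exprn_gt0.
  pose r := (Num.max 1 l * t)%R.
  have r0 : (0 < r)%R by rewrite mulr_gt0// max1_gt0.
  have rn0 : (0 < (2 * r) ^+ n)%R by rewrite exprn_gt0// mulr_gt0.
  have mball : mnn (ind R (ballRn y t)) by apply: mnn_ind; exact: measurable_ballRn.
  apply: (@le_trans _ _ (((2 * r) ^+ n)%:E * cavg h y r)).
    rewrite /cavg muleA -EFinM mulfV ?gt_eqF// mul1e (int_restrict mu h (measurable_cube y r)).
    apply: int_le => [| |x].
    - by apply: mnn_mul => //; apply: mnn_ind; exact: measurable_cube.
    - by apply: mnn_mul => //; apply: mnn_ind; exact: measurable_cube.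
    - apply: lee_wpmul2r; first exact: mh.2.
      by apply: ind_sub; exact: cube_sub_maxcube.
  have c0 : 0 <= cavg h y r by apply: cavg_ge0 => //; exact: mh.2.
  have avg : (cB * t ^+ n)%:E * cavg h y r <= (2 ^+ n)%:E * \int[mu]_x (ind R (ballRn y t) x * maxf h x).
    apply: (@le_trans _ _ (\int[mu]_x (ind R (ballRn y t) x * cavg h y r))).
      rewrite int_Zr// (int_mu (measurable_ballRn y t)).
      by apply: lee_wpmul2r => //; exact: mu_ballRn_ge.
    rewrite -int_Zl ?lee_fin ?exprn_ge0//; last exact: mnn_mul.
    apply: int_le => [| |x].
    - by apply: mnn_mul => //; exact: mnn_cst.
    - by apply: mnn_mul; [apply: mnn_cst; rewrite lee_fin exprn_ge0|exact: mnn_mul].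
    - have [xB|xB] := pselect (ballRn y t x); last by rewrite ind_out// !mul0e mule0.
      rewrite ind_in// !mul1e; apply: cavg_le_maxf => //.
      exact: ball_sub_maxcube.
  have -> : ((2 * r) ^+ n)%:E * cavg h y r =
     ((2 * Num.max 1 l) ^+ n / cB)%:E * ((cB * t ^+ n)%:E * cavg h y r).
    rewrite [RHS]muleA -EFinM; congr (_%:E * _); rewrite /r mulrA exprMn.
    by field; rewrite gt_eqF// cB_gt0.
  apply: le_trans (lee_wpmul2l _ avg) _.
    by rewrite lee_fin divr_ge0 ?exprn_ge0 ?mulr_ge0 ?ltW ?cB_gt0 ?max1_gt0.
  by rewrite muleA -EFinM /C1 mulrAC.
have W := weight_transfer C10 mh mMh claim mw; rewrite -/Al -/A in W.
have step : X <= (2^-1)%:E * X + D1%:E * \int[mu]_x (A x `^ s).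
  apply: (@le_trans _ _ (\int[mu]_x (h x * Al x))).
    apply: int_le => [| |x].
    - by apply: mnn_mul => //; exact: mnn_poweR.
    - exact: mnn_mul.
    - rewrite /h -muleA; apply: lee_wpmul2l; first exact: ind_ge0.
      rewrite -/(m x) -(mule_poweRB1 (mm.2 x) s1) muleC; apply: lee_wpmul2l; first exact: poweR_ge0.
      by rewrite ge_min lexx.
  apply: (le_trans W).
  apply: (@le_trans _ _ (C1%:E * (\int[mu]_x (eta%:E * maxf h x `^ s' + (eta `^ (1 - s))%:E * A x `^ s)))).
    apply: lee_wpmul2l; first by rewrite lee_fin.
    apply: int_le => [| |x]; first exact: mnn_mul.
      apply: mnn_add; apply: mnn_mul => //.
      - by apply: mnn_cst; rewrite lee_fin ltW.
      - exact: mnn_poweR.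
      - by apply: mnn_cst; rewrite lee_fin powR_ge0.
    by rewrite muleC; apply: young_eps => //; [exact: mA.2|exact: mMh.2].
  have mMs : mnn (fun x => maxf h x `^ s') by exact: mnn_poweR.
  rewrite int_D; last 2 first.
  - by apply: mnn_mul => //; apply: mnn_cst; rewrite lee_fin ltW.
  - by apply: mnn_mul => //; apply: mnn_cst; rewrite lee_fin powR_ge0.
  rewrite int_Zl ?lee_fin ?(ltW eta0)// int_Zl ?lee_fin ?powR_ge0//.
  rewrite ge0_muleDr; last 2 first.
  - by rewrite mule_ge0 ?int_ge0// lee_fin ltW.
  - by rewrite mule_ge0 ?int_ge0// lee_fin powR_ge0.
  apply: leeD; last by rewrite muleA -EFinM.
  rewrite XE; apply: (@le_trans _ _ (C1%:E * (eta%:E * (C'%:E * \int[mu]_x h x `^ s')))).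
    apply: lee_wpmul2l; first by rewrite lee_fin.
    apply: lee_wpmul2l; first by rewrite lee_fin ltW.
    exact: M'.
  rewrite muleA muleA -!EFinM; apply: lee_wpmul2r; last by rewrite lee_fin -mulrA.
  by apply: int_ge0; exact: mnn_poweR.
have X0 : 0 <= X by rewrite XE; apply: int_ge0; exact: mnn_poweR.
have Xf : X \is a fin_num by rewrite ge0_fin_numE.
rewrite EFinM -muleA.
move: step; set Y := D1%:E * _.
have Y0 : 0 <= Y by rewrite mule_ge0 ?int_ge0// lee_fin.
rewrite -(fineK Xf); case: Y Y0 => [Y| |]// Y0.
  rewrite -!EFinM -EFinD !lee_fin; lra.
by move=> _; rewrite gt0_muley ?leey.
Qed.

Theorem aperture (s l : R) : (0 < s)%R -> (0 < l)%R ->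
  exists2 C : R, (0 <= C)%R & forall w, mnn w ->
    \int[mu]_x (Acube l w x `^ s) <= C%:E * \int[mu]_x (Acone w x `^ s).
Proof.
by move=> s0 l0; have [s1|s1] := leP s 1%R; [exact: aperture_le1|exact: aperture_gt1].
Qed.

End ApertureChange.

(** * Whitney averages *)

Section Null.
Variables (R : realType) (n : nat).
Local Notation E := (n.-tuple R).
Local Notation nu := (@nu R n).
Local Notation Hp := (@Hp R n).
Local Notation pt := (pt R n).
Implicit Types (z : pt).

Lemma int_nu (A : set pt) : measurable A -> \int[nu]_x ind R A x = nu A.
Proof. exact: int_indic. Qed.

Lemma intH_Hp (F : pt -> \bar R) : intH F = intH (fun z => ind R Hp z * F z).
Proof.
rewrite /intH; congr intRn; apply/funext => y; apply: eq_integral => t.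
by rewrite inE/= => t0; rewrite ind_in// mul1e.
Qed.

Lemma intH_ind (F : pt -> \bar R) : mnn (fun z => ind R Hp z * F z) ->
  intH F = \int[nu]_z (ind R Hp z * F z).
Proof.
move=> [mF F0]; rewrite intH_Hp intHE// => z z0.
by rewrite ind_out ?mul0e// /Hp/=; apply/negP; rewrite -leNgt.
Qed.

Lemma volHE (M : set pt) : measurable M -> volH M = nu (M `&` Hp).
Proof.
move=> mM; have mHp := @measurable_Hp R n.
have E1 : (fun z => ind R Hp z * (\1_M z)%:E) = ind R (M `&` Hp).
  apply/funext => z; rewrite -/(ind R M z).
  have [zH|zH] := pselect (Hp z); last by rewrite ind_out// mul0e ind_out// => -[].
  by rewrite ind_in// mul1e; apply: ind_eq; split => [|[]].
rewrite /volH intH_ind E1; last by apply: mnn_ind; exact: measurableI.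
by rewrite int_nu//; exact: measurableI.
Qed.

Lemma nullHP (N : set pt) : measurable N -> nullH N <-> nu (N `&` Hp) = 0.
Proof.
move=> mN; split=> [[M [mM [NM]]]|N0].
  rewrite volHE// => M0; apply: (subset_measure0 _ _ _ M0).
  - by apply: measurableI => //; exact: measurable_Hp.
  - by apply: measurableI => //; exact: measurable_Hp.
  - by apply: setSI.
by exists N; split=> //; split=> //; rewrite volHE.
Qed.

Lemma nullHS (N M : set pt) : N `<=` M -> nullH M -> nullH N.
Proof.
by move=> NM [P [mP [MP P0]]]; exists P; split=> //; split=> //; exact: subset_trans MP.
Qed.

Lemma nullH_bigcup (N : nat -> set pt) : (forall k, nullH (N k)) -> nullH (\bigcup_k N k).
Proof.
move=> /choice[M HM]; exists (\bigcup_k M k); split.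
  by apply: bigcup_measurable => k _; have [] := HM k.
split; first by apply: subset_bigcup => k _; have [_ []] := HM k.
have mM k : measurable (M k `&` Hp).
  by apply: measurableI; [have [] := HM k|exact: measurable_Hp].
rewrite volHE; last by apply: bigcup_measurable => k _; have [] := HM k.
rewrite setI_bigcupl; apply/eqP; rewrite eq_le measure_ge0 andbT.
apply: le_trans (measure_sigma_subadditive _ mM _ _) _ => //.
  by apply: bigcup_measurable => k _.
rewrite eseries0// => k _ _; have [mk [_ k0]] := HM k.
exact: etrans (esym (volHE mk)) k0.
Qed.

Lemma nullHU (N M : set pt) : nullH N -> nullH M -> nullH (N `|` M).
Proof.
move=> N0 M0; rewrite -bigcup2E; apply: nullH_bigcup => -[|[|k]] //=.
by exists set0; split=> //; split=> //; rewrite volHE// set0I measure0.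
Qed.

Lemma nullH_set0 : nullH (@set0 pt).
Proof. by exists set0; split=> //; split=> //; rewrite volHE// set0I measure0. Qed.

(** The infimum is attained: the levels [c + k.+1%:R^-1] are admissible up to null sets, and a
    countable union of these is null. *)
Lemma esssupH_leP (A : set pt) (g : pt -> \bar R) (c : R) :
  esssupH A g <= c%:E <-> nullH [set z | A z /\ c%:E < g z].
Proof.
split=> [le|N]; last by apply: ereal_inf_lbound.
have H k : nullH [set z | A z /\ (c + k.+1%:R^-1)%:E < g z].
  have : esssupH A g < (c + k.+1%:R^-1)%:E.
    by apply: le_lt_trans le _; rewrite lte_fin ltrDl invr_gt0.
  move=> /ereal_inf_lt[M NM Mc]; apply: nullHS NM => z [Az cz]; split => //.
  exact: lt_trans Mc cz.
apply: nullHS (nullH_bigcup H) => z [Az cz].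
have [k ck] : exists k : nat, (c + k.+1%:R^-1)%:E < g z.
  case: (g z) cz => [v| |]// cv; last by exists 0%N; rewrite ltry.
  rewrite lte_fin in cv.
  exists (Num.truncn (v - c)^-1); rewrite lte_fin -ltrBrDl.
  rewrite -[ltRHS]invrK ltf_pV2 ?posrE ?invr_gt0 ?subr_gt0//.
  exact: truncnS_gt.
by exists k.
Qed.

End Null.

Section WhitneyAverages.
Variables (R : realType) (n : nat).
Local Notation E := (n.-tuple R).
Local Notation mu := (@mu R n).
Local Notation nu := (@nu R n).
Local Notation Hp := (@Hp R n).
Local Notation pt := (pt R n).
Local Notation cB := (cB R n).
Implicit Types (z w : pt) (f : pt -> R[i]).

Definition whitney_param (a1 a2 : R) := [/\ (0 < a1)%R, (a1 < a2^-1)%R & (a2^-1 < 1)%R].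

Variables (a1 a2 : R).
Hypothesis wp : whitney_param a1 a2.
Let ha1 : (0 < a1)%R. Proof. by case: wp. Qed.
Let ha12 : (a1 < a2^-1)%R. Proof. by case: wp. Qed.
Let ha2 : (a2^-1 < 1)%R. Proof. by case: wp. Qed.

Lemma a2_gt0 : (0 < a2)%R.
Proof. by rewrite -invr_gt0; exact: lt_trans ha12. Qed.

Lemma a2_gt1 : (1 < a2)%R.
Proof. by rewrite -[a2]invrK invf_gt1 ?invr_gt0 ?a2_gt0. Qed.

Definition W z : set pt := whitney a1 a2 z.1 z.2.

Lemma W_pos z w : Hp z -> W z w -> (0 < w.2)%R.
Proof.
move=> z0 [_ [h _]]; apply: lt_trans h; rewrite mulr_gt0// invr_gt0; exact: a2_gt0.
Qed.

Lemma W_self z : Hp z -> W z z.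
Proof.
move=> z0; split; last split.
- rewrite /Defs.edist big1 ?sqrtr0 ?mulr_gt0// => i _.
  by rewrite subrr expr0n.
- by rewrite gtr_pMl.
- by rewrite ltr_pMl// a2_gt1.
Qed.

Lemma measurable_W2 : measurable [set p : pt * pt | W p.1 p.2].
Proof.
have m1 : measurable_fun setT (fun p : pt * pt => p.1.1) by exact: (measurableT_comp measurable_fst measurable_fst).
have m2 : measurable_fun setT (fun p : pt * pt => p.1.2) by exact: (measurableT_comp measurable_snd measurable_fst).
have m3 : measurable_fun setT (fun p : pt * pt => p.2.1) by exact: (measurableT_comp measurable_fst measurable_snd).
have m4 : measurable_fun setT (fun p : pt * pt => p.2.2) by exact: (measurableT_comp measurable_snd measurable_snd).
apply: measurable_setAnd; last apply: measurable_setAnd.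
- apply: measurable_ltr_set; first exact: measurable_edist.
  exact: measurable_funM.
- by apply: measurable_ltr_set => //; exact: measurable_funM.
- by apply: measurable_ltr_set => //; exact: measurable_funM.
Qed.

Lemma measurable_W z : measurable (W z).
Proof.
have := pair1_measurable z measurableT measurable_W2.
by rewrite setTI.
Qed.

Lemma WE z : W z = ballRn z.1 (a1 * z.2) `*` [set s | (a2^-1 * z.2 < s)%R /\ (s < a2 * z.2)%R].
Proof. by apply/seteqP; split => -[u s]. Qed.

Lemma leb_oo (a b : R) : (a <= b)%R -> leb [set s | (a < s)%R /\ (s < b)%R] = (b - a)%:E.
Proof.
move=> ab; rewrite (_ : [set s | _] = [set` `]a, b[%R]); last first.
  by apply/seteqP; split=> x /=; rewrite in_itv/=; [case=> -> ->|move/andP].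
rewrite /leb /pushforward preimage_id lebesgue_measure_itv/= lte_fin EFinB.
by case: ifPn => //; rewrite -leNgt => ba; rewrite -EFinB (_ : (b - a = 0)%R)//; lra.
Qed.

Definition cW1 : R := (cB * a1 ^+ n * (a2 - a2^-1))%R.
Definition cW2 : R := ((2 * a1) ^+ n * (a2 - a2^-1))%R.

Let a2V : (0 < a2 - a2^-1)%R.
Proof. by have := a2_gt1; have := ha2; lra. Qed.

Lemma cW1_gt0 : (0 < cW1)%R.
Proof. by rewrite mulr_gt0// mulr_gt0 ?cB_gt0// exprn_gt0. Qed.

Lemma cW2_gt0 : (0 < cW2)%R.
Proof. by rewrite mulr_gt0// exprn_gt0// mulr_gt0. Qed.

Let nuW z : Hp z -> nu (W z) = mu (ballRn z.1 (a1 * z.2)) * ((a2 - a2^-1) * z.2)%:E.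
Proof.
move=> z0; rewrite WE /nu product_measure1E; last 2 first.
- exact: measurable_ballRn.
- by apply: measurable_setAnd; exact: measurable_ltr_set.
rewrite mulrBl; congr (_ * _); apply: leb_oo.
by rewrite ler_pM2r//; have := a2_gt1; have := ha2; lra.
Qed.

Lemma nuW_ge z : Hp z -> (cW1 * z.2 ^+ n.+1)%:E <= nu (W z).
Proof.
move=> z0; rewrite nuW//.
apply: (@le_trans _ _ ((cB * (a1 * z.2) ^+ n)%:E * ((a2 - a2^-1) * z.2)%:E)).
  rewrite -EFinM lee_fin /cW1 exprMn exprSr le_eqVlt; apply/orP; left; apply/eqP; ring.
apply: lee_wpmul2r; first by rewrite lee_fin mulr_ge0// ltW.
by apply: mu_ballRn_ge; rewrite mulr_gt0.
Qed.

Lemma nuW_le z : Hp z -> nu (W z) <= (cW2 * z.2 ^+ n.+1)%:E.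
Proof.
move=> z0; rewrite nuW//.
apply: (@le_trans _ _ (((2 * (a1 * z.2)) ^+ n)%:E * ((a2 - a2^-1) * z.2)%:E)).
  apply: lee_wpmul2r; first by rewrite lee_fin mulr_ge0// ltW.
  by apply: mu_ballRn_le; rewrite mulr_gt0.
rewrite -EFinM lee_fin /cW2 mulrA exprMn exprSr le_eqVlt; apply/orP; left; apply/eqP; ring.
Qed.

Lemma nuW_fin z : Hp z -> nu (W z) \is a fin_num.
Proof.
by move=> z0; rewrite ge0_fin_numE// (le_lt_trans (nuW_le z0))// ltry.
Qed.

Lemma nuW_gt0 z : Hp z -> 0 < nu (W z).
Proof.
move=> z0; apply: lt_le_trans (nuW_ge z0).
by rewrite lte_fin mulr_gt0 ?cW1_gt0// exprn_gt0.
Qed.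

Lemma volW z : Hp z -> volH (W z) = nu (W z).
Proof.
move=> z0; rewrite volHE; last exact: measurable_W.
by congr (nu _); apply/setIidl => w; exact: W_pos.
Qed.

(** [cmeasurable] constrains [f] on the half-space only. The extension by zero is measurable on the
    whole product, where [nu] lives. *)
Definition absH f z : R := if (0 < z.2)%R then cabs (f z) else 0%R.

Lemma absH_ge0 f z : (0 <= absH f z)%R.
Proof. by rewrite /absH; case: ifP => // _; rewrite /cabs; case: (f z) => a b; exact: sqrtr_ge0. Qed.

Lemma measurable_absH f : cmeasurable f -> measurable_fun setT (absH f).
Proof.
move=> [mr mi]; have mH := @measurable_Hp R n.
have -> : absH f = (fun z => Num.sqrt ((fun z => complex.Re (f z)) \_ Hp z ^+ 2 +
                                      (fun z => complex.Im (f z)) \_ Hp z ^+ 2)%R).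
  apply/funext => z; rewrite /absH !patchE.
  case: ifPn => z0; first by rewrite mem_set// /cabs; case: (f z).
  by rewrite (memNset (negP z0 : ~ Hp z)) expr0n/= addr0 sqrtr0.
apply: (@measurableT_comp _ _ _ _ _ _ (@Num.sqrt R)).
  by apply: continuous_measurable_fun; exact: sqrt_continuous.
by apply: measurable_funD; apply: measurable_funX; apply/(measurable_restrictT _ _).1.
Qed.

Definition Fp (r : R) f z : \bar R := (absH f z `^ r)%:E.

Lemma mnn_Fp r f : cmeasurable f -> mnn (Fp r f).
Proof.
move=> mf; apply: mnn_EFin => [|z]; last exact: powR_ge0.
exact: (measurableT_comp (@measurable_powR R r) (measurable_absH mf)).
Qed.

Lemma Wavg_fin (r : R) f z : cmeasurable f -> Hp z ->
  Wavg a1 a2 r%:E f z = ((nu (W z))^-1 * \int[nu]_w (ind R (W z) w * Fp r f w)) `^ r^-1.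
Proof.
move=> mf z0; rewrite /Wavg -/(W z) volW//; congr (_ `^ _); congr (_ * _).
  have := nuW_fin z0; have := nuW_gt0 z0; case: (nu (W z)) => // v v0 _.
  by rewrite inver gt_eqF.
have E1 : (fun w => ind R Hp w * (\1_(W z) w * cabs (f w) `^ r)%:E) =
    (fun w => ind R (W z) w * Fp r f w).
  apply/funext => w; have [w0|w0] := pselect (Hp w).
    by rewrite ind_in// mul1e EFinM /Fp /absH ifT.
  rewrite ind_out// mul0e ind_out ?mul0e// => Ww; exact: w0 (W_pos z0 Ww).
rewrite intH_ind E1//; apply: mnn_mul; last exact: mnn_Fp.
by apply: mnn_ind; exact: measurable_W.
Qed.

(* Vanishes for [t <= 0], where [Wavg] is junk, so that integrals can be taken over
   the whole product space. *)
Definition G (r : \bar R) f z := ind R Hp z * Wavg a1 a2 r f z.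

Lemma G_Hp r f z : Hp z -> G r f z = Wavg a1 a2 r f z.
Proof. by move=> z0; rewrite /G ind_in// mul1e. Qed.

Lemma G_out r f z : ~ Hp z -> G r f z = 0.
Proof. by move=> z0; rewrite /G ind_out// mul0e. Qed.

(** The infimum in [esssupH] ranges over all extended reals and would be minus infinity on a null
    set; what excludes negative values is the positive measure of the Whitney box. *)
Lemma Wavg_oo_ge0 f z : Hp z -> 0 <= Wavg a1 a2 +oo f z.
Proof.
move=> z0; rewrite /Wavg -/(W z) leNgt; apply/negP => /ereal_inf_lt[M NM M0].
move: NM => /=; rewrite (_ : [set w | _] = W z); last first.
  apply/seteqP; split => w; first by case.
  move=> Ww; split => //; apply: (lt_le_trans M0); rewrite lee_fin /cabs.
  by case: (f w) => a b; exact: sqrtr_ge0.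
move/(nullHP (measurable_W z)); rewrite setIidl; last by move=> w; exact: W_pos.
by move=> N0; have := nuW_gt0 z0; rewrite N0 ltxx.
Qed.

Lemma Wavg_oo_leP f z (c : R) : cmeasurable f -> Hp z -> (0 <= c)%R ->
  Wavg a1 a2 +oo f z <= c%:E <-> nu (W z `&` [set w | (c < absH f w)%R]) = 0.
Proof.
move=> mf z0 c0; rewrite /Wavg -/(W z).
have mS : measurable (W z `&` [set w | (c < absH f w)%R]).
  apply: measurableI; first exact: measurable_W.
  by apply: measurable_ltr_set => //; exact: measurable_absH.
have ES : [set z0 | W z z0 /\ c%:E < (cabs (f z0))%:E] = W z `&` [set w | (c < absH f w)%R].
  by apply/seteqP; split => w [Ww]; rewrite /= lte_fin /absH (W_pos z0 Ww).
rewrite (propext (esssupH_leP _ _ _)) ES (propext (nullHP mS)) setIidl//.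
by move=> w [Ww _]; exact: W_pos Ww.
Qed.

End WhitneyAverages.

Section WhitneyAverageBounds.
Variables (R : realType) (n : nat).
Local Notation E := (n.-tuple R).
Local Notation nu := (@nu R n).
Local Notation Hp := (@Hp R n).
Local Notation pt := (pt R n).
Implicit Types (z w : pt) (f : pt -> R[i]).

Variables (a1 a2 : R).
Hypothesis wp : whitney_param a1 a2.
Local Notation W := (@W R n a1 a2).
Local Notation G := (@G R n a1 a2).

Lemma mnn_W2 : mnn (fun p : pt * pt => ind R (W p.1) p.2).
Proof. by apply: mnn_ind2; exact: measurable_W2. Qed.

Lemma G_ge0 r f z : 0 < r -> 0 <= G r f z.
Proof.
move=> r0; have [z0|z0] := pselect (Hp z); last by rewrite G_out.
rewrite G_Hp//; case: r r0 => [r| |]// r0; first exact: poweR_ge0.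
exact: Wavg_oo_ge0.
Qed.

(** For finite [r] the average is a quotient of integrals depending on a parameter. For infinite
    [r], exceeding [c] at [z] means that [absH f] exceeds [c] on a part of the box of positive
    measure, and this measure is again such an integral. *)
Lemma mnn_G r f : 0 < r -> cmeasurable f -> mnn (G r f).
Proof.
move=> r0 mf; split; last by move=> z; exact: G_ge0.
have mHp : mnn (ind R Hp) by apply: mnn_ind; exact: measurable_Hp.
have G0 z := @G_ge0 r f z r0.
case: r r0 G0 => [r| |]// r0 G0.
  pose J z := (\int[nu]_w ind R (W z) w)^-1 * \int[nu]_w (ind R (W z) w * Fp r f w).
  have mJ : mnn J.
    apply: mnn_mul; first by apply: mnn_inve; exact: mnn_int1 mnn_W2.
    apply: (@mnn_int1 R _ _ _ _ nu (fun (z : pt) (w : pt) => ind R (W z) w * Fp r f w)).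
    apply: mnn_mul; first exact: mnn_W2.
    exact: mnn_comp (mnn_Fp r mf) _.
  rewrite (_ : G r%:E f = fun z => ind R Hp z * J z `^ r^-1).
    by apply: (mnn_mul _ _).1 => //; exact: mnn_poweR.
  apply/funext => z; have [z0|z0] := pselect (Hp z).
    by rewrite G_Hp// ind_in// mul1e Wavg_fin// /J int_nu//; exact: measurable_W.
  by rewrite G_out// ind_out// mul0e.
move=> mT; apply: (measurability _ (ErealGenOInfty.measurableE R)) => //.
move=> _ [_ [c ->] <-]; rewrite setTI.
rewrite (_ : _ @^-1` _ = [set z | c%:E < G +oo f z]); last first.
  by apply/seteqP; split=> x /=; rewrite in_itv/= andbT.
have [c0|c0] := ltP c 0%R.
  rewrite (_ : [set x | _] = setT)//; apply/seteqP; split=> x //= _.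
  by apply: (@lt_le_trans _ _ 0); rewrite ?lte_fin.
have mS : measurable [set w : pt | (c < absH f w)%R].
  by apply: measurable_ltr_set => //; exact: measurable_absH.
rewrite (_ : [set x | _] = [set z | 0 < ind R Hp z *
    \int[nu]_w (ind R (W z) w * ind R [set w : pt | (c < absH f w)%R] w)]).
  apply: measurable_lte_set => //; apply: (mnn_mul _ _).1 => //.
  apply: (@mnn_int1 R _ _ _ _ nu (fun (z : pt) (w : pt) => ind R (W z) w * ind R _ w)).
  apply: mnn_mul; first exact: mnn_W2.
  exact: mnn_comp (mnn_ind R mS) _.
have IE z : \int[nu]_w (ind R (W z) w * ind R [set w : pt | (c < absH f w)%R] w) =
    nu (W z `&` [set w : pt | (c < absH f w)%R]).
  rewrite -int_nu; last by apply: measurableI => //; exact: measurable_W.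
  apply: eq_integral => w _; rewrite /ind -EFinM; congr EFin.
  by rewrite indicI.
apply/seteqP; split=> z /=; have [z0|z0] := pselect (Hp z); rewrite IE.
- rewrite ind_in// mul1e G_Hp// ltNge => /negP H.
  rewrite lt_neqAle eq_sym measure_ge0 andbT.
  by apply/eqP => I0; apply: H; apply/Wavg_oo_leP.
- by rewrite G_out// ltNge lee_fin c0.
- rewrite ind_in// mul1e G_Hp// => I0; rewrite ltNge; apply/negP.
  by move/(Wavg_oo_leP wp mf z0 c0) => N0; move: I0; rewrite N0 ltxx.
- by rewrite ind_out// mul0e ltxx.
Qed.

Lemma G_oo_le f z (c : R) : cmeasurable f -> Hp z -> (0 <= c)%R ->
  (forall w, W z w -> (cabs (f w) <= c)%R) -> G +oo f z <= c%:E.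
Proof.
move=> mf z0 c0 H; rewrite G_Hp//; apply/(Wavg_oo_leP wp mf z0 c0).
rewrite (_ : _ `&` _ = set0) ?measure0//; apply/seteqP; split => // w [Ww] /=.
by rewrite /absH (W_pos wp z0 Ww) ltNge (H w Ww).
Qed.

Lemma G_le_scale r f1 f2 z (c : R) : 0 < r -> cmeasurable f1 -> cmeasurable f2 ->
  Hp z -> (0 <= c)%R -> (forall w, W z w -> (cabs (f2 w) <= c * cabs (f1 w))%R) ->
  G r f2 z <= c%:E * G r f1 z.
Proof.
move=> r0 m1 m2 z0 c0 H; have G10 := @G_ge0 r f1 z r0.
have HH w : W z w -> (absH f2 w <= c * absH f1 w)%R.
  by move=> Ww; rewrite /absH (W_pos wp z0 Ww); exact: H.
have mW : mnn (ind R (W z)) by apply: mnn_ind; exact: measurable_W.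
case: r r0 G10 => [r| |]// r0 G10.
  rewrite lte_fin in r0.
  rewrite !G_Hp// !(Wavg_fin wp)//.
  set v := (nu (W z))^-1.
  have v0 : 0 <= v by rewrite inve_ge0.
  have mI i : cmeasurable i -> mnn (fun w => ind R (W z) w * Fp r i w).
    by move=> mi; apply: mnn_mul => //; exact: mnn_Fp.
  have I0 i : cmeasurable i -> 0 <= \int[nu]_w (ind R (W z) w * Fp r i w).
    by move=> mi; apply: int_ge0; exact: mI.
  apply: (@le_trans _ _ ((v * ((c `^ r)%:E * \int[nu]_w (ind R (W z) w * Fp r f1 w))) `^ r^-1)).
    apply: le_poweR; [by rewrite invr_ge0 ltW|by rewrite mule_ge0// I0|].
    apply: lee_wpmul2l => //.
    rewrite -int_Zl ?lee_fin ?powR_ge0//; last exact: mI.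
    apply: int_le => [| |w]; first exact: mI.
      by apply: mnn_mul; [apply: mnn_cst; rewrite lee_fin powR_ge0|exact: mI].
    have [Ww|Ww] := pselect (W z w); last by rewrite ind_out// !mul0e mule0.
    rewrite ind_in// !mul1e /Fp -EFinM lee_fin -powRM ?absH_ge0//.
    apply: (ge0_ler_powR (ltW r0)); rewrite ?nnegrE ?mulr_ge0 ?absH_ge0//.
    exact: HH.
  rewrite (muleCA v) (@poweRM _ (c `^ r)%:E); last 2 first.
  - by rewrite lee_fin powR_ge0.
  - by rewrite mule_ge0// I0.
  by rewrite poweR_EFin -powRrM mulfV ?gt_eqF// powRr1.
(* For [c = 0] the right-hand side is 0 even where the average of [f1] is infinite, so the vanishing
   of [f2] on the box is used directly. *)
have [cE|cN] := eqVneq c 0%R.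
  rewrite cE mul0e; apply: G_oo_le => // w Ww.
  by apply: le_trans (H w Ww) _; rewrite cE mul0r.
have cp : (0 < c)%R by rewrite lt_neqAle eq_sym cN.
move: G10; rewrite !G_Hp//; case E1 : (Wavg _ _ _ f1 z) => [M| |]// M0; last first.
  by rewrite gt0_muley ?leey.
rewrite lee_fin in M0.
have : Wavg a1 a2 +oo f1 z <= M%:E by rewrite E1.
move/(Wavg_oo_leP wp m1 z0 M0) => N0.
rewrite -EFinM; apply/(Wavg_oo_leP wp m2 z0); first by rewrite mulr_ge0.
apply: (subset_measure0 _ _ _ N0).
- by apply: measurableI; [exact: measurable_W|apply: measurable_ltr_set => //; exact: measurable_absH].
- by apply: measurableI; [exact: measurable_W|apply: measurable_ltr_set => //; exact: measurable_absH].
- move=> w [Ww] /= lt; split => //=; rewrite -(ltr_pM2l cp).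
  exact: lt_le_trans lt (HH w Ww).
Qed.

(** The criterion is the same for all [r], which makes vanishing averages easy to carry from [f] to
    its quotients and to turn into null sets. *)
Lemma G_eq0P r f z : 0 < r -> cmeasurable f -> Hp z ->
  G r f z = 0 <-> nu (W z `&` [set w | (0 < absH f w)%R]) = 0.
Proof.
move=> r0 mf z0; case: r r0 => [r| |]// r0; last first.
  rewrite -(propext (Wavg_oo_leP wp mf z0 (lexx 0%R))) G_Hp//.
  split=> [->//|le]; apply/eqP; rewrite eq_le le; exact: Wavg_oo_ge0.
rewrite lte_fin in r0.
have mI : mnn (fun w => ind R (W z) w * Fp r f w).
  apply: mnn_mul; [by apply: mnn_ind; exact: measurable_W|exact: mnn_Fp].
have SE : W z `&` [set w | (0 < absH f w)%R] = [set w | ind R (W z) w * Fp r f w != 0].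
  apply/seteqP; split=> w /=.
    by move=> [Ww fw]; rewrite ind_in// mul1e eqe gt_eqF// powR_gt0.
  have [Ww|Ww] := pselect (W z w); last by rewrite ind_out// mul0e eqxx.
  rewrite ind_in// mul1e eqe => fw; split => //.
  rewrite lt_neqAle absH_ge0 andbT eq_sym; apply: contra fw => /eqP->.
  by rewrite powR0// gt_eqF.
rewrite G_Hp// (Wavg_fin wp)// SE; split => [|N0]; last first.
  by rewrite (int_null0 mI N0) mule0 poweR0r// invr_neq0// gt_eqF.
move=> /poweR_eq0_eq0 => /(_ _)/eqP; rewrite mule_eq0 => /(_ _)/orP[].
- by rewrite mule_ge0 ?inve_ge0// int_ge0.
- rewrite inve_eq0 => /eqP voo.
  by have := nuW_fin wp z0; rewrite voo.
- by move/eqP; exact: int_eq0.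
Qed.

End WhitneyAverageBounds.

(** * Sub-mean value inequality for Whitney averages *)

Section Harnack.
Variables (R : realType) (n : nat).
Local Notation E := (n.-tuple R).
Local Notation nu := (@nu R n).
Local Notation Hp := (@Hp R n).
Local Notation pt := (pt R n).
Implicit Types (z w : pt) (f : pt -> R[i]).

Variables (a1 a2 : R).
Hypothesis wp : whitney_param a1 a2.
Let ha1 : (0 < a1)%R. Proof. by case: wp. Qed.
Let ha12 : (a1 < a2^-1)%R. Proof. by case: wp. Qed.
Let ha2 : (a2^-1 < 1)%R. Proof. by case: wp. Qed.
Local Notation W := (@W R n a1 a2).
Local Notation G := (@G R n a1 a2).
Local Notation cW1 := (@cW1 R n a1 a2).
Local Notation cW2 := (@cW2 R n a1 a2).

Definition box (u : E) (s d : R) : set pt := [set w | cube u d w.1 /\ (`|w.2 - s| < d)%R].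

Lemma boxE u s d : box u s d = cube u d `*` [set t | (s - d < t)%R /\ (t < s + d)%R].
Proof.
apply/seteqP; split => -[v t] /= [h1 h2]; split => //=; move: h2; rewrite ?ltr_distl.
  by move=> /andP.
by move=> [-> ->].
Qed.

Lemma measurable_box u s d : measurable (box u s d).
Proof.
rewrite boxE; apply: measurableX; first exact: measurable_cube.
by apply: measurable_setAnd; exact: measurable_ltr_set.
Qed.

Lemma nu_box u s (d : R) : (0 < d)%R -> nu (box u s d) = ((2 * d) ^+ n.+1)%:E.
Proof.
move=> d0; rewrite boxE /nu product_measure1E; last 2 first.
- exact: measurable_cube.
- by apply: measurable_setAnd; exact: measurable_ltr_set.
rewrite exprSr EFinM; congr (_ * _); first exact: mu_cube.
apply: (etrans (leb_oo _)); first by lra.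
by congr EFin; ring.
Qed.

Let a2p : (0 < a2)%R. Proof. exact: a2_gt0 wp. Qed.
Let a21 : (1 < a2)%R. Proof. exact: a2_gt1 wp. Qed.

(** The first component is the mesh size and the second the relative displacement tolerated by the
    inequalities that define a Whitney box. Two points of a cell differ by less than twice the mesh
    times t in each coordinate, and t is at most [2 * a2] times the height of either point, hence
    the factor [4 * a2]; the factor [n%:R] passes to the Euclidean distance. *)
Let mesh : exists p : R * R, [/\ (0 < p.1)%R, [/\ (0 < p.2)%R, (p.2 < 1 - a2^-1)%R,
  (p.2 < a1)%R & (p.2 < a2 - 1)%R], (4 * a2 * p.1 <= p.2)%R & (n%:R * (4 * a2 * p.1) <= p.2)%R].
Proof.
pose e := (a1 * (1 - a2^-1))%R.
have c0 : (0 < 4 * n.+1%:R * a2)%R by rewrite !mulr_gt0.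
have e0 : (0 < e)%R by rewrite mulr_gt0// subr_gt0.
have dE : (4 * a2 * (e / (4 * n.+1%:R * a2)) = e / n.+1%:R)%R.
  by field; rewrite nat1r pnatr_eq0/= gt_eqF.
have e1 : (e < 1 - a2^-1)%R.
  by rewrite /e gtr_pMl ?subr_gt0//; exact: lt_trans ha12 ha2.
exists (e / (4 * n.+1%:R * a2), e)%R => /=; rewrite dE; split.
- exact: divr_gt0.
- split => //; first by rewrite /e gtr_pMr// gtrBl invr_gt0.
  apply: (lt_trans e1); rewrite -subr_gt0.
  have -> : (a2 - 1 - (1 - a2^-1) = (a2 - 1) ^+ 2 / a2)%R by field; rewrite gt_eqF.
  by rewrite divr_gt0// exprn_gt0// subr_gt0.
- by rewrite ler_pdivrMr// ler_peMr ?(ltW e0)// ler1n.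
- by rewrite mulrCA ger_pMr// ler_pdivrMr// mul1r ler_nat.
Qed.

Let dl := (sval (cid mesh)).1.
Let eps := (sval (cid mesh)).2.
Let dl0 : (0 < dl)%R. Proof. by have [] := svalP (cid mesh). Qed.
Let eps1 : (eps < 1 - a2^-1)%R. Proof. by have [_ []] := svalP (cid mesh). Qed.
Let eps2 : (eps < a1)%R. Proof. by have [_ []] := svalP (cid mesh). Qed.
Let eps3 : (eps < a2 - 1)%R. Proof. by have [_ []] := svalP (cid mesh). Qed.
Let dl_eps : (4 * a2 * dl <= eps)%R. Proof. by have [] := svalP (cid mesh). Qed.
Let dl_n : (n%:R * (4 * a2 * dl) <= eps)%R. Proof. by have [] := svalP (cid mesh). Qed.
Let dl_a2 : (dl <= (4 * a2)^-1)%R.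
Proof.
rewrite -[leRHS]mul1r ler_pdivlMr ?mulr_gt0// mulrC.
by apply: (le_trans dl_eps); apply/ltW/(lt_trans eps1); rewrite gtrBl invr_gt0.
Qed.

Lemma box_W (t : R) u (s : R) v w : (0 < t)%R -> (a2^-1 * t <= s)%R ->
  box u s (dl * t) v -> box u s (dl * t) w -> W w v /\ (0 < w.2)%R.
Proof.
move=> t0 ts [cv sv] [cw sw].
have dt : (dl * t <= a2^-1 * t / 4)%R.
  by rewrite mulrAC ler_wpM2r ?(ltW t0)// -invfM mulrC.
have iat : (0 < a2^-1 * t)%R by rewrite mulr_gt0 ?invr_gt0.
have wlow : (a2^-1 * t / 2 < w.2)%R by move: sw; rewrite ltr_distl => /andP[]; lra.
have w0 : (0 < w.2)%R by lra.
have tw : (t <= 2 * a2 * w.2)%R.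
  by rewrite mulrAC mulrC -ler_pdivrMl//; lra.
have k : (2 * (dl * t) <= 4 * a2 * dl * w.2)%R.
  have -> : (4 * a2 * dl * w.2 = 2 * (dl * (2 * a2 * w.2)))%R by ring.
  by rewrite ler_wpM2l// ler_wpM2l// ltW.
have kk : (2 * (dl * t) <= eps * w.2)%R by apply: (le_trans k); rewrite ler_wpM2r// ltW.
have e2 := eps1; have e3 := eps3; have e1 := eps2.
have d2 : (`|v.2 - w.2| < 2 * (dl * t))%R.
  by have := ler_distD s v.2 w.2; rewrite (distrC s w.2); lra.
split => //; split; last split.
- apply: (@le_lt_trans _ _ (n%:R * (2 * (dl * t)))%R).
    apply: edist_le => [|i]; first by rewrite !mulr_ge0// ltW.
    have := ler_distD (tnth u i) (tnth v.1 i) (tnth w.1 i).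
    by rewrite (distrC (tnth u i)); have := cv i; have := cw i; lra.
  apply: (@le_lt_trans _ _ (eps * w.2)%R); last by rewrite ltr_pM2r.
  apply: le_trans (ler_wpM2l (ler0n _ _) k) _.
  by rewrite mulrA ler_wpM2r// ltW.
- move: d2; rewrite ltr_distl => /andP[d2 _].
  have : (a2^-1 * w.2 < (1 - eps) * w.2)%R by rewrite ltr_pM2r//; lra.
  lra.
- move: d2; rewrite ltr_distl => /andP[_ d2].
  have : ((1 + eps) * w.2 < a2 * w.2)%R by rewrite ltr_pM2r//; lra.
  lra.
Qed.

(** Grid steps per coordinate. In units of t, the horizontal offsets shifted by 1 lie between 0 and
    2, and the heights above the bottom of the box are below [a2], so one range of length [2 + a2]
    serves for all. *)
Let L := (Num.truncn ((2 + a2) / dl)).+1.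
Let I := ({ffun 'I_n -> 'I_L} * 'I_L)%type.
Let cu z (i : I) : E := [tuple (tnth z.1 m + z.2 * (-1 + (i.1 m)%:R * dl))%R | m < n].
Let cs z (i : I) : R := (z.2 * (a2^-1 + i.2%:R * dl))%R.

Definition cell z (i : I) : set pt := box (cu z i) (cs z i) (dl * z.2).

Let truncn_lt_L (x : R) : (0 <= x)%R -> (x <= (2 + a2) / dl)%R -> (Num.truncn x < L)%N.
Proof. by move=> x0 xL; rewrite ltnS le_truncn. Qed.

Let grid (x : R) : (0 <= x)%R -> (x <= 2 + a2)%R ->
  exists k : 'I_L, (0 <= x - k%:R * dl)%R /\ (x - k%:R * dl < dl)%R.
Proof.
move=> x0 xL.
have xd0 : (0 <= x / dl)%R by rewrite divr_ge0// ltW.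
exists (inord (Num.truncn (x / dl))); rewrite inordK; last first.
  by apply: truncn_lt_L => //; rewrite ler_pM2r ?invr_gt0.
have /andP[h1 h2] := truncn_itv xd0.
rewrite ler_pdivlMr// in h1.
rewrite ltr_pdivrMr// -natr1 in h2; split; lra.
Qed.

Lemma cell_cover z w : Hp z -> W z w -> exists i, cell z i w.
Proof.
move=> z0 [dw [wl wu]]; have t0 : (0 < z.2)%R by [].
have a11 : (a1 < 1)%R by exact: lt_trans ha12 ha2.
have gm (m : 'I_n) : exists k : 'I_L,
    (`|tnth w.1 m - (tnth z.1 m + z.2 * (-1 + k%:R * dl))| < dl * z.2)%R.
  have := le_lt_trans (edist_coord w.1 z.1 m) dw => dm.
  have dm' : (`|tnth w.1 m - tnth z.1 m| < z.2)%R.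
    by apply: (lt_trans dm); rewrite gtr_pMl.
  move: dm'; rewrite ltr_norml => /andP[d1 d2].
  have [||k [k1 k2]] := @grid ((tnth w.1 m - tnth z.1 m) / z.2 + 1)%R.
  - by rewrite -lerBlDr sub0r ler_pdivlMr//; lra.
  - rewrite -lerBrDr ler_pdivrMr//.
    have : (1 * z.2 <= (2 + a2 - 1) * z.2)%R by rewrite ler_wpM2r ?(ltW t0)//; have := a21; lra.
    lra.
  exists k.
  have -> : (tnth w.1 m - (tnth z.1 m + z.2 * (-1 + k%:R * dl)) =
    ((tnth w.1 m - tnth z.1 m) / z.2 + 1 - k%:R * dl) * z.2)%R.
    by field; rewrite gt_eqF.
  by rewrite normrM (gtr0_norm t0) ltr_pM2r// ger0_norm.
have [g Hg] := choice gm.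
have [||j [j1 j2]] := @grid (w.2 / z.2 - a2^-1)%R.
- by rewrite subr_ge0 ler_pdivlMr// ltW.
- rewrite lerBlDr ler_pdivrMr//.
  have : (a2 * z.2 <= (2 + a2 + a2^-1) * z.2)%R.
    have ia : (0 < a2^-1)%R by rewrite invr_gt0.
    by rewrite ler_wpM2r ?(ltW t0)//; lra.
  lra.
exists ([ffun m => g m], j); split.
  by move=> m; rewrite tnth_mktuple ffunE; exact: Hg.
rewrite /cs/=.
have -> : (w.2 - z.2 * (a2^-1 + j%:R * dl) = (w.2 / z.2 - a2^-1 - j%:R * dl) * z.2)%R.
  by field; rewrite !gt_eqF.
by rewrite normrM (gtr0_norm t0) ltr_pM2r// ger0_norm.
Qed.

Lemma cell_W z i v w : Hp z -> cell z i v -> cell z i w -> W w v /\ (0 < w.2)%R.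
Proof.
move=> z0; apply: box_W => //; rewrite /cs mulrDr mulrC lerDl.
by rewrite !mulr_ge0// ltW.
Qed.

(** In units of t, the cells extend less than [a2 + 2] sideways, stay below height [a2 + 4], and
    stay above [3 / (4 * a2)]. The value leaves a margin in all three directions. *)
Definition K0 : R := (2 * a2 + 6)%R.

(** A Whitney region of arbitrary size. Cubes and reciprocal height bounds make this family stable,
    up to the value of [K], under exchange of the two points and under composition ([V_sym],
    [V_trans]). *)
Definition V (K : R) z : set pt :=
  [set w | cube z.1 (K * z.2) w.1 /\ (K^-1 * z.2 < w.2)%R /\ (w.2 < K * z.2)%R].

Lemma K0_gt1 : (1 < K0)%R. Proof. by rewrite /K0; have := a2p; lra. Qed.

Lemma cell_V z i w : Hp z -> cell z i w -> V K0 z w.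
Proof.
move=> z0 [cw sw]; have t0 : (0 < z.2)%R by [].
have dl1 : (dl < 1)%R.
  apply: (le_lt_trans dl_a2); rewrite invf_lt1 ?mulr_gt0//; have := a21; lra.
have bd (k : 'I_L) : (0 <= k%:R * dl /\ k%:R * dl <= 2 + a2)%R.
  split; first by rewrite mulr_ge0// ltW.
  rewrite -ler_pdivlMr//; apply: (@le_trans _ _ (Num.truncn ((2 + a2) / dl))%:R).
    by rewrite ler_nat -ltnS ltn_ord.
  by rewrite truncn_le// divr_ge0 ?addr_ge0 ?ltW.
have A0 := a21; have A1 : (0 < a2^-1)%R by rewrite invr_gt0.
have Kt : (K0 * z.2 = 2 * (a2 * z.2) + 6 * z.2)%R by rewrite /K0; ring.
have dt : (0 < dl * z.2)%R by rewrite mulr_gt0.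
have dt1 : (dl * z.2 < z.2)%R by rewrite gtr_pMl.
have a2t : (z.2 < a2 * z.2)%R by rewrite ltr_pMl.
split; last split.
- move=> m; have := cw m; rewrite tnth_mktuple.
  have [k1 k2] := bd (i.1 m); set kk := ((i.1 m)%:R * dl)%R in k1 k2 *.
  have k3 : (0 <= z.2 * kk)%R by rewrite mulr_ge0// ltW.
  have k4 : (z.2 * kk <= z.2 * (2 + a2))%R by rewrite ler_wpM2l// ltW.
  rewrite Kt !ltr_norml => /andP[h1 h2]; apply/andP; split; lra.
- move: sw; rewrite /cs ltr_distl => /andP[h1 _]; apply: le_lt_trans h1.
  have [k1 k2] := bd i.2; set kk := ((i.2)%:R * dl)%R in k1 k2 *.
  have k3 : (0 <= z.2 * kk)%R by rewrite mulr_ge0// ltW.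
  have h : (dl * z.2 <= (4 * a2)^-1 * z.2)%R by rewrite ler_wpM2r// ltW.
  have h' : (K0^-1 * z.2 <= (2 * a2)^-1 * z.2)%R.
    rewrite ler_wpM2r ?(ltW t0)// lef_pV2 ?posrE ?mulr_gt0// /K0; lra.
  have e1 : ((4 * a2)^-1 * z.2 = 4^-1 * (a2^-1 * z.2))%R by rewrite invfM mulrA.
  have e2 : ((2 * a2)^-1 * z.2 = 2^-1 * (a2^-1 * z.2))%R by rewrite invfM mulrA.
  have e3 : (0 < a2^-1 * z.2)%R by rewrite mulr_gt0.
  lra.
- move: sw; rewrite /cs ltr_distl => /andP[_ h2]; apply: (lt_trans h2).
  have [k1 k2] := bd i.2; set kk := ((i.2)%:R * dl)%R in k1 k2 *.
  have k4 : (z.2 * kk <= z.2 * (2 + a2))%R by rewrite ler_wpM2l// ltW.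
  have h : (a2^-1 * z.2 < z.2)%R by rewrite gtr_pMl.
  rewrite Kt; lra.
Qed.

Lemma nu_cell z i : Hp z -> nu (cell z i) = ((2 * (dl * z.2)) ^+ n.+1)%:E.
Proof. by move=> z0; rewrite nu_box// mulr_gt0. Qed.

Lemma G_rpow (r : R) f z : (0 < r)%R -> cmeasurable f -> Hp z ->
  nu (W z) * G r%:E f z `^ r = \int[nu]_w (ind R (W z) w * Fp r f w).
Proof.
move=> r0 mf z0; rewrite G_Hp// (Wavg_fin wp)// -poweRrM mulVf ?gt_eqF// poweRe1; last first.
  rewrite mule_ge0 ?inve_ge0//; apply: int_ge0; apply: mnn_mul; last exact: mnn_Fp.
  by apply: mnn_ind; exact: measurable_W.
have := nuW_fin wp z0; have := nuW_gt0 wp z0; case: (nu (W z)) => // v v0 _.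
rewrite lte_fin in v0.
by rewrite inver gt_eqF// muleA -EFinM mulfV ?mul1e// gt_eqF.
Qed.

Lemma harnack_fin (r : R) : (0 < r)%R -> exists2 k : R, (0 < k)%R &
  forall f z, cmeasurable f -> Hp z ->
  exists i, forall w, cell z i w -> G r%:E f z <= k%:E * G r%:E f w.
Proof.
move=> r0.
pose N := #|{: I}|.
pose i0 : I := ([ffun=> ord0], ord0).
have N0 : (0 < N%:R :> R)%R by rewrite ltr0n; apply/card_gt0P; exists i0.
have cW10 := cW1_gt0 n wp; have cW20 := cW2_gt0 n wp.
(* [N] counts the cells; the other factor compares the measure of the box of [w], whose height is
   below [K0] times that of [z], with the measure of the box of [z]. *)
pose k := (N%:R * (cW2 * K0 ^+ n.+1) / cW1)%R.
have k0 : (0 < k)%R.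
  by rewrite divr_gt0// mulr_gt0// mulr_gt0// exprn_gt0// (lt_trans ltr01 K0_gt1).
exists (k `^ r^-1)%R; first by rewrite powR_gt0.
move=> f z mf z0.
have t0 : (0 < z.2)%R by [].
have mF := mnn_Fp r mf.
have mi i : mnn (ind R (cell z i)) by apply: mnn_ind; exact: measurable_box.
pose J i := \int[nu]_w (ind R (cell z i) w * Fp r f w).
have J0 i : 0 <= J i by apply: int_ge0; exact: mnn_mul.
pose i := [arg max_(i > i0) J i]%O.
have Jmax j : J j <= J i by rewrite /i; case: arg_maxP => // i' _; apply.
exists i => w wi.
have [Www w0] := cell_W z0 wi wi.
have sub : \int[nu]_v (ind R (W z) v * Fp r f v) <= N%:R%:E * J i.
  have -> : N%:R%:E * J i = \sum_(j : I) J i.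
    by rewrite sumr_const; exact: mule_natl.
  apply: (@le_trans _ _ (\sum_(j : I) J j)); last exact: lee_sum.
  have mJ j : measurable_fun setT (fun v => ind R (cell z j) v * Fp r f v).
    by case: (mnn_mul (mi j) mF).
  rewrite -(@ge0_integral_sum _ _ _ nu _ measurableT _ _ mJ); last first.
    by move=> j v _; case: (mnn_mul (mi j) mF).
  have mS : mnn (fun v => \sum_(j : I) (ind R (cell z j) v * Fp r f v)).
    split; first exact: emeasurable_sum.
    by move=> v; apply: sume_ge0 => j _; case: (mnn_mul (mi j) mF).
  apply: int_le => // [|v].
    by apply: mnn_mul => //; apply: mnn_ind; exact: measurable_W.
  have [Wv|Wv] := pselect (W z v); last first.
    by rewrite ind_out// mul0e; exact: mS.2.
  have [j vj] := cell_cover z0 Wv.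
  rewrite ind_in// mul1e (bigD1 j)//= ind_in// mul1e leeDl//.
  by apply: sume_ge0 => j' _; case: (mnn_mul (mi j') mF).
have sub2 : J i <= \int[nu]_v (ind R (W w) v * Fp r f v).
  apply: int_le => [| |v]; first exact: mnn_mul.
    by apply: mnn_mul => //; apply: mnn_ind; exact: measurable_W.
  apply: lee_wpmul2r; first exact: mF.2.
  by apply: ind_sub => vi; have [] := cell_W z0 vi wi.
have [_ [_ wK]] := cell_V z0 wi.
have Gw0 : 0 <= G r%:E f w by apply: (G_ge0 wp).
have Gz0 : 0 <= G r%:E f z by apply: (G_ge0 wp).
have main : (cW1 * z.2 ^+ n.+1)%:E * G r%:E f z `^ r <=
    (N%:R * (cW2 * (K0 * z.2) ^+ n.+1))%:E * G r%:E f w `^ r.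
  apply: (@le_trans _ _ (nu (W z) * G r%:E f z `^ r)).
    by apply: lee_wpmul2r; [exact: poweR_ge0|exact: nuW_ge].
  rewrite G_rpow//; apply: (le_trans sub).
  rewrite (EFinM N%:R) -muleA; apply: lee_wpmul2l; first by rewrite lee_fin ltW.
  apply: (le_trans sub2); rewrite -G_rpow//; apply: lee_wpmul2r; first exact: poweR_ge0.
  apply: (le_trans (nuW_le wp _)) => //; rewrite lee_fin ler_wpM2l ?(ltW cW20)//.
  by rewrite lerXn2r ?nnegrE// ltW// (lt_trans w0).
have main2 : G r%:E f z `^ r <= k%:E * G r%:E f w `^ r.
  have c0 : (0 < cW1 * z.2 ^+ n.+1)%R by rewrite mulr_gt0// exprn_gt0.
  rewrite -(@lee_pmul2l _ (cW1 * z.2 ^+ n.+1)%:E) ?lte_fin//.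
  apply: (le_trans main); rewrite muleA -EFinM.
  apply: lee_wpmul2r; first exact: poweR_ge0.
  rewrite lee_fin /k exprMn le_eqVlt; apply/orP; left; apply/eqP.
  by field; rewrite gt_eqF.
have -> : G r%:E f z = (G r%:E f z `^ r) `^ r^-1.
  by rewrite -poweRrM mulfV ?gt_eqF// poweRe1.
apply: (@le_trans _ _ ((k%:E * G r%:E f w `^ r) `^ r^-1)).
  by apply: le_poweR => //; [rewrite invr_ge0 ltW|exact: poweR_ge0].
rewrite poweRM ?lee_fin ?(ltW k0) ?poweR_ge0// poweR_EFin.
by rewrite -poweRrM mulfV ?gt_eqF// poweRe1.
Qed.

(** By contradiction: choose in each cell a point with a strictly smaller average, and let [M] be
    the largest of these. Each cell lies in the box of its point, so [f] is at most [M] almost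
    everywhere on each cell, hence on the whole box of [z]. *)
Lemma harnack_oo f z : cmeasurable f -> Hp z ->
  exists i, forall w, cell z i w -> G +oo f z <= G +oo f w.
Proof.
move=> mf z0; apply: contrapT => /forallNP H.
have Gz0 : 0 <= G +oo f z by apply: (G_ge0 wp).
have {}H i : exists w, cell z i w /\ G +oo f w < G +oo f z.
  apply: contrapT => /forallNP Hi; apply: (H i) => w wi.
  by rewrite leNgt; apply/negP => lt; apply: (Hi w).
have [w Hw] := choice H.
pose i0 : I := ([ffun=> ord0], ord0).
pose i := [arg max_(i > i0) G +oo f (w i)]%O.
have Gmax j : G +oo f (w j) <= G +oo f (w i) by rewrite /i; case: arg_maxP => // i' _; apply.
have [_ lt] := Hw i.
have Gi0 : 0 <= G +oo f (w i) by apply: (G_ge0 wp).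
have [M EM] : exists M : R, G +oo f (w i) = M%:E.
  by move: lt Gi0; case: (G +oo f (w i)) => [M| |]//; [exists M|rewrite ltNge leey].
have M0 : (0 <= M)%R by rewrite -lee_fin -EM.
suff : G +oo f z <= M%:E by rewrite leNgt -EM lt.
rewrite G_Hp//; apply/(Wavg_oo_leP wp mf z0 M0).
have mS j : measurable (W (w j) `&` [set v | (M < absH f v)%R]).
  by apply: measurableI; [exact: measurable_W|apply: measurable_ltr_set => //; exact: measurable_absH].
have N0 j : nu (W (w j) `&` [set v | (M < absH f v)%R]) = 0.
  have [wj _] := Hw j.
  have [_ wj0] := cell_W z0 wj wj.
  apply/(Wavg_oo_leP wp mf wj0 M0).
  by rewrite -(@G_Hp R n a1 a2 +oo f (w j))// -EM; exact: Gmax.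
have mU : measurable (\big[setU/set0]_(j : I) (W (w j) `&` [set v | (M < absH f v)%R])).
  by apply: bigsetU_measurable => j _; exact: mS.
apply: (subset_measure0 _ mU).
- by apply: measurableI; [exact: measurable_W|apply: measurable_ltr_set => //; exact: measurable_absH].
- move=> v [Wv Mv]; have [j vj] := cell_cover z0 Wv.
  rewrite -bigcup_seq; exists j; first by rewrite /= mem_index_enum.
  by split => //; have [wj _] := Hw j; have [] := cell_W z0 vj wj.
- pose P A := measurable A /\ nu A = 0.
  have [] : P (\big[setU/set0]_(j : I) (W (w j) `&` [set v | (M < absH f v)%R])) => //.
  apply: (big_ind P) => [|A B [mA A0] [mB B0]|j _]; [by split|split|by split].
    exact: measurableU.
  apply/eqP; rewrite eq_le measure_ge0 andbT.
  have -> : 0 = nu A + nu B by rewrite A0 B0 adde0.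
  exact: measureU2.
Qed.

(* Finitely many cells of a fixed mesh cover [W z], and [W w] contains the cell of
   [w]: by pigeonhole, [G r f z] is bounded by a multiple of [G r f w] for all [w]
   in one of the cells, so that the exponent [q] does not depend on [r]. *)
Lemma G_submean r (q : R) : 0 < r -> (0 < q)%R -> exists2 C : R, (0 <= C)%R &
  forall f z, cmeasurable f -> Hp z ->
  (z.2 ^+ n.+1)%:E * G r f z `^ q <= C%:E * \int[nu]_w (ind R (V K0 z) w * G r f w `^ q).
Proof.
move=> r0 q0.
have [k k0 H] : exists2 k : R, (0 < k)%R & forall f z, cmeasurable f -> Hp z ->
  exists i, forall w, cell z i w -> G r f z <= k%:E * G r f w.
  case: r r0 => [r| |]// r0; first exact: harnack_fin.
  exists 1%R => // f z mf z0; have [i Hi] := harnack_oo mf z0.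
  by exists i => w wi; rewrite mul1e; exact: Hi.
have D0 : (0 < (2 * dl) ^+ n.+1)%R by rewrite exprn_gt0// mulr_gt0.
exists (k `^ q / (2 * dl) ^+ n.+1)%R; first by rewrite divr_ge0 ?powR_ge0// ltW.
move=> f z mf z0; have [i Hi] := H f z mf z0.
have t0 : (0 < z.2)%R by [].
have mG := mnn_G wp r0 mf.
have mGq : mnn (fun w => G r f w `^ q) by exact: mnn_poweR.
have mc : mnn (ind R (cell z i)) by apply: mnn_ind; exact: measurable_box.
have mV : mnn (ind R (V K0 z)).
  apply: mnn_ind; apply: measurable_setAnd; last apply: measurable_setAnd.
  - by apply: measurable_in_cube => //; exact: measurable_fst.
  - by apply: measurable_ltr_set => //; exact: measurable_snd.
  - by apply: measurable_ltr_set => //; exact: measurable_snd.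
have main : ((2 * dl) ^+ n.+1 * z.2 ^+ n.+1)%:E * G r f z `^ q <=
   (k `^ q)%:E * \int[nu]_w (ind R (V K0 z) w * G r f w `^ q).
  have -> : ((2 * dl) ^+ n.+1 * z.2 ^+ n.+1)%:E = nu (cell z i).
    by rewrite nu_cell// -exprMn -mulrA.
  rewrite -int_nu; last exact: measurable_box.
  rewrite -int_Zr ?poweR_ge0// -int_Zl ?lee_fin ?powR_ge0//; last exact: mnn_mul.
  apply: int_le => [| |w].
  - by apply: mnn_mul => //; apply: mnn_cst; exact: poweR_ge0.
  - by apply: mnn_mul; [apply: mnn_cst; rewrite lee_fin powR_ge0|exact: mnn_mul].
  - have [wi|wi] := pselect (cell z i w); last first.
      rewrite ind_out// mul0e mule_ge0 ?lee_fin ?powR_ge0// mule_ge0 ?ind_ge0//.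
      exact: poweR_ge0.
    rewrite ind_in// mul1e ind_in; last exact: cell_V wi.
    rewrite mul1e -poweR_EFin -poweRM ?lee_fin ?(ltW k0)//; last exact: mG.2.
    by apply: le_poweR; [exact: ltW|exact: mG.2|exact: Hi].
rewrite mulrC EFinM -muleA lee_pdivlMl//.
by rewrite muleA -EFinM.
Qed.

End Harnack.

(** * Tent space norms *)

Section TentNorms.
Variables (R : realType) (n : nat).
Local Notation E := (n.-tuple R).
Local Notation mu := (@mu R n).
Local Notation nu := (@nu R n).
Local Notation Hp := (@Hp R n).
Local Notation pt := (pt R n).
Local Notation edist := (@Defs.edist R n).
Local Notation cone := (@cone R n).
Local Notation tent := (@tent R n).
Local Notation ballRn := (@ballRn R n).
Implicit Types (z w : pt) (f : pt -> R[i]) (x y c : E).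

Variables (a1 a2 : R).
Hypothesis wp : whitney_param a1 a2.
Let ha1 : (0 < a1)%R. Proof. by case: wp. Qed.
Let ha12 : (a1 < a2^-1)%R. Proof. by case: wp. Qed.
Let ha2 : (a2^-1 < 1)%R. Proof. by case: wp. Qed.
Local Notation W := (@W R n a1 a2).
Local Notation G := (@G R n a1 a2).

Definition tw (k : nat) z : \bar R := (if 0 < z.2 then z.2 ^- k else 0)%R%:E.

Lemma mnn_tw k : mnn (tw k).
Proof.
apply: mnn_EFin => [|z]; last first.
  by case: ifPn => // z0; rewrite invr_ge0 exprn_ge0// ltW.
rewrite (_ : (fun z : pt => _) = (fun z : pt => z.2 `^ (- k%:R) * \1_Hp z)%R); last first.
  apply/funext => z; rewrite indicE; case: ifPn => z0.
    by rewrite mem_set// mulr1 powR_invn// ltW.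
  by rewrite memNset ?mulr0// /Hp/=; exact/negP.
apply: measurable_funM; last by apply: measurable_indic; exact: measurable_Hp.
exact: (measurableT_comp (@measurable_powR R _) measurable_snd).
Qed.

Lemma tw_Hp k z : Hp z -> tw k z = (z.2 ^- k)%:E.
Proof. by move=> z0; rewrite /tw ifT. Qed.

Lemma tw_out k z : ~ Hp z -> tw k z = 0.
Proof. by move=> /negP/negbTE z0; rewrite /tw z0. Qed.

Definition wq (q : R) (g : pt -> \bar R) z := tw n.+1 z * g z `^ q.

Lemma mnn_wq q g : mnn g -> mnn (wq q g).
Proof. by move=> mg; apply: mnn_mul; [exact: mnn_tw|exact: mnn_poweR]. Qed.

Lemma measurable_cone x : measurable (cone x).
Proof.
apply: measurable_setAnd; first by apply: measurable_ltr_set => //; exact: measurable_snd.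
by apply: measurable_ltr_set; [apply: measurable_edist|].
Qed.

Lemma intH_weight (S : set pt) (g g' : pt -> \bar R) (q : R) (k : nat) :
  measurable S -> S `<=` Hp -> mnn g' -> (forall z, Hp z -> g z = g' z) ->
  intH (fun z => (\1_S z)%:E * poweR (g z) q * (z.2 ^- k)%:E) =
  \int[nu]_z (ind R S z * (tw k z * g' z `^ q)).
Proof.
move=> mS SH mg gg'.
have E1 : (fun z => ind R Hp z * ((\1_S z)%:E * poweR (g z) q * (z.2 ^- k)%:E)) =
    (fun z => ind R S z * (tw k z * g' z `^ q)).
  apply/funext => z; have [z0|z0] := pselect (Hp z).
    by rewrite ind_in// mul1e -/(ind R S z) tw_Hp// gg'// -muleA; congr (_ * _); rewrite muleC.
  by rewrite ind_out// mul0e ind_out ?mul0e// => /SH.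
rewrite intH_ind E1//; apply: mnn_mul; first exact: mnn_ind.
by apply: mnn_mul; [exact: mnn_tw|exact: mnn_poweR].
Qed.

Lemma tnormA (p q : R) r f : (0 < p)%R -> (0 < q)%R -> 0 < r -> cmeasurable f ->
  tnorm a1 a2 p%:E r q%:E f =
  (\int[mu]_x (Acone (wq q (G r f)) x `^ (p / q))) `^ p^-1.
Proof.
move=> p0 q0 r0 mf; rewrite /tnorm/=; congr (_ `^ _).
have mg := mnn_G wp r0 mf.
have E1 x : intH (fun z => (\1_(cone x) z)%:E * poweR (Wavg a1 a2 r f z) q * (z.2 ^- n.+1)%:E) =
    Acone (wq q (G r f)) x.
  apply: intH_weight => //; [exact: measurable_cone|by move=> z []|].
  by move=> z z0; rewrite G_Hp.
under eq_fun do rewrite E1.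
rewrite intRnE//; first by apply: (mnn_poweR _ _).1; exact: Acone_mnn (mnn_wq q mg).
by move=> x; exact: poweR_ge0.
Qed.

Definition tint (q : R) (g : pt -> \bar R) c (rho : R) :=
  \int[nu]_z (ind R (tent c rho) z * (tw 1 z * g z `^ q)).

(** A countable base of the topology. It makes open sets measurable and reduces local nullity to
    countably many boxes. *)
Definition ratbox (k : nat) : set pt :=
  if unpickle k is Some q then
    let: (c, s, d) := (q : n.-tuple rat * rat * rat) in
    box [tuple of map ratr c] (ratr s) (ratr d)
  else set0.

Lemma measurable_ratbox k : measurable (ratbox k).
Proof. by rewrite /ratbox; case: unpickle => [[[c s] d]|]//; exact: measurable_box. Qed.

Lemma ratbox_in z (d : R) : (0 < d)%R ->
  exists k, ratbox k z /\ ratbox k `<=` box z.1 z.2 d.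
Proof.
move=> d0.
have ex (a : R) : exists q : rat, (`|ratr q - a| < d / 4)%R.
  have [q] := @rat_in_itvoo R (a - d / 4)%R (a + d / 4)%R ltac:(lra).
  by rewrite in_itv/= => /andP[h1 h2]; exists q; rewrite ltr_distl; lra.
have [c Hc] := choice (fun i => ex (tnth z.1 i)).
have [s Hs] := ex z.2.
have [r] := @rat_in_itvoo R (d / 4)%R (d / 2)%R ltac:(lra).
rewrite in_itv/= => /andP[r1 r2].
exists (pickle ([tuple c i | i < n], s, r)); rewrite /ratbox pickleK; split.
- split => [i|]; last by rewrite distrC; lra.
  by rewrite tnth_map tnth_mktuple distrC; have := Hc i; lra.
- move=> w [w1 w2]; split => [i|].
    have := w1 i; rewrite tnth_map tnth_mktuple => h; have := Hc i.
    have := ler_distD (ratr (c i)) (tnth w.1 i) (tnth z.1 i); lra.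
  have := ler_distD (ratr s) w.2 z.2; lra.
Qed.

Lemma measurable_open (S : set pt) :
  (forall z, S z -> exists2 d : R, (0 < d)%R & box z.1 z.2 d `<=` S) -> measurable S.
Proof.
move=> oS.
have -> : S = \bigcup_k (if `[< ratbox k `<=` S >] then ratbox k else set0).
  apply/seteqP; split => z.
    move=> Sz; have [d d0 sub] := oS z Sz; have [k [kz ks]] := ratbox_in z d0.
    by exists k => //; rewrite asboolT//; exact: subset_trans sub.
  by move=> [k _]; case: ifPn => // /asboolP; apply.
apply: bigcup_measurable => k _; case: ifPn => // _; exact: measurable_ratbox.
Qed.

Lemma edist_lt_open x y (t : R) : (edist x y < t)%R -> exists2 d : R, (0 < d)%R &
  forall y' t', (forall i, `|tnth y' i - tnth y i| < d)%R -> (`|t' - t| < d)%R -> (edist x y' < t')%R.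
Proof.
set e := edist x y => et; have e0 : (0 <= e)%R by rewrite /e sqrtr_ge0.
have t0 : (0 < t)%R by exact: le_lt_trans et.
have te : (0 < t ^+ 2 - e ^+ 2)%R by rewrite subr_gt0 ltrXn2r// nnegrE ltW.
(* The first two terms control the growth of the squared distance, [2 * t] the decrease of the
   squared radius, and the final 1 makes the inequality strict. *)
pose M := (2 * (n%:R * e) + n%:R + 2 * t + 1)%R.
have n0 : (0 <= n%:R :> R)%R by [].
have M0 : (0 < M)%R.
  have : (0 <= n%:R * e)%R by rewrite mulr_ge0.
  rewrite /M; lra.
pose d := Num.min 1%R (Num.min t ((t ^+ 2 - e ^+ 2) / M)%R).
have d0 : (0 < d)%R by rewrite !lt_min ltr01 t0 divr_gt0.
have d1 : (d <= 1)%R by rewrite ge_min lexx.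
have dt : (d <= t)%R by rewrite !ge_min lexx orbT.
have dM : (d * M <= t ^+ 2 - e ^+ 2)%R.
  by rewrite -ler_pdivlMr// !ge_min lexx !orbT.
exists d => // y' t' Hy; rewrite ltr_distl => /andP[ht _].
have t'0 : (0 < t')%R by lra.
rewrite -(@ltr_pXn2r _ 2)// ?nnegrE ?sqrtr_ge0 ?ltW//.
rewrite sqr_sqrtr; last by apply: sumr_ge0 => i _; exact: sqr_ge0.
apply: (@le_lt_trans _ _ (e ^+ 2 + d * (2 * (n%:R * e) + n%:R))%R).
  rewrite [(e ^+ 2)%R]sqr_sqrtr; last by apply: sumr_ge0 => i _; exact: sqr_ge0.
  have -> : (d * (2 * (n%:R * e) + n%:R) = \sum_(i < n) (d * (2 * e + 1)))%R.
    by rewrite sumr_const card_ord -[RHS]mulr_natl; ring.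
  rewrite -big_split/=; apply: ler_sum => i _.
  have := edist_coord x y i; rewrite -/e => ei.
  set a := (tnth x i - tnth y i)%R in ei *.
  set b := (tnth y' i - tnth y i)%R.
  have -> : (tnth x i - tnth y' i = a - b)%R by rewrite /a /b; ring.
  have bd : (`|b| <= d)%R by apply/ltW/Hy.
  have ab : (- (a * b) <= e * d)%R.
    apply: (le_trans (ler_norm _)); rewrite normrN normrM.
    by apply: ler_pM.
  have bb : (b ^+ 2 <= d)%R.
    rewrite -real_normK ?num_real//; apply: (@le_trans _ _ (d ^+ 2)%R).
      by rewrite lerXn2r ?nnegrE// ltW.
    by rewrite expr2 ger_pMr.
  have -> : ((a - b) ^+ 2 = a ^+ 2 + 2 * (- (a * b)) + b ^+ 2)%R by ring.
  lra.
apply: (@le_lt_trans _ _ (t ^+ 2 - d * (2 * t) - d)%R); first by move: dM; rewrite /M; lra.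
apply: (@lt_le_trans _ _ ((t - d) ^+ 2)%R).
  have -> : ((t - d) ^+ 2 = t ^+ 2 - d * (2 * t) + d ^+ 2)%R by ring.
  by have : (0 <= d ^+ 2)%R by [exact: sqr_ge0|]; lra.
by rewrite lerXn2r ?nnegrE ?subr_ge0// ltW.
Qed.

(** Within the half-space, failing to lie in the tent means that some point outside the large ball
    is at distance less than the height, which is an open condition. *)
Lemma measurable_tent c (rho : R) : measurable (tent c rho).
Proof.
rewrite (_ : tent c rho = Hp `&` ~` [set z : pt | exists2 x, ~ ballRn c rho x & (edist x z.1 < z.2)%R]).
  apply: measurableI; first exact: measurable_Hp.
  apply: measurableC; apply: measurable_open => z [x nx xz].
  have [d d0 Hd] := edist_lt_open xz; exists d => // w [w1 w2]; exists x => //.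
  exact: Hd.
apply/seteqP; split => z [z0 zB]; split => //.
  by move=> [x nx xz]; apply: nx; exact: zB.
by move=> x xz; apply: contrapT => nx; apply: zB; exists x.
Qed.

(* Superlevel sets of a supremum over cones are unions of balls, hence
   measurable without any regularity of [g]. *)
Lemma mnn_cone_sup (g : pt -> \bar R) : (forall z, Hp z -> 0 <= g z) ->
  mnn (fun x => ereal_sup (g @` cone x)).
Proof.
move=> g0.
have cone1 x : cone x (x, 1%R).
  split => //=; rewrite /Defs.edist big1 ?sqrtr0// => i _.
  by rewrite subrr expr0n.
split=> [|x]; last first.
  apply: (@le_trans _ _ (g (x, 1%R))); first by apply: g0; exact: ltr01.
  by apply: ereal_sup_ubound; exists (x, 1%R).
move=> mT; apply: (measurability _ (ErealGenOInfty.measurableE R)) => //.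
move=> _ [_ [a ->] <-]; rewrite setTI.
rewrite (_ : _ @^-1` _ = [set x | exists2 z, cone x z & a%:E < g z]); last first.
  apply/seteqP; split=> x /=; rewrite in_itv/= andbT.
    by move=> /ereal_sup_gt[_ [z xz <-] az]; exists z.
  by move=> [z xz az]; apply: (lt_le_trans az); apply: ereal_sup_ubound; exists z.
pose S := [set p : pt | exists2 z, cone p.1 z & a%:E < g z].
have mS : measurable S.
  apply: measurable_open => p [z [z0 pz] az].
  have [d d0 Hd] := edist_lt_open pz; exists d => // w [w1 w2].
  exists z => //; split => //; apply: Hd => //.
  by rewrite subrr normr0.
have := measurable_fun_pair (@measurable_id _ E setT) (@measurable_cst _ _ E R setT 0%R).
move=> /(_ measurableT _ mS); rewrite setTI.
by congr measurable; apply/seteqP.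
Qed.

Lemma W_open z : Hp z -> exists2 d : R, (0 < d)%R & box z.1 z.2 d `<=` W z.
Proof.
move=> z0; have t0 : (0 < z.2)%R by [].
have a2p := a2_gt0 wp; have a21 := a2_gt1 wp.
pose e := (a1 * (1 - a2^-1))%R.
have e0 : (0 < e)%R by rewrite mulr_gt0// subr_gt0.
have e1 : (e < 1 - a2^-1)%R.
  by rewrite /e gtr_pMl ?subr_gt0//; exact: lt_trans ha12 ha2.
have e2 : (e < a1)%R by rewrite /e gtr_pMr// gtrBl invr_gt0.
have e3 : (e < a2 - 1)%R.
  apply: (lt_trans e1); rewrite -subr_gt0.
  have -> : (a2 - 1 - (1 - a2^-1) = (a2 - 1) ^+ 2 / a2)%R by field; rewrite gt_eqF.
  by rewrite divr_gt0// exprn_gt0// subr_gt0.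
clearbody e.
have ez : (0 < e * z.2)%R by exact: mulr_gt0.
have d0 : (0 < e * z.2 / n.+1%:R)%R by exact: divr_gt0.
have d1 : (e * z.2 / n.+1%:R <= e * z.2)%R.
  by rewrite ler_pdivrMr// ler_peMr ?ler1n// ltW.
have d2 : (n%:R * (e * z.2 / n.+1%:R) <= e * z.2)%R.
  by rewrite mulrCA ger_pMr// ler_pdivrMr// mul1r ler_nat.
exists (e * z.2 / n.+1%:R)%R => // w [w1 w2].
have k1 : (e * z.2 < (1 - a2^-1) * z.2)%R by rewrite ltr_pM2r.
have k2 : (e * z.2 < a1 * z.2)%R by rewrite ltr_pM2r.
have k3 : (e * z.2 < (a2 - 1) * z.2)%R by rewrite ltr_pM2r.
split; last first.
  move: w2 k1 k3 d1; set d := (e * z.2 / n.+1%:R)%R; rewrite ltr_distl => /andP[h1 h2] k1 k3 d1.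
  split; first lra.
  lra.
apply: le_lt_trans (edist_le (ltW d0) (fun i => ltW (w1 i))) _.
exact: le_lt_trans k2.
Qed.

(** A Lindelof argument: each point of [Z] has a rational box inside its Whitney box, and there are
    only countably many rational boxes. *)
Lemma nullH_local (Z S : set pt) : Z `<=` Hp ->
  (forall z, Z z -> nullH (W z `&` S)) -> nullH (Z `&` S).
Proof.
move=> ZH H.
apply: (@nullHS _ _ _ (\bigcup_k (if `[< nullH (ratbox k `&` S) >] then ratbox k `&` S else set0))).
  move=> z [Zz Sz]; have [d d0 sub] := W_open (ZH z Zz).
  have [k [kz ks]] := ratbox_in z d0; exists k => //.
  rewrite asboolT//; apply: nullHS (H z Zz); apply: setSI.
  exact: subset_trans sub.
apply: nullH_bigcup => k; case: ifPn => [/asboolP//|_]; exact: nullH_set0.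
Qed.

End TentNorms.

(** * Norms at infinite exponents and quotients *)

Section Quotient.
Variables (R : realType) (n : nat).
Local Notation E := (n.-tuple R).
Local Notation mu := (@mu R n).
Local Notation Hp := (@Hp R n).
Local Notation pt := (pt R n).
Local Notation cone := (@cone R n).
Local Notation tent := (@tent R n).
Local Notation ballRn := (@ballRn R n).
Implicit Types (z w : pt) (f : pt -> R[i]) (x y c : E).

Variables (a1 a2 : R).
Hypothesis wp : whitney_param a1 a2.
Local Notation W := (@W R n a1 a2).
Local Notation G := (@G R n a1 a2).

(** The Carleson condition freed of its root of order [q]: integrals over tents are then compared
    linearly with volumes of balls, where doubling and Tonelli's theorem apply. *)
Lemma tnormB_le (q : R) r f (D : R) : (0 < q)%R -> 0 < r -> cmeasurable f -> (0 <= D)%R ->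
  (forall c (rho : R), (0 < rho)%R ->
    tint q (G r f) c rho <= (D `^ q)%:E * volRn (ballRn c rho)) ->
  tnorm a1 a2 +oo r q%:E f <= D%:E.
Proof.
move=> q0 r0 mf D0 H; rewrite /tnorm/=; apply: ge_ereal_sup => _ [x [c [rho [rho0 _ ->]]]].
have mg := mnn_G wp r0 mf.
have mb := measurable_ballRn c rho.
have vE : volRn (ballRn c rho) = mu (ballRn c rho).
  by rewrite /volRn (intRnE (mnn_ind R mb).1 (mnn_ind R mb).2) int_mu.
have v1 := mu_ballRn_ge c rho0; have v2 := mu_ballRn_le c rho0.
have vf : mu (ballRn c rho) \is a fin_num.
  by rewrite ge0_fin_numE// (le_lt_trans v2)// ltry.
have v0 : (0 < fine (mu (ballRn c rho)))%R.
  rewrite fine_gt0//; apply/andP; split.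
    by apply: lt_le_trans v1; rewrite lte_fin mulr_gt0 ?cB_gt0// exprn_gt0.
  by rewrite (le_lt_trans v2)// ltry.
have := H c rho rho0; rewrite vE -(fineK vf).
set v := fine (mu (ballRn c rho)) in v0 * => H'.
have -> : intH (fun z => (\1_(tent c rho) z)%:E * poweR (Wavg a1 a2 r f z) q * (z.2^-1)%:E) =
    tint q (G r f) c rho.
  apply: (@intH_weight R n (tent c rho) _ (G r f) q 1) => //; first exact: measurable_tent.
    by move=> z [].
  by move=> z z0; rewrite G_Hp.
have t0 : 0 <= tint q (G r f) c rho.
  apply: int_ge0; apply: mnn_mul; first by apply: mnn_ind; exact: measurable_tent.
  by apply: mnn_mul; [exact: mnn_tw|exact: mnn_poweR].
apply: (@le_trans _ _ ((v `^ (- q^-1))%:E * ((D `^ q)%:E * v%:E) `^ q^-1)).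
  apply: lee_wpmul2l; first by rewrite lee_fin powR_ge0.
  by apply: le_poweR => //; rewrite invr_ge0 ltW.
rewrite -(EFinM (D `^ q)) poweR_EFin -EFinM lee_fin powRM ?powR_ge0 ?(ltW v0)//.
rewrite -powRrM mulfV ?gt_eqF// powRr1// mulrCA -powRD ?addNr ?powRr0 ?mulr1//.
by rewrite (gt_eqF v0) implybT.
Qed.

Lemma tnormB_ge (q : R) r f (D : R) : (0 < q)%R -> 0 < r -> cmeasurable f ->
  tnorm a1 a2 +oo r q%:E f = D%:E ->
  forall c (rho : R), (0 < rho)%R ->
    tint q (G r f) c rho <= (D `^ q)%:E * volRn (ballRn c rho).
Proof.
move=> q0 r0 mf DE c rho rho0.
have mg := mnn_G wp r0 mf.
have mb := measurable_ballRn c rho.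
have vE : volRn (ballRn c rho) = mu (ballRn c rho).
  by rewrite /volRn (intRnE (mnn_ind R mb).1 (mnn_ind R mb).2) int_mu.
have v1 := mu_ballRn_ge c rho0; have v2 := mu_ballRn_le c rho0.
have vf : mu (ballRn c rho) \is a fin_num.
  by rewrite ge0_fin_numE// (le_lt_trans v2)// ltry.
have v0 : (0 < fine (mu (ballRn c rho)))%R.
  rewrite fine_gt0//; apply/andP; split.
    by apply: lt_le_trans v1; rewrite lte_fin mulr_gt0 ?cB_gt0// exprn_gt0.
  by rewrite (le_lt_trans v2)// ltry.
have t0 : 0 <= tint q (G r f) c rho.
  apply: int_ge0; apply: mnn_mul; first by apply: mnn_ind; exact: measurable_tent.
  by apply: mnn_mul; [exact: mnn_tw|exact: mnn_poweR].
have TE : intH (fun z => (\1_(tent c rho) z)%:E * poweR (Wavg a1 a2 r f z) q * (z.2^-1)%:E) =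
    tint q (G r f) c rho.
  apply: (@intH_weight R n (tent c rho) _ (G r f) q 1) => //; first exact: measurable_tent.
    by move=> z [].
  by move=> z z0; rewrite G_Hp.
have le : ((fine (volRn (ballRn c rho)) `^ (- q^-1))%:E *
    (tint q (G r f) c rho) `^ q^-1) <= D%:E.
  rewrite -DE /tnorm/= -TE; apply: ereal_sup_ubound; exists c, c, rho; split => //.
  by rewrite /Defs.ballRn/= /Defs.edist big1 ?sqrtr0// => i _; rewrite subrr expr0n.
move: le; rewrite vE -(fineK vf)/=.
set v := fine (mu (ballRn c rho)) in v0 *; move: t0.
case: (tint q (G r f) c rho) => [T| |]// T0.
  rewrite poweR_EFin -EFinM lee_fin => h; rewrite -EFinM lee_fin.
  rewrite lee_fin in T0.
  have h2 : (T `^ q^-1 <= D * v `^ q^-1)%R.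
    move: h; rewrite powRN mulrC ler_pdivrMr// powR_gt0//.
  have h0 : (0 <= T `^ q^-1)%R by exact: powR_ge0.
  have D0 : (0 <= D)%R.
    by rewrite -(pmulr_lge0 _ (powR_gt0 q^-1 v0)); exact: le_trans h2.
  have : ((T `^ q^-1) `^ q <= (D * v `^ q^-1) `^ q)%R.
    apply: (ge0_ler_powR (ltW q0)) => //; rewrite ?nnegrE//.
    exact: le_trans h2.
  rewrite powRM ?powR_ge0// -!powRrM mulVf ?gt_eqF// !powRr1//.
  exact: ltW.
rewrite poweRyr ?invr_neq0 ?gt_eqF// gt0_muley ?lte_fin ?powR_gt0//.
Qed.

Lemma tnormC (p : R) r f : (0 < p)%R -> 0 < r -> cmeasurable f ->
  tnorm a1 a2 p%:E r +oo f =
  (\int[mu]_x (ereal_sup (G r f @` cone x) `^ p)) `^ p^-1.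
Proof.
move=> p0 r0 mf; rewrite /tnorm/=; congr (_ `^ _).
have mg := mnn_G wp r0 mf.
have E1 x : Wavg a1 a2 r f @` cone x = G r f @` cone x.
  by apply/seteqP; split => _ [z [z0 xz] <-]; exists z => //; rewrite G_Hp.
under eq_fun do rewrite E1.
have ms := @mnn_cone_sup R n (G r f) (fun z _ => mg.2 z).
rewrite intRnE//; first exact: (mnn_poweR p ms).1.
by move=> x; exact: poweR_ge0.
Qed.

Lemma tnormD_le r f (D : R) : 0 < r -> cmeasurable f ->
  (forall z, Hp z -> G r f z <= D%:E) -> tnorm a1 a2 +oo r +oo f <= D%:E.
Proof.
move=> r0 mf H; rewrite /tnorm/=; apply/esssupH_leP.
rewrite (_ : [set z | _] = set0); first exact: nullH_set0.
apply/seteqP; split => // z [z0]; rewrite -(@G_Hp R n a1 a2)// => h.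
by have := H z z0; rewrite leNgt h.
Qed.

Definition realC (phi : pt -> R) : pt -> R[i] := fun z => (phi z)%:C%C.

Lemma cabs_real (a : R) : (0 <= a)%R -> cabs (a%:C%C) = a.
Proof. by move=> a0; rewrite /cabs /= expr0n/= addr0 sqrtr_sqr ger0_norm. Qed.

Lemma cmeas_real phi : measurable_fun setT phi -> cmeasurable (realC phi).
Proof. by move=> mp; split => //=; exact: measurable_funTS. Qed.

(** The inverse of 0 is 0, so the quotient vanishes where [phi] does. This does no harm once
    [phi z = 0] forces the average of [f] at [z] to vanish. *)
Definition quo f (phi : pt -> R) : pt -> R[i] := fun z => (f z * ((phi z)^-1)%:C%C)%R.

Section quo.
Variables (f : pt -> R[i]) (phi : pt -> R).
Hypothesis mf : cmeasurable f.
Hypothesis mphi : measurable_fun setT phi.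
Hypothesis phi0 : forall z, (0 <= phi z)%R.

Lemma cabs_quo z : cabs (quo f phi z) = (cabs (f z) * (phi z)^-1)%R.
Proof.
rewrite /quo /cabs ComplexField.Normc.normcM; congr (_ * _)%R.
by apply: cabs_real; rewrite invr_ge0.
Qed.

Lemma cmeas_quo : cmeasurable (quo f phi).
Proof.
have mi : measurable_fun Hp (fun z => (phi z)^-1)%R.
  have -> : (fun z => (phi z)^-1)%R = (fun z => phi z `^ (-1))%R.
    by apply/funext => z; rewrite powR_inv1.
  apply: measurable_funTS.
  exact: (measurableT_comp (@measurable_powR R (-1)) mphi).
have [m1 m2] := mf; split.
- rewrite (_ : (fun z => _) = (fun z => complex.Re (f z) * (phi z)^-1)%R); first exact: measurable_funM.
  by apply/funext => z; rewrite /quo; case: (f z) => a b /=; rewrite mulr0 subr0.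
- rewrite (_ : (fun z => _) = (fun z => complex.Im (f z) * (phi z)^-1)%R); first exact: measurable_funM.
  by apply/funext => z; rewrite /quo; case: (f z) => a b /=; rewrite mulr0 add0r.
Qed.

Lemma G_quo_le r z (m : R) : 0 < r -> Hp z -> (0 < m)%R ->
  (forall w, W z w -> (m <= phi w)%R) -> G r (quo f phi) z <= (m^-1)%:E * G r f z.
Proof.
move=> r0 z0 m0 H; apply: (G_le_scale wp) => //; first exact: cmeas_quo.
- by rewrite invr_ge0 ltW.
- move=> w Ww; rewrite cabs_quo mulrC; have mw := H w Ww.
  apply: ler_wpM2r; first by rewrite /cabs; case: (f w) => a b; exact: sqrtr_ge0.
  by rewrite lef_pV2 ?posrE//; exact: lt_le_trans mw.
Qed.

Lemma G_quo_eq0 r z : 0 < r -> Hp z -> G r f z = 0 -> G r (quo f phi) z = 0.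
Proof.
move=> r0 z0 /(G_eq0P wp r0 mf z0) N0; apply/(G_eq0P wp r0 cmeas_quo z0).
have mS g : cmeasurable g -> measurable (W z `&` [set w | (0 < absH g w)%R]).
  move=> mg; apply: measurableI; first exact: measurable_W.
  by apply: measurable_ltr_set => //; exact: measurable_absH.
apply: (subset_measure0 (mS _ cmeas_quo) (mS _ mf) _ N0) => w [Ww] /=.
rewrite /absH (W_pos wp z0 Ww) cabs_quo => h; split => //=.
rewrite lt_neqAle eq_sym; apply/andP; split.
  by apply: contraTneq h => ->; rewrite mul0r ltxx.
by rewrite /cabs; case: (f w) => a b; exact: sqrtr_ge0.
Qed.

(** The factorization can only fail where [phi] vanishes and [f] does not. By assumption [f] is then
    zero almost everywhere on the Whitney box of each such point, and [nullH_local] concludes. *)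
Lemma quo_factor r : 0 < r -> (forall z, Hp z -> phi z = 0%R -> G r f z = 0) ->
  ae_absH (fun z => cabs (f z)) (fun z => cabs (realC phi z) * cabs (quo f phi z))%R.
Proof.
move=> r0 H; rewrite /ae_absH.
pose Z := [set z | (0 < z.2)%R /\ phi z = 0%R].
have ZH : Z `<=` Hp by move=> z [].
have mS : measurable [set w : pt | (0 < absH f w)%R].
  by apply: measurable_ltr_set => //; exact: measurable_absH.
apply: nullHS (nullH_local wp ZH _ (S := [set w | (0 < absH f w)%R])); last first.
  move=> z [z0 pz]; apply/nullHP; first by apply: measurableI => //; exact: measurable_W.
  rewrite setIidl; last by move=> w [Ww _]; exact: W_pos Ww.
  by apply/(G_eq0P wp r0 mf z0)/H.
move=> z [z0 ne].
have pz : phi z = 0%R.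
  apply: contrapT => /eqP pn; apply: ne.
  by rewrite /realC cabs_real// cabs_quo mulrCA mulfV// mulr1.
split => //=; rewrite /absH z0 lt_neqAle; apply/andP; split; last first.
  by rewrite /cabs; case: (f z) => a b; exact: sqrtr_ge0.
by apply/eqP => f0; apply: ne; rewrite -f0 /realC pz cabs_real// mul0r.
Qed.

(** Where the average of [f] is a positive number [g], the hypothesis reads [phi >= g / C] on the
    whole box, and dividing by [phi] leaves an average of at most [C]. *)
Lemma G_quo_bounded r (C : R) : 0 < r -> (0 < C)%R ->
  (forall z w, Hp z -> W z w -> G r f z <= (C * phi w)%:E) ->
  forall z, Hp z -> G r (quo f phi) z <= C%:E.
Proof.
move=> r0 C0 H z z0.
have [g0|gn] := eqVneq (G r f z) 0.
  by rewrite G_quo_eq0// lee_fin ltW.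
have gp : 0 < G r f z by rewrite lt_neqAle eq_sym gn (G_ge0 wp).
have [g gE] : exists g : R, G r f z = g%:E.
  move: gp (H z z z0 (W_self wp z0)); case: (G r f z) => [g| |]//; first by exists g.
have g0 : (0 < g)%R by rewrite -lte_fin -gE.
have m0 : (0 < g / C)%R by rewrite divr_gt0.
have := @G_quo_le r z (g / C)%R r0 z0 m0.
rewrite gE -EFinM invf_div divfK ?gt_eqF//; apply => w Ww.
by rewrite ler_pdivrMr// mulrC -lee_fin -gE; exact: H.
Qed.

End quo.

End Quotient.

(** * The first factorization *)

Section Spread.
Variables (R : realType) (n : nat).
Local Notation E := (n.-tuple R).
Local Notation nu := (@nu R n).
Local Notation Hp := (@Hp R n).
Local Notation pt := (pt R n).
Local Notation V := (@V R n).
Local Notation tw := (@tw R n).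
Implicit Types (z w : pt) (f : pt -> R[i]) (x y c : E).

Lemma measurable_V2 (K : R) : measurable [set p : pt * pt | V K p.1 p.2].
Proof.
have m1 : measurable_fun setT (fun p : pt * pt => p.1.1) by exact: (measurableT_comp measurable_fst measurable_fst).
have m2 : measurable_fun setT (fun p : pt * pt => p.1.2) by exact: (measurableT_comp measurable_snd measurable_fst).
have m3 : measurable_fun setT (fun p : pt * pt => p.2.1) by exact: (measurableT_comp measurable_fst measurable_snd).
have m4 : measurable_fun setT (fun p : pt * pt => p.2.2) by exact: (measurableT_comp measurable_snd measurable_snd).
apply: measurable_setAnd; last apply: measurable_setAnd.
- by apply: measurable_in_cube => //; exact: measurable_funM.
- by apply: measurable_ltr_set => //; exact: measurable_funM.
- by apply: measurable_ltr_set => //; exact: measurable_funM.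
Qed.

Lemma mnn_V2 (K : R) : mnn (fun p : pt * pt => ind R (V K p.1) p.2).
Proof. by apply: mnn_ind2; exact: measurable_V2. Qed.

Lemma mnn_V (K : R) z : mnn (ind R (V K z)).
Proof. exact: mnn_comp (mnn_V2 K) (pair1_measurable z). Qed.

Lemma nu_V_le (K : R) z : (1 <= K)%R -> Hp z ->
  nu (V K z) <= ((2 * K) ^+ n.+1 * z.2 ^+ n.+1)%:E.
Proof.
move=> K1 z0; have t0 : (0 < z.2)%R by [].
have Kp : (0 < K)%R by lra.
have Kt : (0 < K * z.2)%R by rewrite mulr_gt0.
rewrite -exprMn -mulrA -(@nu_box R n z.1 z.2 (K * z.2)%R)//.
apply: le_measure; rewrite ?inE.
- have := pair1_measurable z measurableT (measurable_V2 K).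
  by rewrite setTI.
- exact: measurable_box.
- move=> w [h1 [h2 h3]]; split => //.
  have : (0 < K^-1 * z.2)%R by rewrite mulr_gt0// invr_gt0.
  have : (z.2 <= K * z.2)%R by rewrite ler_peMl// ltW.
  by rewrite ltr_norml; lra.
Qed.

Lemma V_pos (K : R) z w : (0 < K)%R -> Hp z -> V K z w -> (0 < w.2)%R.
Proof. by move=> K0 z0 [_ [h _]]; apply: lt_trans h; rewrite mulr_gt0// invr_gt0. Qed.

Lemma V_ltK (K : R) z w : (0 < K)%R -> V K z w -> (z.2 < K * w.2)%R.
Proof. by move=> K0 [_ [h _]]; rewrite -ltr_pdivrMl. Qed.

Lemma V_sym (K : R) z w : (1 <= K)%R -> Hp z -> V K z w -> V (K * K) w z.
Proof.
move=> K1 z0 zw; have Kp : (0 < K)%R by lra.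
have w0 := V_pos Kp z0 zw; have t0 : (0 < z.2)%R by [].
have zK := V_ltK Kp zw; case: zw => [h1 [h2 h3]].
have KK : (K <= K * K)%R by rewrite ler_peMl// ltW.
split; last split.
- move=> i; rewrite distrC; apply: (lt_le_trans (h1 i)).
  by rewrite -mulrA ler_wpM2l ?ltW.
- apply: (@le_lt_trans _ _ (K^-1 * w.2)%R); last by rewrite ltr_pdivrMl.
  by rewrite ler_wpM2r ?(ltW w0)// lef_pV2 ?posrE ?mulr_gt0.
- by apply: (lt_le_trans zK); rewrite ler_wpM2r// ltW.
Qed.

Lemma V_trans (K L : R) z w v : (1 <= K)%R -> (1 <= L)%R -> Hp z ->
  V K z w -> V L w v -> V (K + K * L) z v.
Proof.
move=> K1 L1 z0 zw wv; have Kp : (0 < K)%R by lra.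
have Lp : (0 < L)%R by lra.
have KL : (0 < K * L)%R by rewrite mulr_gt0.
have w0 := V_pos Kp z0 zw; have t0 : (0 < z.2)%R by [].
have zK := V_ltK Kp zw; have wL := V_ltK Lp wv.
have v0 : (0 < v.2)%R by exact: V_pos wv.
case: zw wv => [h1 [h2 h3]] [k1 [k2 k3]].
have e1 : (L * w.2 < K * L * z.2)%R by rewrite -mulrA (mulrCA K) ltr_pM2l.
have e2 : (0 < K * z.2)%R by rewrite mulr_gt0.
split; last split.
- move=> i; have := h1 i; have := k1 i.
  have := ler_distD (tnth w.1 i) (tnth v.1 i) (tnth z.1 i); rewrite mulrDl; lra.
- rewrite mulrC ltr_pdivrMr ?addr_gt0//; apply: (lt_trans zK).
  apply: (@lt_trans _ _ (K * (L * v.2))%R); first by rewrite ltr_pM2l.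
  by rewrite mulrDr [ltRHS]addrC (mulrA K L) (mulrC _ v.2) ltrDl mulr_gt0.
- by rewrite mulrDl; lra.
Qed.

Lemma tw_le (k : nat) (K : R) z w : (0 < K)%R -> Hp z -> (0 < w.2)%R -> (w.2 <= K * z.2)%R ->
  tw k z <= (K ^+ k)%:E * tw k w.
Proof.
move=> Kp z0 w0 wz; have t0 : (0 < z.2)%R by [].
rewrite !tw_Hp// -EFinM lee_fin -exprVn -exprVn -exprMn lerXn2r ?nnegrE//.
- by rewrite invr_ge0 ltW.
- by rewrite mulr_ge0 ?invr_ge0 ?(ltW w0) ?(ltW Kp).
- by rewrite ler_pdivlMr// mulrC ler_pdivrMr.
Qed.

(** A mean over an enlarged Whitney region, normalised by the power of the height rather than by the
    measure of the region. *)
Definition spread (u : pt -> \bar R) (K : R) z : \bar R :=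
  tw n.+1 z * \int[nu]_w (ind R (V K z) w * u w).

Lemma mnn_spread_int u (K : R) : mnn u -> mnn (fun z => \int[nu]_w (ind R (V K z) w * u w)).
Proof.
move=> mu_; apply: (@mnn_int1 R _ _ _ _ nu (fun (z : pt) (w : pt) => ind R (V K z) w * u w)).
by apply: mnn_mul; [exact: mnn_V2|exact: mnn_comp mu_ _].
Qed.

Lemma mnn_spread u (K : R) : mnn u -> mnn (spread u K).
Proof. by move=> mu_; apply: mnn_mul; [exact: mnn_tw|exact: mnn_spread_int]. Qed.

Definition cS (K : R) : R := (K ^+ n.+1 * (2 * (K * K)) ^+ n.+1)%R.

(** Tonelli's theorem moves the averaging from [u] to the kernel. For fixed [w], the points [z]
    whose region contains [w] lie in [V (K * K) w], and both the measure of that set and the weight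
    are comparable to powers of the height of [w]; [cS] collects the two constants. *)
Lemma spread_le (K : R) (k k' u : pt -> \bar R) : (1 <= K)%R -> mnn k -> mnn k' -> mnn u ->
  (forall z w, Hp z -> V K z w -> k z <= k' w) ->
  \int[nu]_z (k z * spread u K z) <= (cS K)%:E * \int[nu]_w (k' w * u w).
Proof.
move=> K1 mk mk' mu_ H; have Kp : (0 < K)%R by lra.
have mt := mnn_tw R n n.+1.
have cS0 : (0 <= cS K)%R.
  by apply: mulr_ge0; apply: exprn_ge0; rewrite ?mulr_ge0 ?(ltW Kp).
have KK1 : (1 <= K * K)%R by rewrite (le_trans K1)// ler_peMl// ltW.
have mL : mnn (fun p : pt * pt => k p.1 * tw n.+1 p.1 * (ind R (V K p.1) p.2 * u p.2)).
  apply: mnn_mul.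
    apply: mnn_mul; first exact: mnn_comp mk measurable_fst.
    exact: mnn_comp mt measurable_fst.
  by apply: mnn_mul; [exact: mnn_V2|exact: mnn_comp mu_ _].
have mR : mnn (fun p : pt * pt => k' p.2 * u p.2 * (tw n.+1 p.1 * ind R (V K p.1) p.2)).
  apply: mnn_mul.
    by apply: mnn_mul; [exact: mnn_comp mk' _|exact: mnn_comp mu_ _].
  by apply: mnn_mul; [exact: mnn_comp mt _|exact: mnn_V2].
have mku : mnn (fun w => k' w * u w) by exact: mnn_mul.
apply: (@le_trans _ _ (\int[nu]_z \int[nu]_w (k' w * u w * (tw n.+1 z * ind R (V K z) w)))).
  rewrite (_ : \int[nu]_z _ = \int[nu]_z \int[nu]_w (k z * tw n.+1 z * (ind R (V K z) w * u w))); last first.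
    apply: eq_integral => z _; rewrite int_Zl.
    - by rewrite muleA.
    - by apply: mnn_mul => //; exact: mnn_V.
    - by rewrite mule_ge0; [|exact: mk.2|exact: mt.2].
  apply: int_le.
  - exact: (mnn_int1 nu mL).
  - exact: (mnn_int1 nu mR).
  - move=> z; apply: int_le => [| |w].
    + exact: (mnn_comp mL (pair1_measurable z)).
    + exact: (mnn_comp mR (pair1_measurable z)).
    have [z0|z0] := pselect (Hp z); last by rewrite tw_out// mule0 !mul0e mule0.
    have [zw|zw] := pselect (V K z w); last by rewrite ind_out// mul0e !mule0.
    rewrite ind_in// mul1e mule1 muleAC; apply: lee_wpmul2r; first exact: mt.2.
    by apply: lee_wpmul2r; [exact: mu_.2|exact: H].
rewrite (tonelli nu nu mR) -int_Zl ?lee_fin//.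
apply: int_le.
- exact: (mnn_int2 nu mR).
- by apply: mnn_mul => //; apply: mnn_cst; rewrite lee_fin.
- move=> w; rewrite int_Zl; last 2 first.
  + apply: mnn_mul => //; exact: mnn_comp (mnn_V2 K) (pair2_measurable w).
  + exact: mku.2.
  rewrite muleC; apply: lee_wpmul2r; first exact: mku.2.
  have [w0|w0] := pselect (Hp w); last first.
    rewrite integral0_eq ?lee_fin// => z _.
     have [z0|z0] := pselect (Hp z); last by rewrite tw_out// mul0e.
    by rewrite ind_out ?mule0// => zw; apply: w0; exact: V_pos zw.
  have w0' : (0 < w.2)%R by [].
  have mc : mnn (fun _ : pt => (K ^+ n.+1)%:E * tw n.+1 w).
    by apply: mnn_cst; apply: mule_ge0; [by rewrite lee_fin exprn_ge0// ltW|exact: mt.2].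
  apply: (@le_trans _ _ (\int[nu]_z ((K ^+ n.+1)%:E * tw n.+1 w * ind R (V (K * K) w) z))).
    apply: int_le => [| |z].
    - by apply: mnn_mul => //; exact: mnn_comp (mnn_V2 K) (pair2_measurable w).
    - by apply: mnn_mul => //; exact: mnn_V.
    have [z0|z0] := pselect (Hp z); last first.
      by rewrite tw_out// mul0e mule_ge0 ?ind_ge0//; exact: (mc.2 z).
    have [zw|zw] := pselect (V K z w); last first.
      by rewrite ind_out// mule0 mule_ge0 ?ind_ge0//; exact: (mc.2 z).
    rewrite !ind_in//; last exact: V_sym.
    by rewrite !mule1; apply: tw_le => //; case: zw => [_ [_ /ltW]].
  rewrite int_Zl; [|exact: mnn_V|exact: (mc.2 w)].
  rewrite int_nu; last first.
    by have := pair1_measurable w measurableT (measurable_V2 (K * K)); rewrite setTI.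
  apply: le_trans (lee_wpmul2l (mc.2 w) (nu_V_le KK1 w0)) _.
  rewrite tw_Hp// -!EFinM lee_fin /cS le_eqVlt; apply/orP; left; apply/eqP.
  by field; rewrite gt_eqF// exprn_gt0.
Qed.

End Spread.

Section FirstFactorization.
Variables (R : realType) (n : nat).
Local Notation E := (n.-tuple R).
Local Notation Hp := (@Hp R n).
Local Notation pt := (pt R n).
Local Notation V := (@V R n).
Implicit Types (z w : pt) (f : pt -> R[i]) (x y c : E).

Variables (a1 a2 : R).
Hypothesis wp : whitney_param a1 a2.
Let ha1 : (0 < a1)%R. Proof. by case: wp. Qed.
Let ha12 : (a1 < a2^-1)%R. Proof. by case: wp. Qed.
Let ha2 : (a2^-1 < 1)%R. Proof. by case: wp. Qed.
Let a2p : (0 < a2)%R. Proof. exact: a2_gt0 wp. Qed.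
Let a21 : (1 < a2)%R. Proof. exact: a2_gt1 wp. Qed.
Local Notation W := (@W R n a1 a2).
Local Notation G := (@G R n a1 a2).

Lemma W_V z w : Hp z -> W z w -> V a2 z w /\ V a2 w z.
Proof.
move=> z0 Ww; have w0 := W_pos wp z0 Ww; have t0 : (0 < z.2)%R by [].
case: Ww => [h1 [h2 h3]].
have d i : (`|tnth w.1 i - tnth z.1 i| < a1 * z.2)%R.
  by apply: le_lt_trans h1; exact: edist_coord.
have a11 : (a1 < 1)%R by exact: lt_trans ha12 ha2.
have tw' : (z.2 < a2 * w.2)%R by rewrite -ltr_pdivrMl.
split; split => //.
- move=> i; apply: (lt_trans (d i)); rewrite ltr_pM2r//; have := a21; lra.
- move=> i; rewrite distrC; apply: (lt_trans (d i)).
  apply: (@lt_trans _ _ (a1 * (a2 * w.2))%R); first by rewrite ltr_pM2l.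
  by rewrite gtr_pMl// mulr_gt0.
- by split => //; rewrite ltr_pdivrMl.
Qed.

(* Chosen so that [V K0 z `<=` V K1 w] and [V K1 w `<=` V K2 z] for [w] in [W z]. *)
Definition K1 : R := (a2 + a2 * @K0 R a2)%R.
Definition K2 : R := (a2 + a2 * K1)%R.

Let K0_1 : (1 <= @K0 R a2)%R. Proof. exact: ltW (K0_gt1 wp). Qed.
Lemma K1_ge1 : (1 <= K1)%R.
Proof.
have : (0 <= a2 * @K0 R a2)%R by rewrite mulr_ge0 ?(ltW a2p)// (le_trans ler01).
by rewrite /K1; have := a21; lra.
Qed.

Lemma K2_ge1 : (1 <= K2)%R.
Proof.
have : (0 <= a2 * K1)%R by rewrite mulr_ge0 ?(ltW a2p)// (le_trans ler01 K1_ge1).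
by rewrite /K2; have := a21; lra.
Qed.

Section phi.
Variables (q : R) (q0 : (0 < q)%R) (g : pt -> \bar R).
Hypothesis mg : mnn g.
Let u z := g z `^ q.
Let mu_ : mnn u. Proof. exact: mnn_poweR. Qed.

(** [fine] would turn an infinite mean into 0, so the estimates assume that the means are finite;
    this is derived from the norm of [f] in [phi1_norm_cone] and [phi1_norm_tent]. *)
Definition phi1 z : R := (fine (spread u K1 z) `^ q^-1)%R.

Lemma phi1_ge0 z : (0 <= phi1 z)%R. Proof. exact: powR_ge0. Qed.

Lemma measurable_phi1 : measurable_fun setT phi1.
Proof.
apply: (measurableT_comp (@measurable_powR R q^-1)).
apply: (@measurableT_comp _ _ _ _ _ _ (fine : \bar R -> R)).
  by apply: fine_measurable.
by case: (mnn_spread K1 mu_).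
Qed.

Lemma spread_fin z : Hp z -> spread u K1 z < +oo -> spread u K1 z = (phi1 z `^ q)%:E.
Proof.
move=> z0 lt; rewrite /phi1 -powRrM mulVf ?gt_eqF// powRr1; last first.
  by apply: fine_ge0; case: (mnn_spread K1 mu_).
by rewrite fineK// ge0_fin_numE//; case: (mnn_spread K1 mu_).
Qed.

Lemma spread_step (K K' : R) z w : (0 < K)%R -> Hp z -> Hp w -> (z.2 <= a2 * w.2)%R ->
  V K w `<=` V K' z -> spread u K w <= (a2 ^+ n.+1)%:E * spread u K' z.
Proof.
move=> Kp z0 w0 zw sub; rewrite /spread muleA; apply: lee_pmul.
- by case: (mnn_tw R n n.+1).
- by case: (mnn_spread_int K mu_).
- exact: tw_le.
- apply: int_le => [| |v].
  + by apply: mnn_mul => //; exact: mnn_V.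
  + by apply: mnn_mul => //; exact: mnn_V.
  + by apply: lee_wpmul2r; [exact: mu_.2|apply: ind_sub => /sub].
Qed.

Hypothesis fin : forall z, Hp z -> spread u K1 z < +oo.

(** The regions [V K1 w] of all points [w] of the box fit into [V K2 z], so a single mean bounds
    even the supremum of [phi1] over the box. This is why the first factor may have inner exponent
    infinity. *)
Lemma phi1_upper z : Hp z ->
  G +oo (realC phi1) z `^ q <= (a2 ^+ n.+1)%:E * spread u K2 z.
Proof.
move=> z0.
have c0 : (0 < a2 ^+ n.+1)%R by rewrite exprn_gt0.
have S0 : 0 <= spread u K2 z by case: (mnn_spread K2 mu_).
case E1 : (spread u K2 z) S0 => [S| |]// S0; last by rewrite gt0_muley ?leey.
rewrite -EFinM; set D := (a2 ^+ n.+1 * S)%R.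
have D0 : (0 <= D)%R by rewrite mulr_ge0// ltW.
have : G +oo (realC phi1) z <= (D `^ q^-1)%:E.
  apply: (G_oo_le wp) => //; [exact: cmeas_real measurable_phi1|exact: powR_ge0|].
  move=> w Ww; rewrite cabs_real ?phi1_ge0//.
  have w0 : Hp w by exact: W_pos wp _ _ z0 Ww.
  have [zw wz] := W_V z0 Ww.
  have := @spread_step K1 K2 z w _ z0 w0 _ (fun v => @V_trans R n a2 K1 z w v (ltW a21) K1_ge1 z0 zw).
  rewrite E1 -EFinM spread_fin ?fin// lee_fin => H.
  have {}H : (phi1 w `^ q <= D)%R.
    by apply: H; [exact: lt_le_trans K1_ge1|exact/ltW/V_ltK].
  have := @ge0_ler_powR R q^-1 _ (phi1 w `^ q)%R D.
  rewrite -powRrM mulfV ?gt_eqF// powRr1 ?phi1_ge0//; apply => //.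
  - by rewrite invr_ge0 ltW.
  - by rewrite nnegrE powR_ge0.
move=> /(le_poweR (ltW q0) (G_ge0 wp _ _ (ltry _))) /le_trans; apply.
by rewrite poweR_EFin -powRrM mulVf ?gt_eqF// powRr1.
Qed.

End phi.

Lemma phi1_lower (q : R) r : (0 < q)%R -> 0 < r -> exists2 C : R, (0 < C)%R &
  forall f, cmeasurable f ->
  (forall z, Hp z -> spread (fun w => G r f w `^ q) K1 z < +oo) ->
  forall z w, Hp z -> W z w -> G r f z <= (C * phi1 q (G r f) w)%:E.
Proof.
move=> q0 r0; have [C C0 H] := G_submean n wp r0 q0.
(* The constant [C] of [G_submean] is only nonnegative; the added 1 provides the positive constant
   that [G_quo_bounded] asks for. *)
pose D := (C * a2 ^+ n.+1 + 1)%R.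
have Dp : (0 < D)%R.
  by rewrite ltr_wpDl ?ltr01// mulr_ge0// exprn_ge0// ltW.
exists (D `^ q^-1)%R; first exact: powR_gt0.
move=> f mf fin z w z0 Ww; have mg := mnn_G wp r0 mf.
have mgq : mnn (fun w => G r f w `^ q) by exact: mnn_poweR.
have w0 : Hp w by exact: W_pos wp _ _ z0 Ww.
have t0 : (0 < z.2)%R by [].
have [zw wz] := W_V z0 Ww.
have wzlt : (w.2 <= a2 * z.2)%R by case: Ww => [_ [_ /ltW]].
have main : G r f z `^ q <= D%:E * spread (fun w => G r f w `^ q) K1 w.
  have S1 : spread (fun w => G r f w `^ q) (@K0 R a2) z <=
      (a2 ^+ n.+1)%:E * spread (fun w => G r f w `^ q) K1 w.
    apply: (spread_step q mg) => //; first exact: lt_le_trans K0_1.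
    by move=> v; apply: V_trans => //; exact: ltW.
  apply: (@le_trans _ _ (C%:E * spread (fun w => G r f w `^ q) (@K0 R a2) z)).
    rewrite /spread tw_Hp// muleCA lee_pdivlMl ?exprn_gt0//; exact: H.
  apply: (@le_trans _ _ (C%:E * ((a2 ^+ n.+1)%:E * spread (fun w => G r f w `^ q) K1 w))).
    by apply: lee_wpmul2l; rewrite ?lee_fin.
  rewrite muleA -EFinM; apply: lee_wpmul2r; first by case: (mnn_spread K1 mgq).
  by rewrite lee_fin lerDl.
rewrite (spread_fin q0 mg w0 (fin w w0)) -EFinM in main.
have -> : G r f z = (G r f z `^ q) `^ q^-1.
  by rewrite -poweRrM mulfV ?gt_eqF// poweRe1//; exact: mg.2.
apply: (@le_trans _ _ ((D * phi1 q (G r f) w `^ q)%:E `^ q^-1)).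
  by apply: le_poweR => //; [rewrite invr_ge0 ltW|exact: poweR_ge0].
rewrite poweR_EFin lee_fin powRM ?(ltW Dp) ?powR_ge0// -powRrM mulfV ?gt_eqF//.
by rewrite powRr1 ?phi1_ge0.
Qed.

End FirstFactorization.

Section FirstFactorizationNorms.
Variables (R : realType) (n : nat).
Local Notation E := (n.-tuple R).
Local Notation mu := (@mu R n).
Local Notation nu := (@nu R n).
Local Notation Hp := (@Hp R n).
Local Notation pt := (pt R n).
Local Notation cone := (@cone R n).
Local Notation V := (@V R n).
Local Notation tw := (@tw R n).
Implicit Types (z w : pt) (f : pt -> R[i]) (x y c : E).

Variables (a1 a2 : R).
Hypothesis wp : whitney_param a1 a2.
Local Notation G := (@G R n a1 a2).
Local Notation K1 := (@K1 R a2).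
Local Notation K2 := (@K2 R a2).

(** The distance from [x] to [w] is below [1 + K] times the height of [z], which in turn is below
    [K] times that of [w]. *)
Lemma V_ccone (K : R) z w x : (1 <= K)%R -> Hp z -> cube z.1 z.2 x -> V K z w ->
  ccone ((1 + K) * K)%R x w.
Proof.
move=> K1' z0 zx zw; have Kp : (0 < K)%R by lra.
have w0 := V_pos Kp z0 zw; have zK := V_ltK Kp zw; case: zw => [h1 _].
split => // i; have := h1 i; have := zx i.
have := ler_distD (tnth z.1 i) (tnth x i) (tnth w.1 i).
rewrite (distrC (tnth z.1 i) (tnth w.1 i)).
have : ((1 + K) * z.2 < (1 + K) * K * w.2)%R by rewrite -mulrA ltr_pM2l//; lra.
rewrite mulrDl mul1r; lra.
Qed.

Lemma mnn_ccone (l : R) x : mnn (ind R (ccone l x : set pt)).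
Proof.
apply: mnn_ind; apply: measurable_setAnd; first by apply: measurable_ltr_set => //; exact: measurable_snd.
apply: measurable_in_cube => //; apply: measurable_funM => //; exact: measurable_snd.
Qed.

Section finiteness.
Variables (q : R) (q0 : (0 < q)%R) (g : pt -> \bar R).
Hypothesis mg : mnn g.
Let u z := g z `^ q.
Let mu_ : mnn u. Proof. exact: mnn_poweR. Qed.

(** One infinite mean at [z] would make the area functional of a wide cone infinite at all [x] of a
    cube, and by change of aperture the integral assumed finite would be infinite. *)
Lemma spread_fin_cone (s : R) : (0 < s)%R ->
  \int[mu]_x (Acone (wq q g) x `^ s) < +oo ->
  forall z, Hp z -> spread u K1 z < +oo.
Proof.
move=> s0 fin z z0; have t0 : (0 < z.2)%R by [].
have k1 := K1_ge1 wp; have kp : (0 < K1)%R by lra.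
pose l := ((1 + K1) * K1)%R.
have l0 : (0 < l)%R by rewrite mulr_gt0//; lra.
have [C C0 Ap] := @aperture R n s l s0 l0.
have mw := mnn_wq q mg.
have fin2 : \int[mu]_x (Acube l (wq q g) x `^ s) < +oo.
  apply: le_lt_trans (Ap _ mw) _; apply: lte_mul_pinfty; rewrite ?lee_fin//.
set I := \int[nu]_w (ind R (V K1 z) w * u w).
have I0 : 0 <= I by apply: int_ge0; apply: mnn_mul => //; exact: mnn_V.
suff If : I < +oo.
  by rewrite /spread tw_Hp//; apply: lte_mul_pinfty; rewrite ?lee_fin ?invr_ge0 ?exprn_ge0 ?ltW.
rewrite ltey; apply/eqP => Ioo.
have big x : cube z.1 z.2 x -> Acube l (wq q g) x = +oo.
  move=> zx.
  have c0 : (0 < (K1 * z.2) ^+ n.+1)%R by rewrite exprn_gt0// mulr_gt0.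
  have : I <= ((K1 * z.2) ^+ n.+1)%:E * Acube l (wq q g) x.
    have mS : mnn (fun w => ind R (ccone l x) w * wq q g w).
      by apply: mnn_mul => //; exact: mnn_ccone.
    rewrite -int_Zl ?lee_fin ?(ltW c0)//.
    apply: int_le => [| |w].
    - by apply: mnn_mul => //; exact: mnn_V.
    - by apply: mnn_mul => //; apply: mnn_cst; rewrite lee_fin ltW.
    - have [zw|zw] := pselect (V K1 z w); last first.
        by rewrite ind_out// mul0e mule_ge0 ?lee_fin ?(ltW c0)//; exact: mS.2.
      have w0 : (0 < w.2)%R := V_pos kp z0 zw.
      rewrite (ind_in R zw) (ind_in R (V_ccone k1 z0 zx zw)).
      rewrite !mul1e /wq tw_Hp// muleA -EFinM.
      rewrite -[leLHS]mul1e; apply: lee_wpmul2r; first exact: mu_.2.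
      rewrite lee_fin ler_pdivlMr ?exprn_gt0// mul1r lerXn2r ?nnegrE ?(ltW w0)//.
        by rewrite mulr_ge0 ?ltW.
      by case: zw => [_ [_ /ltW]].
  rewrite Ioo leye_eq => /eqP.
  case E1 : (Acube l (wq q g) x) => [v| |]//.
  by have := (Acube_mnn l mw).2 x; rewrite E1.
have : \int[mu]_x (ind R (cube z.1 z.2) x * +oo) <= \int[mu]_x (Acube l (wq q g) x `^ s).
  have mA : mnn (fun x => Acube l (wq q g) x `^ s) by exact: mnn_poweR (Acube_mnn l mw).
  apply: int_le => // [|x].
    apply: mnn_mul; first by apply: mnn_ind; exact: measurable_cube.
    exact: mnn_cst.
  have [zx|zx] := pselect (cube z.1 z.2 x).
    by rewrite big// ind_in// mul1e poweRyr// gt_eqF.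
  by rewrite ind_out// mul0e; exact: mA.2.
rewrite int_Zr//; last by apply: mnn_ind; exact: measurable_cube.
rewrite (int_mu (measurable_cube _ _)) mu_cube// gt0_muley; last first.
  by rewrite lte_fin exprn_gt0// mulr_gt0.
by rewrite leNgt fin2.
Qed.

Hypothesis fin : forall z, Hp z -> spread u K1 z < +oo.
Let mphi : mnn (G +oo (realC (phi1 a2 q g))).
Proof. by apply: (mnn_G wp) => //; apply: cmeas_real; exact: measurable_phi1. Qed.

(** The common core of the two norm bounds: [k] is a weighted indicator of a cone or of a tent, and
    [k'] the one of its enlargement. *)
Lemma int_phi1_le (k k' : pt -> \bar R) : mnn k -> mnn k' ->
  (forall z, ~ Hp z -> k z = 0) ->
  (forall z w, Hp z -> V K2 z w -> k z <= k' w) ->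
  \int[nu]_z (k z * G +oo (realC (phi1 a2 q g)) z `^ q) <=
  (a2 ^+ n.+1 * cS n K2)%:E * \int[nu]_w (k' w * g w `^ q).
Proof.
move=> mk mk' k0 kk'; have k2 := K2_ge1 wp.
have a0 : (0 <= a2 ^+ n.+1)%R by rewrite exprn_ge0// ltW// (a2_gt0 wp).
have mkS : mnn (fun z => k z * spread u K2 z) by apply: mnn_mul => //; exact: mnn_spread.
apply: (@le_trans _ _ (\int[nu]_z ((a2 ^+ n.+1)%:E * (k z * spread u K2 z)))).
  apply: int_le => [| |z].
  - by apply: mnn_mul => //; exact: mnn_poweR.
  - by apply: mnn_mul => //; apply: mnn_cst; rewrite lee_fin.
  - have [z0|z0] := pselect (Hp z); last by rewrite k0// !mul0e mule0.
    by rewrite muleCA; apply: lee_wpmul2l; [exact: mk.2|exact: phi1_upper].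
rewrite int_Zl ?lee_fin// EFinM -muleA; apply: lee_wpmul2l; rewrite ?lee_fin//.
exact: spread_le.
Qed.

Lemma Acone_phi1 x : Acone (wq q (G +oo (realC (phi1 a2 q g)))) x <=
  (a2 ^+ n.+1 * cS n K2 * K2 ^+ n.+1)%:E * Acube ((1 + K2) * K2) (wq q g) x.
Proof.
have k2 := K2_ge1 wp; have kp : (0 < K2)%R by lra.
have c0 : (0 <= K2 ^+ n.+1)%R by rewrite exprn_ge0// ltW.
have mi : mnn (ind R (cone x : set pt)) by apply: mnn_ind; exact: measurable_cone.
have mt := mnn_tw R n n.+1.
have mi' := mnn_ccone ((1 + K2) * K2) x.
rewrite (EFinM _ (K2 ^+ n.+1)) -muleA -int_Zl; [| |by rewrite lee_fin]; last first.
  by apply: mnn_mul => //; exact: mnn_wq.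
rewrite (_ : Acone _ x = \int[nu]_z (ind R (cone x) z * tw n.+1 z *
    G +oo (realC (phi1 a2 q g)) z `^ q)); last first.
  by apply: eq_integral => z _; rewrite /wq muleA.
rewrite [X in _ <= _ * X](_ : _ = \int[nu]_w ((K2 ^+ n.+1)%:E *
    (ind R (ccone ((1 + K2) * K2) x) w * tw n.+1 w) * g w `^ q)); last first.
  by apply: eq_integral => w _; rewrite /wq -!muleA.
apply: int_phi1_le.
- exact: mnn_mul.
- by apply: mnn_mul; [apply: mnn_cst; rewrite lee_fin|exact: mnn_mul].
- by move=> z z0; rewrite tw_out// mule0.
- move=> z w z0 zw; have w0 := V_pos kp z0 zw.
  have [xz|xz] := pselect (cone x z); last first.
    rewrite ind_out// mul0e; apply: mule_ge0; first by rewrite lee_fin.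
    by apply: mule_ge0; [exact: ind_ge0|exact: mt.2].
  have [_ zx] := (coneE x z).1 xz.
  rewrite (ind_in R xz) (ind_in R (V_ccone k2 z0 (ballRn_cube zx) zw)).
  by rewrite !mul1e; apply: tw_le => //; case: zw => [_ [_ /ltW]].
Qed.

End finiteness.

End FirstFactorizationNorms.

Section FirstFactorizationFinite.
Variables (R : realType) (n : nat).
Local Notation E := (n.-tuple R).
Local Notation mu := (@mu R n).
Local Notation nu := (@nu R n).
Local Notation Hp := (@Hp R n).
Local Notation pt := (pt R n).
Local Notation cB := (cB R n).
Local Notation tent := (@tent R n).
Local Notation ballRn := (@ballRn R n).
Local Notation V := (@V R n).
Local Notation tw := (@tw R n).
Local Notation tnorm := (@tnorm R).
Implicit Types (z w : pt) (f : pt -> R[i]) (x y c : E).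

(** By [tent_coord] the height is below [2 * n.+1%:R * rho]. Moving inside [V K] and then inside the
    new ball costs [K] times this height twice, and the outer factor passes from coordinates to the
    Euclidean distance. *)
Definition tentK (K : R) : R := (n.+1%:R * (4 * K * n.+1%:R + 1))%R.

Lemma tentK_gt0 (K : R) : (1 <= K)%R -> (0 < tentK K)%R.
Proof.
move=> K1; have : (0 <= K * n.+1%:R)%R by rewrite mulr_ge0//; lra.
by move=> ?; rewrite mulr_gt0//; lra.
Qed.

(** The inclusion of balls is tested at two opposite points, shifted by [s] and [- s] in all
    coordinates. Their distance bounds the height and their midpoint the position. A coordinate must
    be given: in dimension zero tents have unbounded height. *)
Lemma tent_coord c (rho : R) z (i : 'I_n) : tent c rho z ->
  (z.2 < 2 * n.+1%:R * rho)%R /\ (`|tnth z.1 i - tnth c i| < rho)%R.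
Proof.
move=> [z0 sub]; have N0 : (0 < n.+1%:R :> R)%R by rewrite ltr0n.
pose s := (z.2 / n.+1%:R / 2)%R.
have s0 : (0 < s)%R by rewrite !divr_gt0.
have zE : (z.2 = 2 * n.+1%:R * s)%R by rewrite /s -[RHS]mulrA; move: N0; set N := n.+1%:R => N0; field; rewrite gt_eqF.
have H (e : R) : (`|e| = 1)%R -> (`|tnth z.1 i + e * s - tnth c i| < rho)%R.
  move=> e1; pose x : E := [tuple tnth z.1 j + e * s | j < n]%R.
  have xz : ballRn z.1 z.2 x.
    apply: cube_ballRn => // j; rewrite tnth_mktuple addrAC subrr add0r normrM e1 mul1r.
    rewrite gtr0_norm// /s; have := divr_gt0 z0 N0; set q := (z.2 / _)%R => q0; lra.
  by have := ballRn_cube (sub x xz) i; rewrite tnth_mktuple.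
have h1 := H 1%R (normr1 _); have h2 := H (-1)%R (normrN1 _).
rewrite mul1r mulN1r in h1 h2.
have : (s < rho)%R by move: h1 h2; rewrite !ltr_norml => /andP[? ?] /andP[? ?]; lra.
split; first by rewrite zE ltr_pM2l// mulr_gt0.
by move: h1 h2; rewrite !ltr_norml => /andP[? ?] /andP[? ?]; apply/andP; split; lra.
Qed.

Lemma tent_V (K : R) c (rho : R) z w : (1 <= K)%R -> (0 < rho)%R -> tent c rho z -> V K z w ->
  tent c (tentK K * rho) w.
Proof.
move=> K1 rho0 zt zw; have Kp : (0 < K)%R by lra.
have z0 : (0 < z.2)%R by case: zt.
have w0 := V_pos Kp z0 zw.
split => // x xw; rewrite /Defs.ballRn/=.
have r0 : (0 < (4 * K * n.+1%:R + 1) * rho)%R.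
  by have := tentK_gt0 K1; rewrite /tentK pmulr_rgt0// => ?; rewrite mulr_gt0.
apply: le_lt_trans (edist_le (ltW r0) _) _; last first.
  by rewrite /tentK -[ltRHS]mulrA ltr_pM2r// ltr_nat.
move=> i; have [h1 h2] := tent_coord i zt.
case: zw => [h3 [_ h4]]; have := h3 i; have := ballRn_cube xw i.
have := ler_distD (tnth w.1 i) (tnth x i) (tnth c i).
have := ler_distD (tnth z.1 i) (tnth w.1 i) (tnth c i).
have : (K * z.2 < K * (2 * n.+1%:R * rho))%R by rewrite ltr_pM2l.
set N := n.+1%:R; have -> : (K * (2 * N * rho) = 2 * (K * N * rho))%R by ring.
have -> : ((4 * K * N + 1) * rho = 4 * (K * N * rho) + rho)%R by ring.
lra.
Qed.

Lemma V_tent (K : R) z w : (1 <= K)%R -> Hp z -> V K z w ->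
  tent z.1 (n.+1%:R * (2 * K * z.2)) w.
Proof.
move=> K1 z0 zw; have Kp : (0 < K)%R by lra.
have t0 : (0 < z.2)%R by [].
have w0 := V_pos Kp z0 zw; split => // x xw; rewrite /Defs.ballRn/=.
have r0 : (0 < 2 * K * z.2)%R by rewrite !mulr_gt0.
apply: le_lt_trans (edist_le (ltW r0) _) _; last by rewrite ltr_pM2r// ltr_nat.
move=> i; case: zw => [h3 [_ h4]]; have := h3 i; have := ballRn_cube xw i.
have := ler_distD (tnth w.1 i) (tnth x i) (tnth z.1 i); lra.
Qed.

Lemma volRnE (A : set E) : measurable A -> volRn A = mu A.
Proof. by move=> mA; rewrite /volRn (intRnE (mnn_ind R mA).1 (mnn_ind R mA).2) int_mu. Qed.

Lemma volRn_ball_scale (K : R) c (rho : R) : (0 < K)%R -> (0 < rho)%R ->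
  volRn (ballRn c (K * rho)) <= ((2 * K) ^+ n / cB)%:E * volRn (ballRn c rho).
Proof.
move=> K0 rho0; rewrite !volRnE; try exact: measurable_ballRn.
apply: le_trans (mu_ballRn_le _ _) _; first exact: mulr_gt0.
have k0 : (0 <= (2 * K) ^+ n / cB)%R.
  by rewrite divr_ge0 ?(ltW (cB_gt0 R n))// exprn_ge0// mulr_ge0// ltW.
apply: le_trans (lee_wpmul2l _ (mu_ballRn_ge c rho0)); last by rewrite lee_fin.
rewrite -EFinM lee_fin le_eqVlt; apply/orP; left; apply/eqP.
by rewrite mulrA exprMn; field; rewrite gt_eqF// cB_gt0.
Qed.

Lemma volRn_ball_fin c (rho : R) : (0 < rho)%R -> volRn (ballRn c rho) < +oo.
Proof.
move=> r0; rewrite volRnE; last exact: measurable_ballRn.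
by apply: le_lt_trans (mu_ballRn_le _ r0) _; rewrite ltry.
Qed.

Variables (a1 a2 : R).
Hypothesis wp : whitney_param a1 a2.
Local Notation W := (@W R n a1 a2).
Local Notation G := (@G R n a1 a2).
Local Notation K1 := (@K1 R a2).
Local Notation K2 := (@K2 R a2).

Lemma Wavg_ge0 r f z : 0 < r -> Hp z -> 0 <= Wavg a1 a2 r f z.
Proof. by move=> r0 z0; rewrite -(@G_Hp R n a1 a2)//; exact: (G_ge0 wp). Qed.

Lemma tnorm_ge0 p r q f : 0 < p -> 0 < r -> 0 < q -> 0 <= tnorm a1 a2 p r q f.
Proof.
case: p => [p| |]// _ r0; case: q => [q| |]// _; rewrite /Defs.tnorm/=.
- exact: poweR_ge0.
- exact: poweR_ge0.
- pose c : E := [tuple of nseq n 0%R].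
  apply: (@le_trans _ _ (((fine (volRn (ballRn c 1%R))) `^ (- q^-1))%:E *
            poweR (intH (fun z =>
              ((\1_(tent c 1%R) z)%:E * poweR (Wavg a1 a2 r f z) q * (z.2^-1)%:E)%E)) q^-1)).
    by rewrite mule_ge0 ?lee_fin ?powR_ge0 ?poweR_ge0.
  apply: ereal_sup_ubound; exists c, c, 1%R; split => //.
  by rewrite /Defs.ballRn/= /Defs.edist big1 ?sqrtr0// => i _; rewrite subrr expr0n.
- apply: le_ereal_inf_tmp => M nM; rewrite leNgt; apply/negP => M0.
  pose z0 : pt := ([tuple of nseq n 0%R], 1%R).
  have h0 : Hp z0 by rewrite /Defs.Hp/=.
  have : nullH (W z0).
    apply: nullHS nM => z zW; have z1 := W_pos wp h0 zW; split => //.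
    by apply: lt_le_trans M0 _; exact: Wavg_ge0.
  move/(nullHP (measurable_W _ _ _)); rewrite setIidl; last by move=> w; exact: (W_pos wp).
  by apply/eqP; rewrite gt_eqF// nuW_gt0.
Qed.

(** Real bounds [A] and [B] yield membership in both spaces along with the inequality, and no
    product of zero and infinity has to be considered. *)
Lemma factor2_intro (p0 r0 q0 p1 r1 q1 p2 r2 q2 : \bar R) (C : R) :
  0 < p1 -> 0 < r1 -> 0 < q1 -> 0 < p2 -> 0 < r2 -> 0 < q2 ->
  (forall f0, cmeasurable f0 -> tnorm a1 a2 p0 r0 q0 f0 < +oo ->
    exists f1 f2 (A B : R), [/\ cmeasurable f1, cmeasurable f2,
      ae_absH (fun z => cabs (f0 z)) (fun z => cabs (f1 z) * cabs (f2 z))%R &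
      [/\ tnorm a1 a2 p1 r1 q1 f1 <= A%:E, tnorm a1 a2 p2 r2 q2 f2 <= B%:E &
        (A * B)%:E <= C%:E * tnorm a1 a2 p0 r0 q0 f0]]) ->
  factor2 a1 a2 n (p0, r0, q0) (p1, r1, q1) (p2, r2, q2).
Proof.
move=> p10 r10 q10 p20 r20 q20 H; exists C => f0 [mf0 lt0].
have [f1 [f2 [A [B [m1 m2 ae [N1 N2 AB]]]]]] := H f0 mf0 lt0.
exists f1, f2; split => //.
- by split => //; apply: le_lt_trans N1 _; exact: ltry.
- by split => //; apply: le_lt_trans N2 _; exact: ltry.
- apply: le_trans AB; rewrite EFinM; apply: lee_pmul => //; exact: tnorm_ge0.
Qed.

Section phi1_norms.
Variables (q : R) (q0 : (0 < q)%R) (r : \bar R) (r0 : 0 < r).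

Lemma phi1_norm_cone (p : R) : (0 < p)%R -> exists2 C : R, (0 <= C)%R &
  forall f, cmeasurable f -> tnorm a1 a2 p%:E r q%:E f < +oo ->
  (forall z, Hp z -> spread (fun w => G r f w `^ q) K1 z < +oo) /\
  tnorm a1 a2 p%:E +oo q%:E (realC (phi1 a2 q (G r f))) <=
    C%:E * tnorm a1 a2 p%:E r q%:E f.
Proof.
move=> p0; have k2 := K2_ge1 wp; have kp : (0 < K2)%R by lra.
have s0 : (0 < p / q)%R by rewrite divr_gt0.
pose l := ((1 + K2) * K2)%R.
have l0 : (0 < l)%R by rewrite mulr_gt0//; lra.
have [C C0 Ap] := @aperture R n (p / q) l s0 l0.
pose D := (a2 ^+ n.+1 * cS n K2 * K2 ^+ n.+1)%R.
have D0 : (0 <= D)%R.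
  by rewrite !mulr_ge0 ?exprn_ge0 ?mulr_ge0 ?(ltW kp) ?(ltW (a2_gt0 wp)).
exists ((D `^ (p / q) * C) `^ p^-1)%R; first exact: powR_ge0.
move=> f mf; rewrite !tnormA// => [fin|]; last first.
  by apply: cmeas_real; apply: measurable_phi1; exact: mnn_G.
have mg := mnn_G wp r0 mf; set g := G r f in mg fin *.
have mA := Acone_mnn (mnn_wq q mg).
have fin' : \int[mu]_x (Acone (wq q g) x `^ (p / q)) < +oo.
  rewrite ltey; apply: contraTneq fin => ->.
  by rewrite poweRyr ?invr_neq0 ?gt_eqF.
have finS z : Hp z -> spread (fun w => g w `^ q) K1 z < +oo.
  by move=> z0; exact: (spread_fin_cone wp mg s0 fin').
split => //.
have mG1 : mnn (G +oo (realC (phi1 a2 q g))).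
  by apply: (mnn_G wp) => //; apply: cmeas_real; exact: measurable_phi1.
have E1 : \int[mu]_x (Acone (wq q (G +oo (realC (phi1 a2 q g)))) x `^ (p / q)) <=
    (D `^ (p / q) * C)%:E * \int[mu]_x (Acone (wq q g) x `^ (p / q)).
  rewrite EFinM -muleA; apply: le_trans (lee_wpmul2l _ (Ap _ (mnn_wq q mg))); last first.
    by rewrite lee_fin powR_ge0.
  have mB := Acube_mnn l (mnn_wq q mg).
  rewrite -int_Zl ?lee_fin ?powR_ge0//; last exact: mnn_poweR.
  apply: int_le => [| |x].
  - by apply: mnn_poweR; apply: Acone_mnn; exact: mnn_wq.
  - by apply: mnn_mul; [apply: mnn_cst; rewrite lee_fin powR_ge0|exact: mnn_poweR].
  - rewrite -poweR_EFin -poweRM ?lee_fin//; last exact: mB.2.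
    apply: le_poweR; [exact: ltW|exact: (Acone_mnn (mnn_wq q mG1)).2|].
    exact: Acone_phi1.
apply: le_trans (le_poweR _ _ E1) _; first by rewrite invr_ge0 ltW.
  by apply: int_ge0; apply: mnn_poweR; apply: Acone_mnn; exact: mnn_wq.
rewrite poweRM ?poweR_EFin//; first by rewrite lee_fin mulr_ge0 ?powR_ge0.
by apply: int_ge0; exact: mnn_poweR.
Qed.

(** Spreading over [V K2] enlarges a tent by the factor [tentK K2] only ([tent_V]), and doubling
    absorbs it. The means are finite because [V K1 z] lies in a tent over a ball around [z.1], where
    the Carleson condition applies. *)
Lemma phi1_norm_tent : exists2 C : R, (0 <= C)%R &
  forall f, cmeasurable f -> tnorm a1 a2 +oo r q%:E f < +oo ->
  (forall z, Hp z -> spread (fun w => G r f w `^ q) K1 z < +oo) /\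
  tnorm a1 a2 +oo +oo q%:E (realC (phi1 a2 q (G r f))) <=
    C%:E * tnorm a1 a2 +oo r q%:E f.
Proof.
have k1 := K1_ge1 wp; have k1p : (0 < K1)%R by lra.
have k2 := K2_ge1 wp; have kp : (0 < K2)%R by lra.
pose L := tentK K2; have L0 : (0 < L)%R by exact: tentK_gt0.
pose D := (a2 ^+ n.+1 * cS n K2 * K2 * ((2 * L) ^+ n / cB))%R.
have cS0 : (0 <= a2 ^+ n.+1 * cS n K2)%R.
  by rewrite !mulr_ge0 ?exprn_ge0 ?mulr_ge0 ?(ltW kp) ?(ltW (a2_gt0 wp)).
have D0 : (0 <= D)%R.
  apply: mulr_ge0; first exact: (mulr_ge0 cS0 (ltW kp)).
  apply: divr_ge0; last exact: (ltW (cB_gt0 R n)).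
  by rewrite exprn_ge0//; lra.
exists (D `^ q^-1)%R; first exact: powR_ge0.
move=> f mf fin; have N0 := @tnorm_ge0 +oo r q%:E f (ltry _) r0 q0.
have [d dE] : exists d : R, tnorm a1 a2 +oo r q%:E f = d%:E.
  by exists (fine (tnorm a1 a2 +oo r q%:E f)); rewrite fineK// ge0_fin_numE.
rewrite dE lee_fin in N0; have ge := tnormB_ge wp q0 r0 mf dE.
have mg := mnn_G wp r0 mf; set g := G r f in mg ge *.
have mt := mnn_tw R n 1.
have mtg : mnn (fun z => tw 1 z * g z `^ q) by apply: mnn_mul => //; exact: mnn_poweR.
have mT c (rho : R) : mnn (ind R (tent c rho : set pt)).
  by apply: mnn_ind; exact: measurable_tent.
have finS z : Hp z -> spread (fun w => g w `^ q) K1 z < +oo.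
  move=> z0; have t0 : (0 < z.2)%R by [].
  rewrite /spread tw_Hp//; apply: lte_mul_pinfty; rewrite ?lee_fin ?invr_ge0 ?exprn_ge0 ?(ltW t0)//.
  pose rho := (n.+1%:R * (2 * K1 * z.2))%R.
  have rho0 : (0 < rho)%R by rewrite !mulr_gt0.
  apply: (@le_lt_trans _ _ ((K1 * z.2)%:E * tint q g z.1 rho)).
    rewrite /tint -int_Zl ?lee_fin ?mulr_ge0 ?(ltW k1p) ?(ltW t0)//; last exact: mnn_mul.
    apply: int_le => [| |w].
    - by apply: mnn_mul; [exact: mnn_V|exact: mnn_poweR].
    - apply: mnn_mul; last exact: mnn_mul.
      by apply: mnn_cst; rewrite lee_fin mulr_ge0// ltW.
    - have [zw|zw] := pselect (V K1 z w); last first.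
        rewrite ind_out// mul0e mule_ge0//; first by rewrite lee_fin mulr_ge0// ltW.
        by rewrite mule_ge0 ?ind_ge0//; exact: mtg.2.
      have w0 : (0 < w.2)%R := V_pos k1p z0 zw.
      rewrite (ind_in R zw) (ind_in R (V_tent k1 z0 zw)) !mul1e tw_Hp// muleA -EFinM.
      rewrite -[leLHS]mul1e; apply: lee_wpmul2r; first exact: poweR_ge0.
      rewrite lee_fin expr1 ler_pdivlMr// mul1r.
      by case: zw => [_ [_ /ltW]].
  apply: lte_mul_pinfty; rewrite ?lee_fin ?mulr_ge0 ?(ltW k1p) ?(ltW t0)//.
  apply: le_lt_trans (ge _ _ rho0) _.
  by apply: lte_mul_pinfty; rewrite ?lee_fin ?powR_ge0 ?volRn_ball_fin.
split => //; rewrite dE -EFinM.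
apply: (tnormB_le wp) => //.
- by apply: cmeas_real; exact: measurable_phi1.
- by rewrite mulr_ge0 ?powR_ge0.
move=> c rho rho0.
apply: (@le_trans _ _ ((a2 ^+ n.+1 * cS n K2)%:E * (K2%:E * tint q g c (L * rho)))).
  rewrite (_ : tint _ _ c rho = \int[nu]_z (ind R (tent c rho) z * tw 1 z *
      G +oo (realC (phi1 a2 q g)) z `^ q)); last first.
    by apply: eq_integral => z _; rewrite muleA.
  rewrite -int_Zl ?lee_fin ?(ltW kp)//; last exact: mnn_mul.
  rewrite [X in _ <= _ * X](_ : _ = \int[nu]_w (K2%:E *
      (ind R (tent c (L * rho)) w * tw 1 w) * g w `^ q)); last first.
    by apply: eq_integral => w _; rewrite -!muleA.
  apply: (int_phi1_le wp) => //.
  - exact: mnn_mul.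
  - by apply: mnn_mul; [apply: mnn_cst; rewrite lee_fin ltW|exact: mnn_mul].
  - by move=> z z0; rewrite tw_out// mule0.
  - move=> z w z0 zw; have w0 := V_pos kp z0 zw.
    have [xz|xz] := pselect (tent c rho z); last first.
      rewrite ind_out// mul0e; apply: mule_ge0; first by rewrite lee_fin ltW.
      by apply: mule_ge0; [exact: ind_ge0|exact: mt.2].
    rewrite (ind_in R xz) (ind_in R (tent_V k2 rho0 xz zw)) !mul1e -[K2 in leRHS]expr1.
    by apply: tw_le => //; case: zw => [_ [_ /ltW]].
apply: (@le_trans _ _ ((a2 ^+ n.+1 * cS n K2)%:E * (K2%:E * ((d `^ q)%:E *
    (((2 * L) ^+ n / cB)%:E * volRn (ballRn c rho)))))).
  apply: lee_wpmul2l; first by rewrite lee_fin.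
  apply: lee_wpmul2l; first by rewrite lee_fin ltW.
  apply: le_trans (ge _ _ _) _; first exact: mulr_gt0.
  by apply: lee_wpmul2l; [rewrite lee_fin powR_ge0|exact: volRn_ball_scale].
rewrite powRM ?powR_ge0// -powRrM mulVf ?gt_eqF// powRr1//.
rewrite !muleA -!EFinM (_ : (a2 ^+ n.+1 * cS n K2 * K2 * d `^ q * ((2 * L) ^+ n / cB) = D * d `^ q)%R)//.
by rewrite /D; ring.
Qed.

Lemma factor_first_finite p : 0 < p ->
  factor2 a1 a2 n (p, r, q%:E) (p, +oo, q%:E) (+oo, r, +oo).
Proof.
move=> p0; have [C C0 H] : exists2 C : R, (0 <= C)%R &
  forall f, cmeasurable f -> tnorm a1 a2 p r q%:E f < +oo ->
  (forall z, Hp z -> spread (fun w => G r f w `^ q) K1 z < +oo) /\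
  tnorm a1 a2 p +oo q%:E (realC (phi1 a2 q (G r f))) <=
    C%:E * tnorm a1 a2 p r q%:E f.
  by case: p p0 => [p| |]// p0; [exact: phi1_norm_cone|exact: phi1_norm_tent].
have [C' C'0 H'] := phi1_lower n wp q0 r0.
apply: (@factor2_intro _ _ _ _ _ _ _ _ _ (C * C')%R) => // f mf fin.
have [finS N1] := H f mf fin; have lower := H' f mf finS.
have N0 := @tnorm_ge0 p r q%:E f p0 r0 q0.
have [d dE] : exists d : R, tnorm a1 a2 p r q%:E f = d%:E.
  by exists (fine (tnorm a1 a2 p r q%:E f)); rewrite fineK// ge0_fin_numE.
have mg := mnn_G wp r0 mf.
have mphi := measurable_phi1 a2 q mg.
have phi0 := phi1_ge0 a2 q (G r f).
exists (realC (phi1 a2 q (G r f))), (quo f (phi1 a2 q (G r f))), (C * d)%R, C'.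
split.
- exact: cmeas_real.
- exact: cmeas_quo.
- apply: (quo_factor wp mf phi0 r0) => z z0 pz.
  apply/eqP; rewrite eq_le (G_ge0 wp)// andbT.
  by have := lower z z z0 (W_self wp z0); rewrite pz mulr0.
- split.
  + by rewrite EFinM -dE.
  + apply: (tnormD_le r0); first exact: cmeas_quo.
    by move=> z z0; apply: (G_quo_bounded wp mf mphi phi0 r0).
  + by rewrite dE -EFinM lee_fin mulrAC.
Qed.

End phi1_norms.

End FirstFactorizationFinite.

(** * The second factorization *)

Section SecondFactorization.
Variables (R : realType) (n : nat).
Local Notation E := (n.-tuple R).
Local Notation mu := (@mu R n).
Local Notation Hp := (@Hp R n).
Local Notation pt := (pt R n).
Local Notation cB := (cB R n).
Local Notation cone := (@cone R n).
Local Notation ballRn := (@ballRn R n).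
Local Notation tw := (@tw R n).
Local Notation tnorm := (@tnorm R).
Implicit Types (z w : pt) (f : pt -> R[i]) (x y c : E).

Variables (a1 a2 : R).
Hypothesis wp : whitney_param a1 a2.
Local Notation W := (@W R n a1 a2).
Local Notation G := (@G R n a1 a2).
Let a2p : (0 < a2)%R. Proof. exact: a2_gt0 wp. Qed.
Let a21 : (1 < a2)%R. Proof. exact: a2_gt1 wp. Qed.

(** Large enough for two inclusions in the cube around [w]: the balls of the points [z] whose box
    contains [w] need [2 * a2], and those of the points of [V K0 w], in [phi2_eq0], need twice
    [K0]. *)
Definition lam : R := (2 * @K0 R a2)%R.

Let lam2 : (2 * a2 <= lam)%R. Proof. by rewrite /lam /K0; have := a2p; lra. Qed.
Let lamp : (0 < lam)%R. Proof. by have := a2p; have := lam2; lra. Qed.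

Lemma ball_W_cube z w : Hp z -> W z w -> ballRn z.1 z.2 `<=` cube w.1 (lam * w.2).
Proof.
move=> z0 Ww x xz i; have t0 : (0 < z.2)%R by [].
have w0 := W_pos wp z0 Ww; have := lam2 => l2.
have a11 : (a1 < 1)%R by case: wp => _ h1 h2; exact: lt_trans h1 h2.
case: Ww => [h1 [h2 _]].
have zw : (z.2 < a2 * w.2)%R by rewrite -ltr_pdivrMl.
have := ballRn_cube xz i; have := le_lt_trans (edist_coord w.1 z.1 i) h1.
rewrite (distrC (tnth w.1 i)).
have := ler_distD (tnth z.1 i) (tnth x i) (tnth w.1 i).
have : (a1 * z.2 < z.2)%R by rewrite gtr_pMl.
have : (2 * a2 * w.2 <= lam * w.2)%R by rewrite ler_pM2r.
lra.
Qed.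

Section average.
Variables (b : R) (b0 : (0 < b)%R) (A : E -> \bar R).
Hypothesis mA : mnn A.
Let a x := A x `^ b.
Let ma : mnn a. Proof. exact: mnn_poweR. Qed.

Definition avg2 w : \bar R :=
  (((2 * lam) ^+ n)^-1)%:E *
  (tw n w * \int[mu]_x (ind R (cube w.1 (lam * w.2)) x * A x `^ b)).

(* The factor in T^{p,oo}_oo is an [L^b]-mean of the area functional [A], [b = p/2]:
   its cone supremum is controlled by the maximal function of [A ^ b], which is in
   L^2 however small p is. *)
Definition phi2 w : R := (fine (avg2 w) `^ b^-1)%R.

Lemma avg2E w : Hp w -> avg2 w = cavg a w.1 (lam * w.2).
Proof.
move=> w0; have t0 : (0 < w.2)%R by [].
rewrite /avg2 /cavg tw_Hp// (int_restrict mu _ (@measurable_cube R n w.1 (lam * w.2))).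
rewrite muleA -EFinM; congr (_%:E * _).
by rewrite mulrA [((2 * lam * _) ^+ n)%R]exprMn invfM.
Qed.

Lemma mnn_avg2 : mnn avg2.
Proof.
apply: mnn_mul; first by apply: mnn_cst; rewrite lee_fin invr_ge0 exprn_ge0// mulr_ge0// ltW.
apply: mnn_mul; first exact: mnn_tw.
apply: (@mnn_int1 R _ _ _ _ mu (fun (w : pt) x => ind R (cube w.1 (lam * w.2)) x * a x)).
apply: mnn_mul; last exact: mnn_comp ma _.
apply: mnn_ind2; apply: measurable_in_cube => //.
  exact: (measurableT_comp measurable_fst measurable_fst).
by apply: measurable_funM => //; exact: (measurableT_comp measurable_snd measurable_fst).
Qed.

Lemma phi2_ge0 w : (0 <= phi2 w)%R. Proof. exact: powR_ge0. Qed.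

Lemma measurable_phi2 : measurable_fun setT phi2.
Proof.
apply: (measurableT_comp (@measurable_powR R b^-1)).
apply: (@measurableT_comp _ _ _ _ _ _ (fine : \bar R -> R)).
  by apply: fine_measurable.
exact: mnn_avg2.1.
Qed.

Lemma phi2_le z x w : cone x z -> W z w ->
  ((phi2 w)%:E <= ((2 ^+ n)%:E * maxf a x) `^ b^-1).
Proof.
move=> /coneE[z0 xz] Ww; have w0 := W_pos wp z0 Ww.
rewrite /phi2 -poweR_EFin; apply: le_poweR.
- by rewrite invr_ge0 ltW.
- by rewrite lee_fin; apply: fine_ge0; exact: mnn_avg2.2.
have M0 : 0 <= (2 ^+ n)%:E * maxf a x.
  by rewrite mule_ge0 ?lee_fin ?exprn_ge0//; exact: (maxf_mnn ma).2.
have : avg2 w <= (2 ^+ n)%:E * maxf a x.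
  rewrite avg2E//; apply: cavg_le_maxf => //; first exact: mulr_gt0.
  exact: ball_W_cube z0 Ww _ xz.
by move: (mnn_avg2.2 w); case: (avg2 w).
Qed.

(** The constant that [quant] needs for the ball of [z] inside the cube of radius [lam * w.2], which
    is less than [lam * a2] times the height of [z]. *)
Definition kq : R := (2 * (2 * (lam * a2)) ^+ n / cB)%R.

Let kqp : (0 < kq)%R.
Proof.
by rewrite divr_gt0 ?cB_gt0// mulr_gt0// exprn_gt0// mulr_gt0// mulr_gt0.
Qed.

Hypothesis fin : forall w, Hp w -> avg2 w < +oo.

Lemma avg2_fin w : Hp w -> avg2 w = (phi2 w `^ b)%:E.
Proof.
move=> w0; have h := mnn_avg2.2 w.
rewrite /phi2 -powRrM mulVf ?gt_eqF// powRr1 ?fine_ge0//.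
by rewrite fineK// ge0_fin_numE// fin.
Qed.

Lemma quant_phi2 (psi : E -> \bar R) z w (L : \bar R) : mnn psi -> 0 <= L ->
  Hp z -> W z w ->
  (forall x, ballRn z.1 z.2 x -> A x <= (kq `^ b^-1 * phi2 w)%:E -> L <= psi x) ->
  L * mu (ballRn z.1 z.2) <= 2%:E * \int[mu]_x (ind R (ballRn z.1 z.2) x * psi x).
Proof.
move=> mpsi L0 z0 Ww H; have w0 := W_pos wp z0 Ww; have t0 : (0 < z.2)%R by [].
have wz : (w.2 < a2 * z.2)%R by case: Ww => [_ [_ ]].
apply: (quant ma mpsi (y := w.1) (r := (lam * w.2)%R) (k := kq)) => //.
- exact: mulr_gt0.
- exact: measurable_ballRn.
- exact: ball_W_cube.
- apply: (@le_trans _ _ (kq%:E * (cB * z.2 ^+ n)%:E)); last first.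
    by apply: lee_wpmul2l; [rewrite lee_fin ltW|exact: mu_ballRn_ge].
  have -> : (kq%:E * (cB * z.2 ^+ n)%:E = (2 * (2 * (lam * a2) * z.2) ^+ n)%:E :> \bar R).
    rewrite -EFinM; congr (_%:E); rewrite /kq [LHS]mulrA divfK ?gt_eqF ?cB_gt0//.
    by rewrite [in RHS]exprMn [RHS]mulrA.
  have h1 : (0 < lam * w.2)%R by exact: mulr_gt0.
  have h2 : (lam * w.2 <= lam * a2 * z.2)%R by rewrite -[leRHS]mulrA ler_pM2l// ltW.
  rewrite lee_fin ler_pM2l// lerXn2r ?nnegrE//; rewrite -?[(2 * _ * z.2)%R]mulrA; lra.
- move=> x Bx; rewrite -avg2E// avg2_fin// => le; apply: H => //.
  have -> : A x = a x `^ b^-1.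
    by rewrite /a -poweRrM mulfV ?gt_eqF// poweRe1//; exact: mA.2.
  apply: (@le_trans _ _ ((kq * phi2 w `^ b)%:E `^ b^-1)).
    by apply: le_poweR => //; [rewrite invr_ge0 ltW|exact: poweR_ge0].
  rewrite poweR_EFin lee_fin powRM ?(ltW kqp) ?powR_ge0// -powRrM mulfV ?gt_eqF//.
  by rewrite powRr1 ?phi2_ge0.
Qed.

End average.

(** On a set of finite measure, [v <= 1 + v ^ 2] plays the part of Hölder's inequality. *)
Lemma avg2_lty (b : R) (A : E -> \bar R) w : mnn A -> Hp w ->
  \int[mu]_x (A x `^ (b * 2)) < +oo -> avg2 b A w < +oo.
Proof.
move=> mA w0 fin; have t0 : (0 < w.2)%R by [].
have ml : mnn (ind R (cube w.1 (lam * w.2))) by apply: mnn_ind; exact: measurable_cube.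
have l0 : (0 < lam * w.2)%R by rewrite mulr_gt0.
have c0 : (0 <= ((2 * lam) ^+ n)^-1)%R by rewrite invr_ge0 exprn_ge0//; have := lamp; lra.
apply: lte_mul_pinfty; rewrite ?lee_fin//.
rewrite tw_Hp//; apply: lte_mul_pinfty; rewrite ?lee_fin ?invr_ge0 ?exprn_ge0 ?(ltW t0)//.
apply: (@le_lt_trans _ _ (\int[mu]_x (ind R (cube w.1 (lam * w.2)) x + A x `^ (b * 2)))).
  apply: int_le => [| |x].
  - by apply: mnn_mul => //; exact: mnn_poweR.
  - by apply: mnn_add => //; exact: mnn_poweR.
  have [xw|xw] := pselect (cube w.1 (lam * w.2) x); last first.
    by rewrite ind_out// mul0e add0e poweR_ge0.
  rewrite ind_in// mul1e poweRrM; move: (poweR_ge0 (A x) b); case: (A x `^ b) => [v| |]//= v0.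
    rewrite -EFinD lee_fin powR_mulrn//.
    by rewrite lee_fin in v0; have := sqr_ge0 (v - 1)%R; rewrite sqrrB1; lra.
  by rewrite pnatr_eq0 addey.
rewrite int_D//; last exact: mnn_poweR.
rewrite int_mu; last exact: measurable_cube.
by rewrite mu_cube// lte_add_pinfty// ltry.
Qed.

Lemma phi2_norm (p : R) : (0 < p)%R -> exists2 C : R, (0 <= C)%R &
  forall A : E -> \bar R, mnn A ->
  tnorm a1 a2 p%:E +oo +oo (realC (phi2 (p / 2) A)) <=
    C%:E * (\int[mu]_x (A x `^ p)) `^ p^-1.
Proof.
move=> p0; pose b := (p / 2)%R; have b0 : (0 < b)%R by rewrite divr_gt0.
have [C C0 M] := @maxf_Lp R n 2 (ltr1n _ 2).
have pb : (p = b * 2)%R by rewrite /b; lra.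
pose D := ((2 ^+ n) `^ 2 * C)%R.
have D0 : (0 <= D)%R by rewrite mulr_ge0 ?powR_ge0.
exists (D `^ p^-1)%R; first exact: powR_ge0.
move=> A mA; have ma : mnn (fun x => A x `^ b) by exact: mnn_poweR.
have mM := maxf_mnn ma.
have mc : cmeasurable (realC (phi2 b A)) by apply: cmeas_real; exact: measurable_phi2.
rewrite tnormC ?ltry// -poweR_EFin -poweRM ?lee_fin//; last first.
  by apply: int_ge0; exact: mnn_poweR.
rewrite -/b; have mG := mnn_G wp (ltry 0) mc.
have mS := @mnn_cone_sup R n (G +oo (realC (phi2 b A))) (fun z _ => mG.2 z).
apply: le_poweR; first by rewrite invr_ge0 ltW.
  by apply: int_ge0; exact: mnn_poweR.
have M0 x : 0 <= (2 ^+ n)%:E * maxf (fun x => A x `^ b) x.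
  by rewrite mule_ge0 ?lee_fin ?exprn_ge0//; exact: mM.2.
apply: (@le_trans _ _ (\int[mu]_x (((2 ^+ n) `^ 2)%:E * maxf (fun x => A x `^ b) x `^ 2))).
  apply: int_le => [| |x].
  - exact: mnn_poweR.
  - by apply: mnn_mul; [apply: mnn_cst; rewrite lee_fin powR_ge0|exact: mnn_poweR].
  rewrite -poweR_EFin -poweRM ?lee_fin ?exprn_ge0//; last exact: mM.2.
  (* The exponent 2 is [b^-1 * p]: the cone supremum is controlled by the maximal function to the
     power [b^-1], and then raised to the power [p]. *)
  rewrite [X in _ <= _ `^ X](_ : _ = (b^-1 * p)%R); last by rewrite pb mulKf ?gt_eqF.
  rewrite poweRrM; apply: le_poweR; [exact: ltW|exact: mS.2|].
  apply: ge_ereal_sup => _ [z xz <-].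
  have z0 : Hp z by case: xz.
  have := fun w => @phi2_le b b0 A mA z x w xz.
  move: (poweR_ge0 ((2 ^+ n)%:E * maxf (fun x => A x `^ b) x) b^-1).
  case: (_ `^ _) => [v| |]// v0 H; last by rewrite leey.
  apply: (G_oo_le wp) => // w Ww; rewrite cabs_real ?phi2_ge0//.
  by rewrite -lee_fin; exact: H.
rewrite int_Zl ?lee_fin ?powR_ge0//; last exact: mnn_poweR.
rewrite /D EFinM -muleA; apply: lee_wpmul2l; first by rewrite lee_fin powR_ge0.
apply: le_trans (M _ ma) _.
rewrite le_eqVlt; apply/orP; left; apply/eqP; congr (_ * _).
by apply: eq_integral => x _; rewrite -poweRrM -pb.
Qed.

End SecondFactorization.

Section SecondFactorizationProof.
Variables (R : realType) (n : nat).
Local Notation E := (n.-tuple R).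
Local Notation mu := (@mu R n).
Local Notation nu := (@nu R n).
Local Notation Hp := (@Hp R n).
Local Notation pt := (pt R n).
Local Notation cB := (cB R n).
Local Notation cone := (@cone R n).
Local Notation tent := (@tent R n).
Local Notation ballRn := (@ballRn R n).
Local Notation V := (@V R n).
Local Notation tnorm := (@tnorm R).
Implicit Types (z w : pt) (f : pt -> R[i]) (x y c : E).

Variables (a1 a2 : R).
Hypothesis wp : whitney_param a1 a2.
Local Notation W := (@W R n a1 a2).
Local Notation G := (@G R n a1 a2).
Local Notation kq := (@kq R n a2).

Let kq_gt0 (b : R) : (0 < kq `^ b)%R.
Proof.
have a2p := a2_gt0 wp; apply: powR_gt0.
rewrite divr_gt0 ?cB_gt0// mulr_gt0// exprn_gt0// mulr_gt0// mulr_gt0// mulr_gt0//.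
by have := K0_gt1 wp; lra.
Qed.

Lemma mu_ball_gt0 z : Hp z -> 0 < mu (ballRn z.1 z.2).
Proof.
move=> z0; apply: lt_le_trans (mu_ballRn_ge _ z0).
by rewrite lte_fin mulr_gt0 ?cB_gt0// exprn_gt0.
Qed.

Lemma poweR_fin_num (x : \bar R) (p : R) : (0 < p)%R -> 0 <= x -> x `^ p^-1 < +oo -> x < +oo.
Proof.
move=> p0 x0; rewrite !ltey; apply: contra_neq => ->.
by rewrite poweRyr ?invr_neq0 ?gt_eqF.
Qed.

(** Here [A] is the supremum over cones, so [G r f z] is at most [A x] for all [x] in the ball of
    [z]. If [G r f z] exceeded [k] times the mean, no point of the ball would satisfy the Chebyshev
    bound, and [quant_phi2] with [L = 1] and [psi = 0] would make the ball null. *)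
Lemma factor_sup (p : R) r : (0 < p)%R -> 0 < r ->
  factor2 a1 a2 n (p%:E, r, +oo) (p%:E, +oo, +oo) (+oo, r, +oo).
Proof.
move=> p0 r0; have [C C0 H] := @phi2_norm R n a1 a2 wp p p0.
pose b := (p / 2)%R; have b0 : (0 < b)%R by rewrite divr_gt0.
have pb : (b * 2 = p)%R by rewrite /b; lra.
pose k := (kq `^ b^-1)%R; have k0 : (0 < k)%R := kq_gt0 b^-1.
apply: (@factor2_intro _ _ _ _ wp _ _ _ _ _ _ _ _ _ (C * k)%R) => // f mf fin.
have N0 := @tnorm_ge0 R n a1 a2 wp p%:E r +oo f p0 r0 (ltry _).
have [d dE] : exists d : R, tnorm a1 a2 p%:E r +oo f = d%:E.
  by exists (fine (tnorm a1 a2 p%:E r +oo f)); rewrite fineK// ge0_fin_numE.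
have mg := mnn_G wp r0 mf.
pose A : E -> \bar R := fun x => ereal_sup (G r f @` cone x).
have mA : mnn A := @mnn_cone_sup R n (G r f) (fun z _ => mg.2 z).
have AE : tnorm a1 a2 p%:E r +oo f = (\int[mu]_x (A x `^ p)) `^ p^-1 by exact: tnormC.
have Af : \int[mu]_x (A x `^ (b * 2)) < +oo.
  by rewrite pb; apply: (poweR_fin_num p0); [apply: int_ge0; exact: mnn_poweR|rewrite -AE].
have finA w : Hp w -> avg2 a2 b A w < +oo by move=> w0; exact: (avg2_lty wp).
have mphi := @measurable_phi2 R n a1 a2 wp b A mA.
have phi0 := phi2_ge0 a2 b A.
have lower z w : Hp z -> W z w -> G r f z <= (k * phi2 a2 b A w)%:E.
  move=> z0 Ww; rewrite leNgt; apply/negP => lt.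
  have := @quant_phi2 R n a1 a2 wp b b0 A mA finA (fun=> 0) z w 1 (mnn_cst _ (lexx 0)) lee01 z0 Ww.
  rewrite (_ : \int[mu]_x _ = 0); last by apply: integral0_eq => x _; rewrite mule0.
  rewrite mule0 mul1e => Q; suff : mu (ballRn z.1 z.2) <= 0 by rewrite leNgt mu_ball_gt0.
  apply: Q => x xz /le_lt_trans/(_ lt); rewrite ltNge => /negP[].
  by apply: ereal_sup_ubound; exists z => //; exact/coneE.
exists (realC (phi2 a2 b A)), (quo f (phi2 a2 b A)), (C * d)%R, k.
split.
- exact: cmeas_real.
- exact: cmeas_quo.
- apply: (quo_factor wp mf phi0 r0) => z z0 pz.
  apply/eqP; rewrite eq_le (G_ge0 wp)// andbT.
  by have := lower z z z0 (W_self wp z0); rewrite pz mulr0.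
- split.
  + by rewrite EFinM -dE AE; exact: H.
  + apply: (tnormD_le r0); first exact: cmeas_quo.
    by move=> z z0; apply: (G_quo_bounded wp mf mphi phi0 r0).
  + by rewrite dE -EFinM lee_fin mulrAC.
Qed.

Section second_finite.
Variables (p q : R) (p0 : (0 < p)%R) (q0 : (0 < q)%R) (r : \bar R) (r0 : 0 < r).
Variables (f : pt -> R[i]) (mf : cmeasurable f).
Let g := G r f.
Let mg : mnn g. Proof. exact: (mnn_G wp). Qed.
Let S := Acone (wq q g).
Let mS : mnn S. Proof. exact/Acone_mnn/mnn_wq. Qed.

Definition coneA x : \bar R := Acone (wq q (G r f)) x `^ q^-1.
Let mA : mnn coneA. Proof. exact: mnn_poweR. Qed.

Lemma tnorm_coneA : tnorm a1 a2 p%:E r q%:E f = (\int[mu]_x (coneA x `^ p)) `^ p^-1.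
Proof.
rewrite tnormA//; congr (_ `^ _); apply: eq_integral => x _.
by rewrite /coneA -poweRrM mulrC.
Qed.

Let b := (p / 2)%R.
Let b0 : (0 < b)%R. Proof. by rewrite divr_gt0. Qed.
Let phi := phi2 a2 b coneA.
Let phi0 z : (0 <= phi z)%R. Proof. exact: phi2_ge0. Qed.
Let mphi : measurable_fun setT phi. Proof. exact: (measurable_phi2 wp). Qed.
Hypothesis fin : forall w, Hp w -> avg2 a2 b coneA w < +oo.
Let k := (kq `^ b^-1)%R.
Let k0 : (0 < k)%R. Proof. exact: kq_gt0. Qed.
Let lamp : (0 < lam a2)%R.
Proof. by rewrite mulr_gt0//; have := K0_gt1 wp; lra. Qed.

(** A zero mean makes the area functional vanish almost everywhere on the cube [Q]. By Tonelli's
    theorem [g] then vanishes almost everywhere among the points whose ball lies in [Q], in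
    particular on [V K0 w], and the sub-mean value inequality gives the vanishing at [w] itself. *)
Lemma phi2_eq0 w : Hp w -> phi w = 0%R -> g w = 0.
Proof.
move=> w0 pw; have t0 : (0 < w.2)%R by [].
have := @avg2_fin R n a1 a2 wp b b0 coneA mA fin w w0.
rewrite -/phi pw powR0 ?gt_eqF// /avg2 tw_Hp// => /eqP.
have c1 : (((2 * lam a2) ^+ n)^-1 != 0)%R by rewrite gt_eqF// invr_gt0 exprn_gt0// mulr_gt0.
have c2 : (w.2 ^- n != 0)%R by rewrite gt_eqF// invr_gt0 exprn_gt0.
rewrite !mule_eq0 !eqe (negbTE c1) (negbTE c2)/= => /eqP I0.
set Q := cube w.1 (lam a2 * w.2) in I0.
have mQ : mnn (ind R Q) by apply: mnn_ind; exact: measurable_cube.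
have mQA : mnn (fun x => ind R Q x * coneA x `^ b) by apply: mnn_mul => //; exact: mnn_poweR.
have mQS : mnn (fun x => ind R Q x * S x) by exact: mnn_mul.
have m0 d (T : measurableType d) (h : T -> \bar R) : mnn h -> measurable [set x | h x != 0].
  by move=> mh; have := emeasurable_neq measurableT mh.1 0; rewrite setTI.
have I1 : \int[mu]_x (ind R Q x * S x) = 0.
  apply: int_null0 => //; apply: (subset_measure0 (m0 _ _ _ mQS) (m0 _ _ _ mQA) _ (int_eq0 mQA I0)).
  move=> x /=; apply: contra_neq => /eqP; rewrite mule_eq0 => /orP[/eqP->|].
    by rewrite mul0e.
  rewrite /coneA -poweRrM => /eqP /(poweR_eq0_eq0 (mS.2 x)) S0.
  by rewrite S0 mule0.
rewrite (weight_Acone mQ (mnn_wq q mg)) in I1.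
pose h z := ind R Hp z * wq q g z * \int[mu]_x (ind R (ballRn z.1 z.2) x * ind R Q x).
have mh : mnn h.
  apply: mnn_mul.
    by apply: mnn_mul; [apply: mnn_ind; exact: measurable_Hp|exact: mnn_wq].
  apply: (@mnn_int1 R _ _ _ _ mu (fun (z : pt) x => ind R (ballRn z.1 z.2) x * ind R Q x)).
  apply: mnn_mul; last exact: mnn_comp mQ _.
  by apply: mnn_ind2; exact: measurable_in_ball.
have [C C0 sub] := G_submean n wp r0 q0.
have V0 : \int[nu]_z (ind R (V (@K0 R a2) w) z * g z `^ q) = 0.
  have mV : mnn (fun z => ind R (V (@K0 R a2) w) z * g z `^ q).
    by apply: mnn_mul; [exact: mnn_V|exact: mnn_poweR].
  apply: int_null0 => //; apply: (subset_measure0 (m0 _ _ _ mV) (m0 _ _ _ mh) _ (int_eq0 mh I1)).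
  move=> z /=; apply: contra_neq => hz.
  have [wz|wz] := pselect (V (@K0 R a2) w z); last by rewrite ind_out// mul0e.
  have K00 : (0 < @K0 R a2)%R by have := K0_gt1 wp; lra.
  have z0 : Hp z := V_pos K00 w0 wz.
  have zQ : ballRn z.1 z.2 `<=` Q.
    move=> x xz i; have := ballRn_cube xz i; case: wz => [h1 [_ h3]]; have := h1 i.
    have := ler_distD (tnth z.1 i) (tnth x i) (tnth w.1 i).
    by rewrite /lam -mulrA; lra.
  move/eqP: hz; rewrite /h ind_in// mul1e; rewrite (_ : \int[mu]_x _ = mu (ballRn z.1 z.2)).
    rewrite /wq tw_Hp// !mule_eq0 (gt_eqF (mu_ball_gt0 z0)) orbF eqe gt_eqF.
      by move=> /eqP->; rewrite mule0.
    by rewrite invr_gt0 exprn_gt0.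
  rewrite -int_mu; last exact: measurable_ballRn.
  apply: eq_integral => x _; have [xz|xz] := pselect (ballRn z.1 z.2 x).
    by rewrite !ind_in ?mul1e//; exact: zQ.
  by rewrite ind_out// mul0e.
have := sub f w mf w0; rewrite -/g V0 mule0 pmule_rle0 ?lte_fin ?exprn_gt0// => gq.
apply/eqP; rewrite eq_le (mg.2 w) andbT leNgt; apply/negP => gw.
by move: gq; rewrite leNgt poweR_gt0.
Qed.

(** [quant_phi2] with [psi] the inverse of [S] bounds [phi] from below by the same number at all
    points of the Whitney box, so this number can be taken out of the average of the quotient. *)
Lemma G_quo_phi2_le z : Hp z ->
  G r (quo f phi) z `^ q * mu (ballRn z.1 z.2) <=
  (2 * k `^ q)%:E * (g z `^ q * \int[mu]_x (ind R (ballRn z.1 z.2) x * (S x)^-1)).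
Proof.
move=> z0; have [gz0|gz0] := eqVneq (g z) 0.
  rewrite (G_quo_eq0 wp mf mphi phi0 r0 z0 gz0) gz0 poweR0r ?gt_eqF//.
  by rewrite !mul0e mule0.
have gp : 0 < g z by rewrite lt_neqAle eq_sym gz0 (mg.2 z).
have gqp : 0 < g z `^ q by exact: poweR_gt0.
have mB := measurable_ballRn z.1 z.2.
have mBp := mu_ball_gt0 z0.
have mI : mnn (fun x => (S x)^-1) by exact: mnn_inve.
have J0 : 0 <= \int[mu]_x (ind R (ballRn z.1 z.2) x * (S x)^-1).
  by apply: int_ge0; apply: mnn_mul => //; exact: mnn_ind.
have kq0 : (0 < k `^ q)%R by exact: powR_gt0.
have quant w : W z w -> ((k * phi w) `^ q)%:E^-1 * mu (ballRn z.1 z.2) <=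
    2%:E * \int[mu]_x (ind R (ballRn z.1 z.2) x * (S x)^-1).
  move=> Ww; apply: (quant_phi2 wp b0 mA fin mI _ z0 Ww).
    by rewrite inve_ge0 lee_fin powR_ge0.
  move=> x xz le; have Sx : S x <= ((k * phi w) `^ q)%:E.
    have -> : S x = coneA x `^ q.
      by rewrite /coneA -poweRrM mulVf ?gt_eqF// poweRe1//; exact: mS.2.
    rewrite -poweR_EFin; apply: le_poweR => //; [exact: ltW|exact: poweR_ge0].
  have := @inve_le_scale R 1%R (S x) _ ltr01 (mS.2 x) _.
  move=> /(_ ((k * phi w) `^ q)%:E); rewrite !mul1e lee_fin powR_ge0; exact.
move: J0 quant; set J := \int[mu]_x _; case: J => [J| |]// J0 quant; last first.
  by rewrite gt0_muley// gt0_muley ?leey// lte_fin mulr_gt0.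
have [m mE] : exists m : R, mu (ballRn z.1 z.2) = m%:E.
  exists (fine (mu (ballRn z.1 z.2))); rewrite fineK// ge0_fin_numE//.
  by apply: le_lt_trans (mu_ballRn_le _ z0) _; exact: ltry.
rewrite mE in mBp quant *; rewrite lte_fin in mBp.
have phip w : W z w -> (0 < phi w)%R.
  move=> Ww; rewrite lt_neqAle phi0 andbT eq_sym; apply/eqP => pw.
  have := quant w Ww; rewrite pw mulr0 powR0 ?gt_eqF// inve0 gt0_mulye ?lte_fin//.
have quant' w : W z w -> (m <= 2 * J * (k * phi w) `^ q)%R.
  move=> Ww; have kp : (0 < (k * phi w) `^ q)%R.
    by apply: powR_gt0; apply: mulr_gt0 => //; exact: phip.
  have := quant w Ww; rewrite inver gt_eqF// -!EFinM lee_fin.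
  by rewrite mulrC ler_pdivrMr.
have Jp : (0 < J)%R.
  rewrite lt_neqAle -lee_fin J0 andbT eq_sym; apply/eqP => J00.
  by have := quant' z (W_self wp z0); rewrite J00 mulr0 mul0r leNgt mBp.
(* The common lower bound for [phi] on the box, obtained by solving [quant'] for [phi w]. *)
pose mm := ((m / (2 * J)) `^ q^-1 / k)%R.
have mm0 : (0 < mm)%R by rewrite divr_gt0// powR_gt0// divr_gt0// mulr_gt0.
have mmq : (mm `^ q = m / (2 * J) / k `^ q)%R.
  rewrite powRM ?powR_ge0 ?invr_ge0 ?(ltW k0)// -powRrM mulVf ?gt_eqF// powRr1.
    by congr (_ * _)%R; rewrite -powR_inv1 ?(ltW k0)// -powRrM mulN1r powRN.
  by rewrite divr_ge0 ?ltW// mulr_gt0.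
have le : G r (quo f phi) z <= (mm^-1)%:E * g z.
  apply: (G_quo_le wp mf mphi phi0 r0 z0 mm0) => w Ww.
  have k1 : (0 <= k * phi w)%R by rewrite mulr_ge0 ?(ltW k0).
  have -> : (phi w = ((k * phi w) `^ q) `^ q^-1 / k)%R.
    by rewrite -powRrM mulfV ?gt_eqF// powRr1// mulrC mulKf// gt_eqF.
  apply: ler_wpM2r; first by rewrite invr_ge0 ltW.
  apply: ge0_ler_powR.
  - by rewrite invr_ge0 ltW.
  - by rewrite nnegrE divr_ge0 ?ltW// mulr_gt0.
  - by rewrite nnegrE; exact: powR_ge0.
  - by rewrite ler_pdivrMr ?mulr_gt0// mulrC; exact: quant'.
apply: (@le_trans _ _ (((mm^-1)%:E * g z) `^ q * m%:E)).
  apply: lee_wpmul2r; first by rewrite lee_fin ltW.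
  by apply: le_poweR => //; [exact: ltW|exact: (G_ge0 wp)].
rewrite poweRM ?lee_fin ?invr_ge0 ?(ltW mm0)//; last exact: mg.2.
rewrite poweR_EFin -powR_inv1 ?(ltW mm0)// -powRrM mulN1r powRN mmq.
rewrite muleC muleA -EFinM (muleC (g z `^ q)) muleA -EFinM.
apply: lee_wpmul2r; first exact: poweR_ge0.
rewrite lee_fin le_eqVlt; apply/orP; left; apply/eqP.
by field; rewrite !gt_eqF.
Qed.

(** For [z] in the tent, the ball of [z] lies in the base, so the inverse of [S] may be cut off to
    the base. Tonelli's theorem backwards then reassembles [S] itself, and the product of [S] with
    its inverse is at most 1. *)
Lemma tint_quo_phi2 c (rho : R) : (0 < rho)%R ->
  tint q (G r (quo f phi)) c rho <= (2 * k `^ q / cB)%:E * volRn (ballRn c rho).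
Proof.
move=> rho0; have cBp := cB_gt0 R n.
have C0 : (0 <= 2 * k `^ q / cB)%R by rewrite divr_ge0 ?(ltW cBp)// mulr_ge0// powR_ge0.
have mf2 : cmeasurable (quo f phi) by exact: cmeas_quo.
have mg2 := mnn_G wp r0 mf2.
have mBc := measurable_ballRn c rho.
have mI : mnn (fun x => (S x)^-1) by exact: mnn_inve.
pose psi x := ind R (ballRn c rho) x * (S x)^-1.
have mpsi : mnn psi by apply: mnn_mul => //; exact: mnn_ind.
pose h z := ind R Hp z * wq q g z * \int[mu]_x (ind R (ballRn z.1 z.2) x * psi x).
have mh : mnn h.
  apply: mnn_mul.
    by apply: mnn_mul; [apply: mnn_ind; exact: measurable_Hp|exact: mnn_wq].
  apply: (@mnn_int1 R _ _ _ _ mu (fun (z : pt) x => ind R (ballRn z.1 z.2) x * psi x)).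
  apply: mnn_mul; last exact: mnn_comp mpsi _.
  by apply: mnn_ind2; exact: measurable_in_ball.
apply: (@le_trans _ _ (\int[nu]_z ((2 * k `^ q / cB)%:E * h z))).
  apply: int_le => [| |z].
  - apply: mnn_mul; first by apply: mnn_ind; exact: measurable_tent.
    by apply: mnn_mul; [exact: mnn_tw|exact: mnn_poweR].
  - by apply: mnn_mul => //; apply: mnn_cst; rewrite lee_fin.
  have [zt|zt] := pselect (tent c rho z); last first.
    by rewrite ind_out// mul0e mule_ge0 ?lee_fin//; exact: mh.2.
  have z0 : Hp z by case: zt.
  have t0 : (0 < z.2)%R by [].
  rewrite ind_in// mul1e tw_Hp// /h ind_in// mul1e.
  rewrite (_ : \int[mu]_x _ = \int[mu]_x (ind R (ballRn z.1 z.2) x * (S x)^-1)); last first.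
    apply: eq_integral => x _; have [xz|xz] := pselect (ballRn z.1 z.2 x).
      by rewrite /psi [X in _ * (X * _)]ind_in ?mul1e//; case: zt => _; exact.
    by rewrite ind_out// !mul0e.
  have := G_quo_phi2_le z0; set J := \int[mu]_x _ => le.
  have zn : (0 < z.2 ^+ n)%R by rewrite exprn_gt0.
  have le2 : G r (quo f phi) z `^ q * (cB * z.2 ^+ n)%:E <= (2 * k `^ q)%:E * (g z `^ q * J).
    apply: le_trans le; apply: lee_wpmul2l; first exact: poweR_ge0.
    exact: mu_ballRn_ge.
  have c1 : (0 <= (cB * z.2 ^+ n.+1)^-1)%R by rewrite invr_ge0 mulr_ge0 ?exprn_ge0 ?ltW.
  (* Dividing by [cB * z.2 ^+ n.+1] leaves the tent weight [z.2 ^- 1] on the left and creates the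
     weight of [wq] on the right. *)
  have := @lee_wpmul2l R (cB * z.2 ^+ n.+1)^-1%:E _ _ _ le2.
  rewrite lee_fin => /(_ c1).
  rewrite [X in X <= _ -> _]muleCA -EFinM.
  rewrite (_ : ((cB * z.2 ^+ n.+1)^-1 * (cB * z.2 ^+ n) = z.2 ^- 1)%R); last first.
    by rewrite expr1 exprS; field; rewrite !gt_eqF.
  rewrite muleC => /le_trans; apply.
  rewrite /wq tw_Hp// !muleA -!EFinM le_eqVlt; apply/orP; left; apply/eqP.
  congr (_%:E * _ * _); by field; rewrite !gt_eqF// exprn_gt0.
rewrite int_Zl ?lee_fin//; apply: lee_wpmul2l; first by rewrite lee_fin.
rewrite -(weight_Acone mpsi (mnn_wq q mg)) volRnE// -int_mu//.
apply: int_le => [| |x].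
- exact: mnn_mul.
- exact: mnn_ind.
rewrite /psi -muleA -[leRHS]mule1; apply: lee_wpmul2l; first exact: ind_ge0.
(* The product of [S] and its inverse is 0 where [S] is 0 or infinite, and 1 elsewhere. *)
rewrite -/S; move: (mS.2 x); case: (S x) => [v| |]// v0; last by rewrite invey mul0e.
rewrite inver; case: eqVneq => [->|v1]; first by rewrite mule0.
by rewrite -EFinM mulVf.
Qed.

End second_finite.

Lemma factor_second_finite (p q : R) r : (0 < p)%R -> (0 < q)%R -> 0 < r ->
  factor2 a1 a2 n (p%:E, r, q%:E) (p%:E, +oo, +oo) (+oo, r, q%:E).
Proof.
move=> p0 q0 r0; have [C C0 H] := @phi2_norm R n a1 a2 wp p p0.
pose b := (p / 2)%R; have pb : (b * 2 = p)%R by rewrite /b; lra.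
have cBp := cB_gt0 R n.
pose D := (2 * (kq `^ b^-1) `^ q / cB)%R.
have D0 : (0 <= D)%R by rewrite divr_ge0 ?(ltW cBp)// mulr_ge0// powR_ge0.
pose k := (D `^ q^-1)%R.
apply: (@factor2_intro _ _ _ _ wp _ _ _ _ _ _ _ _ _ (C * k)%R) => // f mf fin.
have N0 := @tnorm_ge0 R n a1 a2 wp p%:E r q%:E f p0 r0 q0.
have [d dE] : exists d : R, tnorm a1 a2 p%:E r q%:E f = d%:E.
  by exists (fine (tnorm a1 a2 p%:E r q%:E f)); rewrite fineK// ge0_fin_numE.
have mg := mnn_G wp r0 mf.
have mA : mnn (coneA q r f) by apply: mnn_poweR; apply: Acone_mnn; exact: mnn_wq.
have AE := tnorm_coneA p0 q0 r0 mf.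
have Af : \int[mu]_x (coneA q r f x `^ (b * 2)) < +oo.
  by rewrite pb; apply: (poweR_fin_num p0); [apply: int_ge0; exact: mnn_poweR|rewrite -AE].
have finA w : Hp w -> avg2 a2 b (coneA q r f) w < +oo by move=> w0; exact: (avg2_lty wp).
have mphi := @measurable_phi2 R n a1 a2 wp b _ mA.
have phi0 := phi2_ge0 a2 b (coneA q r f).
exists (realC (phi2 a2 b (coneA q r f))), (quo f (phi2 a2 b (coneA q r f))), (C * d)%R, k.
split.
- exact: cmeas_real.
- exact: cmeas_quo.
- by apply: (quo_factor wp mf phi0 r0) => z z0; exact: phi2_eq0.
- split.
  + by rewrite EFinM -dE AE; exact: H.
  + apply: (tnormB_le wp) => //; [exact: cmeas_quo|exact: powR_ge0|].
    move=> c rho rho0; rewrite -powRrM mulVf ?gt_eqF// powRr1//.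
    exact: tint_quo_phi2.
  + by rewrite dE -EFinM lee_fin mulrAC.
Qed.

End SecondFactorizationProof.

(** * Degenerate exponents and composition of factorizations *)

Section Assembly.
Variables (R : realType) (n : nat).
Local Notation pt := (pt R n).
Local Notation tnorm := (@tnorm R).
Variables (a1 a2 : R).
Hypothesis wp : whitney_param a1 a2.
Implicit Types (p q r : \bar R) (f : pt -> R[i]).

(** With [p] infinite the first factor only has to be bounded, and the constant 1 serves. *)
Lemma factor_one q r : 0 < q -> 0 < r ->
  factor2 a1 a2 n (+oo, r, q) (+oo, +oo, +oo) (+oo, r, q).
Proof.
move=> q0 r0; apply: (@factor2_intro _ _ _ _ wp _ _ _ _ _ _ _ _ _ 1%R) => // f mf fin.
have N0 := @tnorm_ge0 R n a1 a2 wp +oo r q f (ltry _) r0 q0.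
have m1 : cmeasurable (realC (fun _ : pt => 1%R : R)) by exact: cmeas_real.
exists (realC (fun=> 1%R)), f, 1%R, (fine (tnorm a1 a2 +oo r q f)).
have dE : (fine (tnorm a1 a2 +oo r q f))%:E = tnorm a1 a2 +oo r q f.
  by rewrite fineK// ge0_fin_numE.
split => //.
- apply: nullHS (nullH_set0 R n) => z [_]; apply.
  by rewrite /realC cabs_real// mul1r.
- split.
  + apply: tnormD_le => // z z0; apply: (G_oo_le wp) => // w _.
    by rewrite /realC cabs_real.
  + by rewrite dE.
  + by rewrite EFinM dE.
Qed.

Lemma factor_first p q r : 0 < p -> 0 < q -> 0 < r ->
  factor2 a1 a2 n (p, r, q) (p, +oo, q) (+oo, r, +oo).
Proof.
move=> p0; case: q => [q| |]// q0 r0; first exact: factor_first_finite.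
case: p p0 => [p| |]// p0; first exact: factor_sup.
exact: factor_one.
Qed.

Lemma factor_second p q r : 0 < p -> 0 < q -> 0 < r ->
  factor2 a1 a2 n (p, r, q) (p, +oo, +oo) (+oo, r, q).
Proof.
case: p => [p| |]// p0; case: q => [q| |]// q0 r0.
- exact: factor_second_finite.
- exact: factor_sup.
- exact: factor_one.
- exact: factor_one.
Qed.

Lemma factor2_comp (X0 X1 X2 Y1 Y2 : tsp R) :
  (forall f, 0 <= tN a1 a2 X0 f) -> (forall f, 0 <= tN a1 a2 X1 f) ->
  (forall f, 0 <= tN a1 a2 X2 f) ->
  factor2 a1 a2 n X0 X1 X2 -> factor2 a1 a2 n X1 Y1 Y2 ->
  factor3 a1 a2 n X0 Y1 Y2 X2.
Proof.
(* The constant of a factorization may be any real; replacing [D] by its positive part keeps the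
   inequality and allows it to multiply the other one. *)
move=> N0 N1 N2 [C H] [D H']; exists (Num.max 0 D * C)%R => f0 T0.
have [f1 [f2 [T1 T2 ae le]]] := H f0 T0.
have [g1 [g2 [S1 S2 ae' le']]] := H' f1 T1.
exists g1, g2, f2; split => //.
  apply: nullHS (nullHU ae ae') => z [z0 ne].
  have [e|e] := pselect (cabs (f0 z) = (cabs (f1 z) * cabs (f2 z))%R); last by left.
  by right; split => // e'; apply: ne; rewrite e e'.
have D0 : 0 <= (Num.max 0 D)%R%:E :> \bar R by rewrite lee_fin le_max lexx.
apply: le_trans (lee_wpmul2r (N2 f2) le') _.
apply: (@le_trans _ _ ((Num.max 0 D)%R%:E * tN a1 a2 X1 f1 * tN a1 a2 X2 f2)).
  apply: lee_wpmul2r => //; apply: lee_wpmul2r => //.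
  by rewrite lee_fin le_max lexx orbT.
by rewrite -muleA EFinM -[leRHS]muleA; exact: lee_wpmul2l.
Qed.

End Assembly.

End TentSpaceFactorization.

(* Exponent triple (p, r, q) encodes the space T^{p,r}_q. *)
Theorem theorem3p2 (R : realType) (n : nat) (a1 a2 : R)
  (ha1 : 0 < a1) (ha12 : a1 < a2^-1) (ha2 : a2^-1 < 1)
  (p0 q0 r0 : \bar R) (hp0 : ((0%R)%:E < p0)%E) (hq0 : ((0%R)%:E < q0)%E) (hr0 : ((0%R)%:E < r0)%E) :
  [/\ factor2 a1 a2 n (p0, r0, q0) (p0, +oo%E, q0) (+oo%E, r0, +oo%E),
      factor2 a1 a2 n (p0, r0, q0) (p0, +oo%E, +oo%E) (+oo%E, r0, q0) &
      factor3 a1 a2 n (p0, r0, q0) (p0, +oo%E, +oo%E) (+oo%E, +oo%E, q0)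
                                   (+oo%E, r0, +oo%E)].
Proof.
have wp : whitney_param a1 a2 by [].
split.
- exact: factor_first.
- exact: factor_second.
- apply: (factor2_comp _ _ _ (factor_first n wp hp0 hq0 hr0)
    (factor_second n wp hp0 hq0 (ltry 0))) => f.
  + exact: (tnorm_ge0 wp).
  + by apply: (tnorm_ge0 wp) => //; exact: ltry.
  + by apply: (tnorm_ge0 wp) => //; exact: ltry.
Qed.
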